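(* Let $Z$ denote $\mathbb{Z}$ (with the standard norm) or a finite field (with the trivial norm). Let $\mathcal{R}$ be a measured standard equivalence relation on a standard Borel probability space $(X,\mu)$, let $n\in\mathbb{N}$, and let $D_*$ be a marked projective $Z\mathcal{R}$-resolution of $L^\infty(X,\mu,Z)$ (up to degree $n+1$). If $\Gamma$ is a countable group of type $\mathrm{FP}_{n+1}$ and $\alpha$ is a standard probability action of $\Gamma$ on $(X,\mu)$ that induces $\mathcal{R}$ (i.e., $\mathcal{R}$ is the orbit relation of $\alpha$), then $$\mathrm{medim}^Z_n(\alpha)\le\dim_{Z\mathcal{R}}(D_n)\qquad\text{and}\qquad\mathrm{mevol}_n(\alpha)\le\mathrm{lognorm}(\partial^D_{n+1})\ \text{ if }Z=\mathbb{Z}.$$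
   Context: $\mathbb{N}$ contains $0$; the trivial norm is $|0|=0$, $|x|=1$ for $x\neq0$. A group $\Gamma$ is of type $\mathrm{FP}_m$ if the trivial $\mathbb{Z}\Gamma$-module $\mathbb{Z}$ has a projective resolution that is finitely generated in degrees $\le m$. A measured standard equivalence relation is a Borel equivalence relation $\mathcal{R}\subset X\times X$ with countable classes preserving $\mu$. On $\mathcal{R}$ let $\nu(A)=\int_X\#(A\cap(\{x\}\times X))\,d\mu(x)$. The equivalence relation ring is $$Z\mathcal{R}=\{\lambda\in L^\infty(\mathcal{R},\nu,Z)\mid \sup_x\#\{y\mid\lambda(x,y)\ne0\}<\infty,\ \sup_y\#\{x\mid\lambda(x,y)\neq0\}<\infty\}$$ (suprema taken almost everywhere) with product $(\lambda\cdot\lambda')(x,y)=\sum_{w\in[x]_{\mathcal{R}}}\lambda(x,w)\lambda'(w,y)$. $L^\infty(X,\mu,Z)$ (essentially bounded measurable functions $X\to Z$ modulo a.e. equality, also written $L^\infty(\alpha,Z)$) embeds in $Z\mathcal{R}$ as functions supported on the diagonal, and is a $Z\mathcal{R}$-module via $(\lambda\cdot f)(x)=\sum_{y\in[x]_{\mathcal{R}}}\lambda(x,y)f(y)$. A standard action $\alpha\colon\Gamma\curvearrowright(X,\mu)$ is an essentially free, probability measure preserving action of a countable group on a standard Borel probability space. Its crossed product ring $L^\infty(\alpha,Z)*\Gamma$ is the free $L^\infty(\alpha,Z)$-module with basis $\Gamma$ with product $(\lambda,\gamma)(\lambda',\gamma')=(\lambda\cdot(\gamma\cdot\lambda'),\gamma\gamma')$,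 where $(\gamma\cdot\lambda)(x)=\lambda(\gamma^{-1}x)$; it contains $Z\Gamma$ via $\gamma\mapsto(1,\gamma)$. It is a subring of $Z\mathcal{R}$ ($\mathcal{R}$ the orbit relation of $\alpha$): $(\lambda,\gamma)$ corresponds to the function with value $\lambda(\gamma x)$ at $(\gamma x,x)$ and $0$ elsewhere. In the following $S$ is $Z\mathcal{R}$ or $L^\infty(\alpha,Z)*\Gamma$. For measurable $A\subset X$ put $\langle A\rangle=S\cdot\chi_A$. A marked projective $S$-module is an $S$-module $M$ with a finite family $(A_i)_{i\in I}$ of measurable subsets of $X$ and an isomorphism $M\cong\bigoplus_{i\in I}\langle A_i\rangle$; $\dim_S(M)=\sum_i\mu(A_i)$. On $S\subset Z\mathcal{R}$ use $|\lambda|_1=\int_{\mathcal{R}}|\lambda|\,d\nu$; elements of $M\subset\bigoplus_IS$ have norm $\|\sum_i\lambda_ie_i\|_1=\sum_i|\lambda_i|_1$. For an $S$-homomorphism $f\colon M\to N$ of marked projective modules, $\|f\|$ is the least $c$ with $\|f(z)\|_1\le c\|z\|_1$ for all $z$ (always finite). A marked direct summand of $\bigoplus_j\langle B_j\rangle$ is a submodule $\bigoplus_j\langle B_j'\rangle$ with $B_j'\subset B_j$ measurable. A finite marked decomposition of $M=\bigoplus_i\langle A_i\rangle$ is a finite family $(M_k)_k$ with $M_k=\bigoplus_i\langle A_{i,k}\rangle$ for measurable partitions $A_i=\bigsqcup_kA_{i,k}$. $\log_+(t)=\max\{\log t,0\}$ (and $\log_+0=0$). $\mathrm{rk}(f)=\inf\{\dim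 N'\mid N'\subset N\text{ marked direct summand with }f(M)\subset N'\}$; $\mathrm{lognorm}'(f)=\min\{\dim(M)\log_+\|f\|,\mathrm{rk}(f)\log_+\|f\|\}$; $\mathrm{lognorm}(f)=\inf\sum_k\mathrm{lognorm}'(f|_{M_k}\colon M_k\to N)$ over all finite marked decompositions $(M_k)_k$ of $M$. A marked projective augmented $S$-chain complex $D_*\twoheadrightarrow L^\infty(\alpha,Z)$ is a chain complex $(D_k)_{k\ge0}$ of marked projective $S$-modules with a surjective $S$-homomorphism $\eta\colon D_0\to L^\infty(\alpha,Z)$, $\eta\circ\partial_1=0$. A marked projective $Z\mathcal{R}$-resolution up to degree $n+1$ is an exact sequence $D_{n+1}\to D_n\to\dots\to D_0\to L^\infty(X,\mu,Z)\to0$ of marked projective $Z\mathcal{R}$-modules. Let $R=L^\infty(\alpha,Z)*\Gamma$. Fix a free $Z\Gamma$-resolution $C_*\twoheadrightarrow Z$ (the following is independent of the choice). An $\alpha$-embedding (up to degree $n$) is a marked projective augmented $R$-chain complex $D_*\twoheadrightarrow L^\infty(\alpha,Z)$ together with a $Z\Gamma$-chain map $C_*\to D_*$ up to degree $n+1$ extending the inclusion $Z\to L^\infty(\alpha,Z)$ as constant functions; $A_n(\alpha)$ is the class of all such $D_*$. $\mathrm{medim}^Z_n(\alpha)=\inf_{D_*\in A_n(\alpha)}\dim_R(D_n)$ and (for $Z=\mathbb{Z}$) $\mathrm{mevol}_n(\alpha)=\inf_{D_*\in A_n(\alpha)}\mathrm{lognorm}(\partial^D_{n+1})$, with $\mathrm{lognorm}$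 taken over $R$. *)

(* Defs.v *)
From HB Require Import structures.
From mathcomp Require Import all_boot all_order all_algebra.
From mathcomp Require Import generic_quotient ring_quotient.
From mathcomp Require Import all_classical all_reals all_analysis.
Set Implicit Arguments.
Unset Strict Implicit.
Unset Printing Implicit Defensive.
Import Order.TTheory GRing.Theory Num.Theory.
Local Open Scope classical_set_scope.
Local Open Scope ring_scope.

(* The coefficient rings allowed are the integers, with the absolute value, and
   the finite fields, with the trivial norm. *)
Inductive coefficient : Type := CoefInt | CoefFin of finFieldType.

Definition coef_ring (c : coefficient) : countComNzRingType :=
  match c with CoefInt => int | CoefFin F => F end.
Coercion coef_ring : coefficient >-> countComNzRingType.

Definition coef_norm (R : realType) (c : coefficient) : c -> R :=
  match c return c -> R with
  | CoefInt => fun z : int => `|z|%:~R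
  | CoefFin F => fun z : F => (z != 0)%:R
  end.
Arguments coef_norm R {c}.

Section CoefNorm.
Variables (R : realType) (Z : coefficient).
Implicit Types a b : Z.

Lemma coef_norm_ge0 a : 0 <= coef_norm R a.
Proof. by move: a; case: Z => [|F] a /=; rewrite ?ler0z ?ler0n. Qed.

Lemma coef_norm0 : coef_norm R (0 : Z) = 0.
Proof. by case: Z => [|F] /=; rewrite ?normr0// eqxx. Qed.

Lemma coef_normN a : coef_norm R (- a) = coef_norm R a.
Proof. by move: a; case: Z => [|F] a /=; rewrite ?normrN// oppr_eq0. Qed.

Lemma coef_normD a b : coef_norm R (a + b) <= coef_norm R a + coef_norm R b.
Proof.
move: a b; case: Z => [|F] a b /=; first by rewrite -intrD ler_int ler_normD.
have [->|a0] := eqVneq a 0; first by rewrite !add0r.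
by case: (a + b != 0); case: (b != 0); rewrite -?natrD ler_nat.
Qed.

Lemma coef_normM a b : coef_norm R (a * b) = coef_norm R a * coef_norm R b.
Proof.
move: a b; case: Z => [|F] a b /=; first by rewrite normrM intrM.
by rewrite mulf_eq0 negb_or -natrM mulnb.
Qed.

End CoefNorm.


Section CountableValues.
Context d (X : measurableType d) (Z : coefficient).

Lemma preimage_op2_measurable (op : Z -> Z -> Z) (f g : X -> Z) (B : set Z) :
  (forall B : set Z, measurable (f @^-1` B)) ->
  (forall B : set Z, measurable (g @^-1` B)) ->
  measurable ((fun x => op (f x) (g x)) @^-1` B).
Proof.
move=> mf mg.
rewrite (_ : _ @^-1` _ = \bigcup_(p in [set p : Z * Z | B (op p.1 p.2)])
    (f @^-1` [set p.1] `&` g @^-1` [set p.2])); last first.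
  apply/seteqP; split => x /=; first by exists (f x, g x).
  by move=> [[a b] /= Bab [-> ->]].
rewrite bigcup_mkcond; apply: countable_bigcupT_measurable.
  exact: countableP.
by move=> p; case: ifPn => _ //; exact: measurableI.
Qed.

End CountableValues.

Section Linf.
Context d (X : measurableType d) (R : realType) (mu : probability X R).
Variable Z : coefficient.
Implicit Types f g : X -> Z.

(* Z carries the discrete sigma-algebra. *)
Definition is_linf f :=
  (forall B : set Z, measurable (f @^-1` B)) /\
  exists c : R, {ae mu, forall x, coef_norm R (f x) <= c}.

Definition linf_pred : {pred X -> Z} := fun f => `[< is_linf f >].

Let is_linf2 (op : Z -> Z -> Z) (k : R -> R -> R) f g :
  (forall a b x y, coef_norm R a <= x -> coef_norm R b <= y ->
     coef_norm R (op a b) <= k x y) ->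
  is_linf f -> is_linf g -> is_linf (fun x => op (f x) (g x)).
Proof.
move=> opk [mf [c fc]] [mg [c' gc]]; split.
  by move=> B; exact: preimage_op2_measurable.
by exists (k c c'); move: fc gc; apply: filterS2 => x; exact: opk.
Qed.

Lemma is_linf_cst (z : Z) : is_linf (fun=> z).
Proof.
split=> [B|]; last by exists (coef_norm R z); apply: nearW.
rewrite (_ : _ @^-1` _ = if `[< B z >] then setT else set0).
  by case: ifP.
by case: asboolP => Bz; apply/seteqP; split.
Qed.

Fact linf_subring : subring_closed linf_pred.
Proof.
split; first by apply/asboolP; exact: is_linf_cst.
- move=> f g /asboolP lf /asboolP lg; apply/asboolP.
  apply: (@is_linf2 (fun a b => a - b) (fun a b => a + b)) => // a b x y ax ly.
  by rewrite (le_trans (coef_normD _ _ _))// coef_normN lerD.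
- move=> f g /asboolP lf /asboolP lg; apply/asboolP.
  apply: (@is_linf2 (fun a b => a * b) (fun a b => a * b)) => // a b x y ax ly.
  by rewrite coef_normM ler_pM// coef_norm_ge0.
Qed.
HB.instance Definition _ := GRing.isSubringClosed.Build (X -> Z) linf_pred
  linf_subring.

Record linf_fun := LinfFun { linf_val :> X -> Z ; _ : linf_pred linf_val }.
HB.instance Definition _ := [isSub for linf_val].
HB.instance Definition _ := [Choice of linf_fun by <:].
HB.instance Definition _ := [SubChoice_isSubComNzRing of linf_fun by <:].

Definition linf_null : {pred linf_fun} :=
  fun u => `[< {ae mu, forall x, u x = 0} >].

Fact linf_null_ideal : idealr_closed linf_null.
Proof.
split.
- by apply/asboolP/nearW.
- apply/asboolP => /= h.
  have : {ae mu, forall x : X, False}.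
    by apply: filterS h => x /eqP; rewrite oner_eq0.
  move=> [A [mA A0 sA]].
  have AT : A = setT by apply/seteqP; split => // x _; apply: sA => /=.
  by move: A0; rewrite AT probability_setT => /eqP; rewrite eqe oner_eq0.
- move=> a u v /asboolP u0 /asboolP v0; apply/asboolP.
  by move: u0 v0; apply: filterS2 => x u0 v0;
     rewrite -[LHS]/(a x * u x + v x) u0 v0 mulr0 addr0.
Qed.
HB.instance Definition _ := isIdealr.Build linf_fun linf_null linf_null_ideal.

Definition Linf : Type := {ideal_quot linf_null}.
HB.instance Definition _ := GRing.ComNzRing.on Linf.

(* For f outside of L^oo, linf_class f is 0. *)
Definition linf_class f : Linf := \pi_Linf%qT (insubd (0 : linf_fun) f).
Definition linf_repr (a : Linf) : X -> Z := linf_val (repr a).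

End Linf.

Section MeasuredEquivalence.
Context d (X : measurableType d) (R : realType) (mu : probability X R).

(* meq_preserving: every partial Borel isomorphism f : A -> B, with inverse g,
   whose graph lies in the relation preserves mu. *)
Record measured_equivalence := MeasuredEquivalence {
  meq_rel : set (X * X);
  meq_measurable : measurable meq_rel;
  meq_refl : forall x, meq_rel (x, x);
  meq_sym : forall x y, meq_rel (x, y) -> meq_rel (y, x);
  meq_trans : forall x y z, meq_rel (x, y) -> meq_rel (y, z) -> meq_rel (x, z);
  meq_countable : forall x, countable [set y | meq_rel (x, y)];
  meq_preserving : forall (A B : set X) (f g : X -> X),
    measurable A -> measurable B -> measurable_fun A f -> measurable_fun B g ->
    (forall x, A x -> [/\ B (f x), g (f x) = x & meq_rel (x, f x)]) ->
    (forall y, B y -> A (g y) /\ f (g y) = y) ->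
    mu A = mu B }.

(* The measure nu of a relation E on its Borel subsets, extended to X * X by 0
   off E. Countable additivity is a theorem for a measured equivalence relation
   (it uses Lusin-Novikov) and is not needed for the integral of the library to
   be defined. *)
Definition nu (E : set (X * X)) (A : set (X * X)) : \bar R :=
  (\int[mu]_x counting (xsection (A `&` E) x))%E.

End MeasuredEquivalence.

Section ZR.
Context d (X : measurableType d) (R : realType) (mu : probability X R).
Variables (Z : coefficient) (E : measured_equivalence mu).
Implicit Types lam : X * X -> Z.

Definition l1norm (E' : set (X * X)) lam : \bar R :=
  (\int[nu mu E']_(p in E') (coef_norm R (lam p))%:E)%E.

Definition supp_card (a : X -> Z) : \bar R := counting [set y | a y != 0].

(* A function on the relation E is represented by its extension by 0 to X * X.
   A property holds nu-almost everywhere on E iff for mu-almost every x it holds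
   at (x, y) for all y in the class of x: nu of a set is the integral of the
   cardinality of its fibres. *)
Definition is_zr lam :=
  [/\ forall p, lam p != 0 -> meq_rel E p,
      forall B : set Z, measurable (lam @^-1` B),
      exists c : R, \forall x \ae mu, forall y, meq_rel E (x, y) ->
        coef_norm R (lam (x, y)) <= c,
      exists N : nat, \forall x \ae mu,
        (supp_card (fun y => lam (x, y)) <= N%:R%:E)%E &
      exists N : nat, \forall y \ae mu,
        (supp_card (fun x => lam (x, y)) <= N%:R%:E)%E].

Definition zr_pred : {pred X * X -> Z} := fun lam => `[< is_zr lam >].

Let counting_sub (a b : X -> Z) (N M : nat) :
  (forall B : set Z, measurable (a @^-1` B)) ->
  (forall B : set Z, measurable (b @^-1` B)) ->
  (supp_card a <= N%:R%:E)%E -> (supp_card b <= M%:R%:E)%E ->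
  (supp_card (fun y => (a y - b y)%R) <= (N + M)%:R%:E)%E.
Proof.
move=> ma mb aN bM.
have mA : measurable [set y | a y != 0] by exact: (ma [set z | z != 0]).
have mB : measurable [set y | b y != 0] by exact: (mb [set z | z != 0]).
apply: (@le_trans _ _
  (counting ([set y | a y != 0] `|` [set y | b y != 0]) : \bar R)).
  apply: le_measure; rewrite ?inE.
  - exact: (preimage_op2_measurable (fun u v => u - v) [set z | z != 0] ma mb).
  - exact: measurableU.
  - move=> y /=; have [->|] := eqVneq (a y) 0; last by left.
    by rewrite sub0r oppr_eq0; right.
rewrite natrD EFinD; apply: (le_trans _ (leeD aN bM)).
exact: (measureU2 _ mA mB).
Qed.

Fact zr_zmod_closed : zmod_closed zr_pred.
Proof.
split=> [|l1 l2 /asboolP[s1 m1 [c1 b1] [N1 r1] [M1 k1]]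
              /asboolP[s2 m2 [c2 b2] [N2 r2] [M2 k2]]].
  apply/asboolP; split.
  - by move=> p /=; rewrite eqxx.
  - move=> B; rewrite (_ : _ @^-1` _ = if `[< B (0 : Z) >] then setT else set0).
      by case: ifP.
    by case: asboolP => Bz; apply/seteqP; split.
  - by exists 0; apply: nearW => x y _ /=; rewrite coef_norm0.
  - exists 0%N; apply: nearW => x.
    by rewrite /supp_card (_ : [set _ | _] = set0) ?measure0//; apply/seteqP; split => y //=;
       rewrite eqxx.
  - exists 0%N; apply: nearW => x.
    by rewrite /supp_card (_ : [set _ | _] = set0) ?measure0//; apply/seteqP; split => y //=;
       rewrite eqxx.
have row (l : X * X -> Z) x : (forall B, measurable (l @^-1` B)) ->
    forall B : set Z, measurable ((fun y => l (x, y)) @^-1` B).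
  move=> ml B; have := measurable_xsection x (ml B).
  by congr (measurable _); apply/seteqP; split => y; rewrite /xsection/= inE.
have col (l : X * X -> Z) y : (forall B, measurable (l @^-1` B)) ->
    forall B : set Z, measurable ((fun x => l (x, y)) @^-1` B).
  move=> ml B; have := measurable_ysection y (ml B).
  by congr (measurable _); apply/seteqP; split => x; rewrite /ysection/= inE.
apply/asboolP; split.
- move=> p; have [//|nE] := pselect (meq_rel E p).
  have z1 : l1 p = 0 by apply/eqP/negPn/negP => /s1.
  have z2 : l2 p = 0 by apply/eqP/negPn/negP => /s2.
  by rewrite /= [X in X != 0](_ : _ = l1 p - l2 p)// z1 z2 subrr eqxx.
- by move=> B; exact: (preimage_op2_measurable (fun a b => a - b) B m1 m2).
- exists (c1 + c2); move: b1 b2; apply: filterS2 => x h1 h2 y Exy.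
  rewrite (le_trans (coef_normD _ _ _))// coef_normN lerD//; [exact: h1|exact: h2].
- exists (N1 + N2)%N; move: r1 r2; apply: filterS2 => x h1 h2.
  by apply: counting_sub h1 h2; exact: row.
- exists (M1 + M2)%N; move: k1 k2; apply: filterS2 => x h1 h2.
  by apply: counting_sub h1 h2; exact: col.
Qed.
HB.instance Definition _ := GRing.isZmodClosed.Build (X * X -> Z) zr_pred
  zr_zmod_closed.

Record zr_fun := ZrFun { zr_val :> X * X -> Z ; _ : zr_pred zr_val }.
HB.instance Definition _ := [isSub for zr_val].
HB.instance Definition _ := [Choice of zr_fun by <:].
HB.instance Definition _ := [SubChoice_isSubZmodule of zr_fun by <:].

Definition zr_null : {pred zr_fun} :=
  fun u => `[< \forall x \ae mu, forall y, meq_rel E (x, y) -> u (x, y) = 0 >].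

Fact zr_null_closed : zmod_closed zr_null.
Proof.
split; first by apply/asboolP/nearW.
move=> u v /asboolP u0 /asboolP v0; apply/asboolP.
by move: u0 v0; apply: filterS2 => x u0 v0 y Exy /=;
   rewrite -[LHS]/(u (x, y) - v (x, y)) u0// v0// subrr.
Qed.
HB.instance Definition _ := GRing.isZmodClosed.Build zr_fun zr_null
  zr_null_closed.

Definition ZR : Type := Quotient.quot zr_null.
HB.instance Definition _ := GRing.Zmodule.on ZR.

(* For lam outside of the equivalence relation ring, zr_class lam is 0. In zr_mul,
   zr_indic and zr_act below, and in the use of linf_class there, this default
   is never taken if X is standard Borel and A is measurable: the functions
   concerned are measurable by Lusin-Novikov. *)
Definition zr_class lam : ZR := \pi_ZR%qT (insubd (0 : zr_fun) lam).
Definition zr_repr (a : ZR) : X * X -> Z := zr_val (repr a).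

Definition zr_mul (a b : ZR) : ZR :=
  zr_class (fun p => \sum_(w \in [set w | meq_rel E (p.1, w)])
    zr_repr a (p.1, w) * zr_repr b (w, p.2)).

Definition zr_indic (A : set X) : ZR :=
  zr_class (fun p => ((p.1 == p.2) && (p.1 \in A))%:R).

Definition zr_act (a : ZR) (f : Linf mu Z) : Linf mu Z :=
  linf_class mu (fun x => \sum_(y \in [set y | meq_rel E (x, y)])
    zr_repr a (x, y) * linf_repr f y).

End ZR.


(* An action of G on the ring A by ring endomorphisms (hence automorphisms). *)
Record ring_action (G : groupType) (A : nzRingType) := RingAction {
  ract :> G -> {rmorphism A -> A};
  ract1 : forall a, ract 1%g a = a;
  ractM : forall g h a, ract (g * h)%g a = ract g (ract h a) }.

Section XRing.
Variables (G : groupType) (A : nzRingType).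

Definition fin_supp : {pred G -> A} :=
  fun u => `[< finite_set [set g | u g != 0] >].

Fact fin_supp_closed : zmod_closed fin_supp.
Proof.
split=> [|u v /asboolP fu /asboolP fv]; apply/asboolP.
  rewrite (_ : [set _ | _] = set0); first exact: finite_set0.
  by apply/seteqP; split => g //=; rewrite eqxx.
apply: (@sub_finite_set _ _ ([set g | u g != 0] `|` [set g | v g != 0])).
  move=> g /=; have [ug|] := eqVneq (u g) 0; last by left.
  by rewrite -[_ != 0]/(u g - v g != 0) ug sub0r oppr_eq0; right.
by rewrite finite_setU.
Qed.
HB.instance Definition _ := GRing.isZmodClosed.Build (G -> A) fin_supp
  fin_supp_closed.

(* The crossed product A * G of an action: the finitely supported functions
   u : G -> A, read as the sums of the (u g, g), with the product determined by
   (a, g) (b, h) = (a * act g b, g h). *)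
Record xring (act : ring_action G A) :=
  XRing { xcoef :> G -> A ; _ : fin_supp xcoef }.

Variable act : ring_action G A.
Local Notation xprod := (xring act).
HB.instance Definition _ := [isSub for @xcoef act].
HB.instance Definition _ := [Choice of xprod by <:].
HB.instance Definition _ := [SubChoice_isSubZmodule of xprod by <:].

Implicit Types u v w : xprod.


Let supp_seq u : exists2 r : seq G, uniq r & forall h, u h != 0 -> h \in r.
Proof.
have /asboolP/finite_seqP[r ur] := valP u.
exists (undup r) => [|h uh]; first exact: undup_uniq.
by rewrite mem_undup; have : [set` r] h by rewrite -ur.
Qed.

Let fsumE (F : G -> A) (r : seq G) : uniq r ->
  (forall g, F g != 0 -> g \in r) ->
  \sum_(g \in [set: G]) F g = \sum_(g <- r) F g.
Proof.
move=> ur Fr; rewrite -(fsbig_widen [set` r] setT F)//.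
  by rewrite -fsbig_seq.
move=> g [_ gr].
by apply/eqP/negPn/negP => /Fr.
Qed.

Let big_pred1_seq (r : seq G) (g : G) (F : G -> A) : uniq r -> g \in r ->
  \sum_(h <- r | h == g) F h = F g.
Proof.
move=> ur gr; rewrite big_mkcond (bigD1_seq g)//= eqxx big1 ?addr0// => h.
by move=> /negbTE ->.
Qed.

Definition xmul_fun (u v : xprod) : G -> A := fun g =>
  \sum_(h \in [set: G]) u h * act h (v (h^-1 * g)%g).

Let xmul_funE1 u v (r : seq G) g : uniq r -> (forall h, u h != 0 -> h \in r) ->
  xmul_fun u v g = \sum_(h <- r) u h * act h (v (h^-1 * g)%g).
Proof.
move=> ur ru; apply: fsumE => // h; apply: contraNT => hr.
have /eqP -> : u h == 0 by apply: contraNT hr; exact: ru.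
by rewrite mul0r.
Qed.

Let xmul_funE2 u v (r s : seq G) g : uniq r -> uniq s ->
  (forall h, u h != 0 -> h \in r) -> (forall h, v h != 0 -> h \in s) ->
  xmul_fun u v g =
  \sum_(h <- r) \sum_(k <- s | (h * k)%g == g) u h * act h (v k).
Proof.
move=> ur us ru sv; rewrite (xmul_funE1 _ _ ur ru); apply: eq_bigr => h _.
rewrite (eq_bigl (fun k => k == (h^-1 * g)%g)); last first.
  by move=> k; apply/eqP/eqP => [<-|->]; rewrite ?mulKg ?mulVKg.
have [ks|ks] := boolP ((h^-1 * g)%g \in s); first by rewrite big_pred1_seq.
have /eqP -> : v (h^-1 * g)%g == 0 by apply: contraNT ks; exact: sv.
rewrite rmorph0 mulr0 big1_seq// => k /andP[/eqP -> ks'].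
by rewrite ks' in ks.
Qed.

Fact xmul_supp u v : fin_supp (xmul_fun u v).
Proof.
have [r ur ru] := supp_seq u; have [s us sv] := supp_seq v.
apply/asboolP; apply: (@sub_finite_set _ _ [set` [seq (h * k)%g | h <- r, k <- s]]).
  move=> g /=; rewrite (xmul_funE2 _ ur us ru sv).
  apply: contraNT => gn; apply/eqP; rewrite big1_seq// => h /andP[_ hr].
  rewrite big1_seq// => k /andP[/eqP gE ks]; case/negP: gn.
  by rewrite -gE; apply/allpairsP; exists (h, k).
exact: finite_seq.
Qed.
Definition xmul u v : xprod := XRing act (xmul_supp u v).

Definition xone_fun : G -> A := fun g => (g == 1%g)%:R.
Fact xone_supp : fin_supp xone_fun.
Proof.
apply/asboolP; apply: (@sub_finite_set _ _ [set 1%g]); last exact: finite_set1.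
by move=> g /=; rewrite /xone_fun; have [//|_] := eqVneq g 1%g; rewrite eqxx.
Qed.
Definition xone : xprod := XRing act xone_supp.

Fact xelt_supp (a : A) (g : G) : fin_supp (fun h => if h == g then a else 0).
Proof.
apply/asboolP; apply: (@sub_finite_set _ _ [set g]); last exact: finite_set1.
by move=> h /=; have [//|_] := eqVneq h g; rewrite eqxx.
Qed.
(* The element (a, g). *)
Definition xelt (a : A) (g : G) : xprod := XRing act (xelt_supp a g).

Let xone_in h : xone h != 0 -> h \in [:: 1%g].
Proof.
rewrite inE; apply: contraNT => /negbTE h1.
by rewrite -[xone h]/((h == 1%g)%:R) h1.
Qed.

Let xprodP u v : (forall g, u g = v g) -> u = v.
Proof. by move=> uv; apply: val_inj; apply: funext. Qed.

Fact xmulA : associative xmul.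
Proof.
move=> u v w; apply: xprodP => g.
have [r ur ru] := supp_seq u; have [s us sv] := supp_seq v.
have [t ut tuv] := supp_seq (xmul u v).
pose q := undup (t ++ [seq (h * k)%g | h <- r, k <- s]).
have qu : uniq q by exact: undup_uniq.
have quv m : xmul u v m != 0 -> m \in q.
  by move=> /tuv mt; rewrite mem_undup mem_cat mt.
rewrite -[LHS]/(xmul_fun u (xmul v w) g) (xmul_funE1 _ _ ur ru).
rewrite -[RHS]/(xmul_fun (xmul u v) w g) (xmul_funE1 _ _ qu quv).
transitivity (\sum_(h <- r) \sum_(k <- s) u h * act h (v k) *
    act (h * k)%g (w ((h * k)^-1 * g)%g)).
  apply: eq_bigr => h _; rewrite -[xmul v w _]/(xmul_fun v w _).
  rewrite (xmul_funE1 _ _ us sv) rmorph_sum mulr_sumr; apply: eq_bigr => k _.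
  by rewrite rmorphM ractM mulrA invgM mulgA.
transitivity (\sum_(h <- r) \sum_(k <- s) \sum_(m <- q | (h * k)%g == m)
    u h * act h (v k) * act m (w (m^-1 * g)%g)).
  apply: eq_big_seq => h hr; apply: eq_big_seq => k ks.
  under eq_bigl do rewrite eq_sym.
  rewrite big_pred1_seq//.
  by rewrite mem_undup mem_cat; apply/orP; right; apply/allpairsP; exists (h, k).
under eq_bigr => h _ do (under eq_bigr => k _ do rewrite big_mkcond;
  rewrite exchange_big).
rewrite exchange_big; apply: eq_bigr => m _.
rewrite -[xmul u v m]/(xmul_fun u v m) (xmul_funE2 _ ur us ru sv) mulr_suml.
by apply: eq_bigr => h _; rewrite mulr_suml -big_mkcond.
Qed.

Fact xmul1x : left_id xone xmul.
Proof.
move=> u; apply: xprodP => g; rewrite -[LHS]/(xmul_fun xone u g).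
rewrite (@xmul_funE1 _ _ [:: 1%g])// ?big_seq1.
by rewrite /= /xone_fun eqxx mul1r ract1 invg1 mul1g.
Qed.

Fact xmulx1 : right_id xone xmul.
Proof.
move=> u; apply: xprodP => g; rewrite -[LHS]/(xmul_fun u xone g).
have [r ur ru] := supp_seq u.
rewrite (@xmul_funE2 _ _ r [:: 1%g])//.
under eq_bigr => h _ do rewrite big_mkcond big_seq1 /= mulg1 /xone_fun eqxx
  rmorph1 mulr1.
rewrite -big_mkcond; have [gr|gr] := boolP (g \in r).
  by rewrite big_pred1_seq.
rewrite big1_seq => [|h /andP[/eqP -> hr]]; last by rewrite hr in gr.
by apply/esym/eqP; apply: contraNT gr; exact: ru.
Qed.

Fact xmulDl : left_distributive xmul +%R.
Proof.
move=> u v w; apply: xprodP => g.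
have [r ur ru] := supp_seq u; have [s us sv] := supp_seq v.
have [t ut tuv] := supp_seq (u + v).
pose q := undup (r ++ s ++ t); have qu : uniq q by exact: undup_uniq.
rewrite -[RHS]/(xmul_fun u w g + xmul_fun v w g) -[LHS]/(xmul_fun (u + v) w g).
rewrite !(@xmul_funE1 _ _ q)// -?big_split /=.
- by apply: eq_bigr => h _; rewrite -mulrDl.
- by move=> h /sv hs; rewrite mem_undup !mem_cat hs orbT.
- by move=> h /ru hs; rewrite mem_undup !mem_cat hs.
- by move=> h /tuv hs; rewrite mem_undup !mem_cat hs !orbT.
Qed.

Fact xmulDr : right_distributive xmul +%R.
Proof.
move=> u v w; apply: xprodP => g; have [r ur ru] := supp_seq u.
rewrite -[RHS]/(xmul_fun u v g + xmul_fun u w g) -[LHS]/(xmul_fun u (v + w) g).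
rewrite !(@xmul_funE1 _ _ r)// -big_split /=.
by apply: eq_bigr => h _; rewrite -mulrDr -rmorphD.
Qed.

Fact xone_neq0 : xone != 0.
Proof.
apply/eqP => /(congr1 (fun u : xprod => u 1%g)) /eqP.
by rewrite -[xone 1%g]/(xone_fun 1%g) /xone_fun eqxx -[X in _ == X]/(0 : A) oner_eq0.
Qed.

HB.instance Definition _ := GRing.Zmodule_isNzRing.Build xprod
  xmulA xmul1x xmulx1 xmulDl xmulDr xone_neq0.

End XRing.



Section GroupRing.
Variables (A : nzRingType) (G : groupType).

Definition trivial_action : ring_action G A :=
  @RingAction G A (fun=> idfun) (fun=> erefl) (fun _ _ _ => erefl).

(* The group ring is the crossed product of the trivial action. *)
Definition grpring : nzRingType := xring trivial_action.

Definition grpring_aug (s : grpring) : A := \sum_(g \in [set: G]) xcoef s g.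

(* res_aug is linear for the trivial module A, on which the group ring acts
   through the augmentation. *)
Record resolution := Resolution {
  res_mod : nat -> lmodType grpring;
  res_d : forall k, {linear res_mod k.+1 -> res_mod k};
  res_aug : res_mod 0 -> A;
  res_augD : forall x y, res_aug (x + y) = res_aug x + res_aug y;
  res_augZ : forall s x, res_aug (s *: x) = grpring_aug s * res_aug x;
  res_aug_surj : forall a, exists x, res_aug x = a;
  res_exact0 : forall x, res_aug x = 0 <-> exists y, res_d 0 y = x;
  res_exactS : forall k x, res_d k x = 0 <-> exists y, res_d k.+1 y = x }.

End GroupRing.
Arguments res_aug {A G} r x.

Section Modules.
Variable A : nzRingType.

Definition free_module (M : lmodType A) : Prop :=
  exists (I : choiceType) (b : I -> M), forall x, exists! c : I -> A,
    finite_set [set i | c i != 0] /\ x = \sum_(i \in [set: I]) c i *: b i.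

Definition fg_module (M : lmodType A) : Prop :=
  exists (m : nat) (b : 'I_m -> M), forall x, exists c : 'I_m -> A,
    x = \sum_(i < m) c i *: b i.

Definition projective_module (P : lmodType A) : Prop :=
  forall (M N : lmodType A) (p : {linear M -> N}) (f : {linear P -> N}),
    (forall y, exists x, p x = y) ->
    exists g : {linear P -> M}, forall x, p (g x) = f x.

End Modules.

Definition type_FP (m : nat) (G : groupType) : Prop :=
  exists C : resolution int G,
    (forall k, projective_module (res_mod C k)) /\
    (forall k, (k <= m)%N -> fg_module (res_mod C k)).

Definition free_resolution (A : nzRingType) (G : groupType) (C : resolution A G) :=
  forall k, free_module (res_mod C k).

Section LinfTheory.
Context d (X : measurableType d) (R : realType) (mu : probability X R).
Variable Z : coefficient.
Implicit Types (f g : X -> Z) (a b : Linf mu Z).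

Lemma linf_reprP a : is_linf mu (linf_repr a).
Proof. exact/asboolP/(valP (repr a)). Qed.

Lemma linf_eqP a b :
  a = b <-> \forall x \ae mu, linf_repr a x = linf_repr b x.
Proof.
split=> [->|ab]; first exact: nearW.
rewrite -[a]reprK -[b]reprK; apply/eqP; rewrite -Quotient.idealrBE.
apply/asboolP; apply: filterS ab => x.
by rewrite -[X in _ -> X]/(linf_repr a x - linf_repr b x = 0) => ->; rewrite subrr.
Qed.

Lemma linf_classK f : is_linf mu f ->
  \forall x \ae mu, linf_repr (linf_class mu f) x = f x.
Proof.
move=> lf; have fP : linf_pred mu f by exact/asboolP.
have : repr (linf_class mu f) - LinfFun fP \in @linf_null _ _ _ mu Z.
  rewrite Quotient.idealrBE reprK /linf_class.
  have -> // : insubd (0 : linf_fun mu Z) f = LinfFun fP.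
  by apply: val_inj; rewrite insubdK.
move=> /asboolP; apply: filterS => x.
by rewrite -[X in X -> _]/(linf_repr _ x - f x = 0) => /subr0_eq.
Qed.

Let pi_ae (u : linf_fun mu Z) :
  \forall x \ae mu, linf_repr (\pi_(Linf mu Z)%qT u) x = u x.
Proof.
have := linf_classK (elimT (asboolP _) (valP u)).
by rewrite /linf_class valKd.
Qed.

Lemma linf_reprD a b :
  \forall x \ae mu, linf_repr (a + b) x = linf_repr a x + linf_repr b x.
Proof. have e : \pi_(Linf mu Z)%qT (repr a + repr b) = a + b.
  by rewrite -[RHS]/(Quotient.add a b) Quotient.pi_add !reprK.
by have := pi_ae (repr a + repr b); rewrite e. Qed.

Lemma linf_reprM a b :
  \forall x \ae mu, linf_repr (a * b) x = linf_repr a x * linf_repr b x.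
Proof. have e : \pi_(Linf mu Z)%qT (repr a * repr b) = a * b.
  by rewrite -[RHS]/(Quotient.mul a b) Quotient.pi_mul !reprK.
by have := pi_ae (repr a * repr b); rewrite e. Qed.

Lemma linf_repr1 : \forall x \ae mu, linf_repr (1 : Linf mu Z) x = 1.
Proof. have e : \pi_(Linf mu Z)%qT 1 = 1 by rewrite -[RHS]/(Quotient.one _) /Quotient.one -lock.
by have := pi_ae 1; rewrite e. Qed.

Lemma linf_repr0 : \forall x \ae mu, linf_repr (0 : Linf mu Z) x = 0.
Proof.
by have := linf_reprD 0 0; rewrite addr0; apply: filterS => x /eqP;
   rewrite -subr_eq subrr eq_sym => /eqP.
Qed.

Definition linf_const (z : Z) : Linf mu Z := linf_class mu (fun=> z).

Definition linf_indic (A : set X) : Linf mu Z :=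
  linf_class mu (fun x => (x \in A)%:R).

End LinfTheory.

Section Actions.
Context d (X : measurableType d) (R : realType) (mu : probability X R).
Variable G : groupType.

Record standard_action := StandardAction {
  sact :> G -> X -> X;
  sact1 : forall x, sact 1%g x = x;
  sactM : forall g h x, sact (g * h)%g x = sact g (sact h x);
  sact_measurable : forall g, measurable_fun setT (sact g);
  sact_preserving : forall g (A : set X), measurable A ->
    mu (sact g @^-1` A) = mu A;
  sact_free : \forall x \ae mu, forall g, sact g x = x -> g = 1%g }.

Variable alpha : standard_action.

Definition orbit_rel : set (X * X) :=
  [set p | exists g, p.1 = alpha g p.2].

Lemma sact_ae g (P : X -> Prop) :
  (\forall x \ae mu, P x) -> \forall x \ae mu, P (alpha g x).
Proof.
move=> [N [mN N0 sN]]; exists (alpha g @^-1` N); split.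
- by rewrite -[_ @^-1` _]setTI; exact: sact_measurable.
- by rewrite sact_preserving.
- by move=> x /= /sN.
Qed.

Variable Z : coefficient.

Definition linf_trans_fun (g : G) (a : Linf mu Z) : X -> Z :=
  fun x => linf_repr a (alpha g^-1%g x).

Definition linf_trans (g : G) (a : Linf mu Z) : Linf mu Z :=
  linf_class mu (linf_trans_fun g a).

Lemma linf_transE g a :
  \forall x \ae mu, linf_repr (linf_trans g a) x = linf_repr a (alpha g^-1%g x).
Proof.
apply: linf_classK; have [ma [c ac]] := linf_reprP a; split.
  move=> B; rewrite -[X in measurable X]setTI.
  exact: (sact_measurable alpha g^-1%g measurableT (ma B)).
by exists c; exact: (sact_ae g^-1%g ac).
Qed.


Lemma linf_transD g : {morph linf_trans g : a b / a + b}.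
Proof.
move=> a b; apply/linf_eqP; near=> x.
have -> : linf_repr (linf_trans g (a + b)) x = linf_repr (a + b) (alpha g^-1%g x).
  by near: x; exact: linf_transE.
have -> : linf_repr (a + b) (alpha g^-1%g x) =
    linf_repr a (alpha g^-1%g x) + linf_repr b (alpha g^-1%g x).
  by near: x; exact: (sact_ae g^-1%g (linf_reprD a b)).
have -> : linf_repr (linf_trans g a + linf_trans g b) x =
    linf_repr (linf_trans g a) x + linf_repr (linf_trans g b) x.
  by near: x; exact: linf_reprD.
by congr (_ + _); apply/esym; near: x; exact: linf_transE.
Unshelve. all: by end_near. Qed.

Lemma linf_transM g : {morph linf_trans g : a b / a * b}.
Proof.
move=> a b; apply/linf_eqP; near=> x.
have -> : linf_repr (linf_trans g (a * b)) x = linf_repr (a * b) (alpha g^-1%g x).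
  by near: x; exact: linf_transE.
have -> : linf_repr (a * b) (alpha g^-1%g x) =
    linf_repr a (alpha g^-1%g x) * linf_repr b (alpha g^-1%g x).
  by near: x; exact: (sact_ae g^-1%g (linf_reprM a b)).
have -> : linf_repr (linf_trans g a * linf_trans g b) x =
    linf_repr (linf_trans g a) x * linf_repr (linf_trans g b) x.
  by near: x; exact: linf_reprM.
by congr (_ * _); apply/esym; near: x; exact: linf_transE.
Unshelve. all: by end_near. Qed.

Lemma linf_trans1 g : linf_trans g 1 = 1.
Proof.
apply/linf_eqP; near=> x.
have -> : linf_repr (linf_trans g (1 : Linf mu Z)) x =
    linf_repr (1 : Linf mu Z) (alpha g^-1%g x).
  by near: x; exact: linf_transE.
transitivity (1 : Z); last by apply/esym; near: x; exact: linf_repr1.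
by near: x; exact: (sact_ae g^-1%g (linf_repr1 mu Z)).
Unshelve. all: by end_near. Qed.

Fact linf_trans_zmod g : zmod_morphism (linf_trans g).
Proof.
move=> a b; rewrite linf_transD; congr (_ + _).
have t0 : linf_trans g 0 = 0.
  by apply: (@addrI _ (linf_trans g 0)); rewrite -linf_transD !addr0.
by apply: (@addrI _ (linf_trans g b)); rewrite -linf_transD !subrr.
Qed.
HB.instance Definition _ g := GRing.isZmodMorphism.Build (Linf mu Z) (Linf mu Z)
  (linf_trans g) (linf_trans_zmod g).
HB.instance Definition _ g := GRing.isMonoidMorphism.Build (Linf mu Z) (Linf mu Z)
  (linf_trans g) (linf_trans1 g, linf_transM g).

Fact linf_trans_id a : linf_trans 1%g a = a.
Proof.
by apply/linf_eqP; apply: filterS (linf_transE 1%g a) => x ->;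
   rewrite invg1 sact1.
Qed.

Fact linf_trans_comp g h a :
  linf_trans (g * h)%g a = linf_trans g (linf_trans h a).
Proof.
apply/linf_eqP.
apply: filterS3 (linf_transE (g * h)%g a) (linf_transE g (linf_trans h a))
  (sact_ae g^-1%g (linf_transE h a)) => x -> -> ->.
by rewrite invgM sactM.
Qed.

Definition linf_action : ring_action G (Linf mu Z) :=
  @RingAction G (Linf mu Z) linf_trans linf_trans_id linf_trans_comp.

Definition crossed_product : nzRingType := xring linf_action.


Fact grpring_incl_supp (s : grpring Z G) :
  fin_supp (fun g => linf_const mu (s g)).
Proof.
apply/asboolP; have /asboolP := valP s; apply: sub_finite_set => g /=.
apply: contraNN => /eqP ->; apply/eqP/linf_eqP.
apply: filterS2 (linf_classK (is_linf_cst mu (0 : Z))) (linf_repr0 mu Z).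
by move=> x -> ->.
Qed.

Definition grpring_incl (s : grpring Z G) : crossed_product :=
  XRing linf_action (grpring_incl_supp s).

Definition cp_indic (A : set X) : crossed_product :=
  xelt linf_action (linf_indic mu Z A) 1%g.

(* The action obtained by restricting that of the equivalence relation ring along
   the inclusion cp_kernel: (a, g) acts by f |-> a * (g . f). *)
Definition cp_act (s : crossed_product) (f : Linf mu Z) : Linf mu Z :=
  \sum_(g \in [set: G]) xcoef s g * linf_trans g f.

(* The inclusion into the equivalence relation ring of the orbit relation:
   (a, g) has the value a (g x) at (g x, x) and 0 elsewhere. *)
Definition cp_kernel (s : crossed_product) : X * X -> Z :=
  fun p => \sum_(g \in [set g | p.1 = alpha g p.2]) linf_repr (xcoef s g) p.1.

End Actions.

Section Scalars.
Context d (X : measurableType d) (R : realType) (mu : probability X R).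
Variable Z : coefficient.

(* The part of the structure of S that marked modules and their norms use, so
   that both choices of S are treated at once: the product, the elements chi_A,
   the action on L^oo(X, Z) and the norm | |_1. *)
Record scalars := Scalars {
  sc_car :> zmodType;
  sc_mul : sc_car -> sc_car -> sc_car;
  sc_indic : set X -> sc_car;
  sc_act : sc_car -> Linf mu Z -> Linf mu Z;
  sc_norm : sc_car -> \bar R }.

Definition ZR_scalars (E : measured_equivalence mu) : scalars :=
  @Scalars (ZR Z E) (@zr_mul _ _ _ _ Z E) (@zr_indic _ _ _ _ Z E)
    (@zr_act _ _ _ _ Z E) (fun a => l1norm mu (meq_rel E) (zr_repr a)).

Definition cp_scalars (G : groupType) (alpha : standard_action mu G) : scalars :=
  @Scalars (crossed_product alpha Z) (fun s t => s * t)
    (@cp_indic _ _ _ _ _ alpha Z) (@cp_act _ _ _ _ _ alpha Z)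
    (fun s => l1norm mu (orbit_rel alpha) (cp_kernel s)).

End Scalars.

Section Marked.
Context d (X : measurableType d) (R : realType) (mu : probability X R).
Variables (Z : coefficient) (S : scalars mu Z).

(* A marked projective module is given by its marking: it is the submodule
   in_mod of vec = S^I, the direct sum of the left ideals S chi_(A i).
   A homomorphism is a function on S^I of which only the values on in_mod
   matter. *)
Record marked := Marked {
  mk_ix : finType;
  mk_set : mk_ix -> set X;
  mk_measurable : forall i, measurable (mk_set i) }.

Definition vec (M : marked) : Type := mk_ix M -> S.

Definition in_mod (M : marked) (z : vec M) : Prop :=
  forall i, exists s : S, z i = sc_mul s (sc_indic S (mk_set i)).

Definition mdim (M : marked) : \bar R := (\sum_(i : mk_ix M) mu (mk_set i))%E.

Definition norm1 (M : marked) (z : vec M) : \bar R :=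
  (\sum_(i : mk_ix M) sc_norm (z i))%E.

Definition smul (M : marked) (s : S) (z : vec M) : vec M :=
  fun i => sc_mul s (z i).

Definition is_hom (M N : marked) (f : vec M -> vec N) : Prop :=
  [/\ forall z, in_mod z -> in_mod (f z),
      forall z z', in_mod z -> in_mod z' -> f (z + z') = f z + f z' &
      forall s z, in_mod z -> f (smul s z) = smul s (f z)].

Definition is_aug_hom (M : marked) (eta : vec M -> Linf mu Z) : Prop :=
  (forall z z', in_mod z -> in_mod z' -> eta (z + z') = eta z + eta z') /\
  (forall s z, in_mod z -> eta (smul s z) = sc_act s (eta z)).

Definition opnorm (M N : marked) (f : vec M -> vec N) : \bar R :=
  ereal_inf [set c%:E | c in [set c : R | 0 <= c /\
    forall z, in_mod z -> (norm1 (f z) <= c%:E * norm1 z)%E]].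

(* lne 0 = -oo, so logp 0 = 0. *)
Definition logp (x : \bar R) : \bar R := maxe (lne x) 0%E.

Definition rk (M N : marked) (f : vec M -> vec N) : \bar R :=
  ereal_inf [set r | exists (B : mk_ix N -> set X)
    (mB : forall i, measurable (B i)),
    [/\ forall i, B i `<=` mk_set i,
        forall z, in_mod z -> @in_mod (Marked mB) (f z) &
        r = mdim (Marked mB)]].

Definition lognorm' (M N : marked) (f : vec M -> vec N) : \bar R :=
  mine (mdim M * logp (opnorm f))%E (rk f * logp (opnorm f))%E.

Definition lognorm (M N : marked) (f : vec M -> vec N) : \bar R :=
  ereal_inf [set r | exists (K : nat) (B : 'I_K -> mk_ix M -> set X)
    (mB : forall k i, measurable (B k i)),
    [/\ forall i, mk_set i = \bigcup_k B k i,
        forall i, trivIset setT (fun k => B k i) &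
        r = (\sum_(k < K) @lognorm' (Marked (mB k)) N f)%E]].

Record marked_complex := MarkedComplex {
  mc_mod : nat -> marked;
  mc_d : forall k, vec (mc_mod k.+1) -> vec (mc_mod k);
  mc_eta : vec (mc_mod 0) -> Linf mu Z;
  mc_d_hom : forall k, is_hom (@mc_d k);
  mc_dd : forall k (z : vec (mc_mod k.+2)), in_mod z -> mc_d (mc_d z) = 0;
  mc_eta_hom : is_aug_hom mc_eta;
  mc_eta_surj : forall f, exists2 z, in_mod z & mc_eta z = f;
  mc_eta_d : forall z : vec (mc_mod 1), in_mod z -> mc_eta (mc_d z) = 0 }.

(* A resolution up to degree m: nothing is required of the modules of degree
   above m and of the maps mr_d k for k >= m. *)
Record marked_resolution (m : nat) := MarkedResolution {
  mr_mod : nat -> marked;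
  mr_d : forall k, vec (mr_mod k.+1) -> vec (mr_mod k);
  mr_eta : vec (mr_mod 0) -> Linf mu Z;
  mr_d_hom : forall k, (k < m)%N -> is_hom (@mr_d k);
  mr_eta_hom : is_aug_hom mr_eta;
  mr_eta_surj : forall f, exists2 z, in_mod z & mr_eta z = f;
  mr_exact0 : (0 < m)%N -> forall z, in_mod z ->
    (mr_eta z = 0 <-> exists2 y : vec (mr_mod 1), in_mod y & mr_d y = z);
  mr_exactS : forall k, (k.+1 < m)%N ->
    forall z : vec (mr_mod k.+1), in_mod z ->
    (mr_d z = 0 <-> exists2 y : vec (mr_mod k.+2), in_mod y & mr_d y = z) }.

End Marked.
Arguments mc_d {d X R mu Z S} m k z.
Arguments mr_d {d X R mu Z S m} _ k z.

Section AlphaEmbedding.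
Context d (X : measurableType d) (R : realType) (mu : probability X R).
Variables (Z : coefficient) (G : groupType) (alpha : standard_action mu G).
Variable C : resolution Z G.
Local Notation S := (cp_scalars Z alpha).

(* C plays the role of the fixed free resolution of the trivial module Z. *)
Definition alpha_embedding (n : nat) (D : marked_complex S) : Prop :=
  exists phi : forall k, res_mod C k -> vec S (mc_mod D k),
    [/\ forall k x, (k <= n.+1)%N -> in_mod (phi k x),
        forall k x y, (k <= n.+1)%N -> phi k (x + y) = phi k x + phi k y,
        forall k s x, (k <= n.+1)%N ->
          phi k (s *: x) = smul (grpring_incl alpha s : S) (phi k x),
        forall k x, (k < n.+1)%N -> phi k (res_d C k x) = mc_d D k (phi k.+1 x) &
        forall x, mc_eta (phi 0%N x) = linf_const mu (res_aug C x)].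

Definition medim (n : nat) : \bar R :=
  ereal_inf [set r | exists2 D : marked_complex S,
    alpha_embedding n D & r = mdim mu (mc_mod D n)].

Definition mevol (n : nat) : \bar R :=
  ereal_inf [set r | exists2 D : marked_complex S,
    alpha_embedding n D & r = lognorm (mc_d D n)].

End AlphaEmbedding.

(* X is isomorphic, as a measurable space, to a Polish space with its Borel
   sets. *)
Definition standard_borel d (X : measurableType d) (R : realType) : Prop :=
  exists (P : completePseudoMetricType R) (f : X -> P),
    [/\ hausdorff_space P,
        exists2 D : set P, countable D & dense D,
        bijective f &
        forall A : set X, measurable A <->
          exists2 B : set P, <<s [set U : set P | open U] >> B & A = f @^-1` B].

(* Main.v *)
(* The resolution D is approximated, up to sets of small measure, by a complex over
   the crossed product. An element of the equivalence relation ring is an infinite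
   formal sum of terms (u g, g) with u g in L^oo; its restriction to a Borel set Y
   lies in the crossed product as soon as Y avoids the points having a coefficient
   outside of the first p elements of G, and the measure of these points tends to 0
   as p grows. Cutting the differentials of D in this way, from degree 0 upwards,
   gives a subcomplex over the crossed product whose modules <A_j \ U_j> differ from
   <A_j> by a set U_j of vanishing measure. Type FP yields a finitely generated free
   complex L, not necessarily exact, to which the given resolution maps up to degree
   n + 1; L maps to D by exactness of D. The cut maps commute with the differentials
   only off a set B_r of vanishing measure, so in degree r a summand <B_r> is added
   for each generator of L to take the remaining part of the generator. The dimension grows by rank(L_n) mu(B_n), and lognorm by at
   most rank(L_(n+1)) mu(B_(n+1)) log_+ k with a constant k independent of p. *)
Require Import Defs.
From HB Require Import structures.
From mathcomp Require Import all_boot all_order all_algebra all_field.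
From mathcomp Require Import generic_quotient ring_quotient.
From mathcomp Require Import all_classical all_reals all_analysis.
From mathcomp Require Import measurable_realfun.
Set Implicit Arguments.
Unset Strict Implicit.
Unset Printing Implicit Defensive.
Import Order.TTheory GRing.Theory Num.Theory.
Import numFieldNormedType.Exports HBNNSimple.
Local Open Scope classical_set_scope.
Local Open Scope ring_scope.

(** * Crossed products *)

(** Two requirements shape the construction. A coefficient that survives a cut must end inside the
    reduced module of the degree below, since otherwise two consecutive cut differentials would not
    compose to 0. So each exceptional set is built from those of lower degree, and it stays small
    because, outside a set of small measure, only finitely many translates of the lower set matter.
    Moreover all constants have to be fixed before p is chosen. They are bounds on the l1 norms of
    the rows of the uncut elements, and restriction to a set never increases such norms. On a new
    summand the differential is forced: over B_r the generator of L is sent to the new generator,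
    whose boundary must then be the image of its boundary in L. L is not exact because projective
    modules are replaced by free ones of which they are retracts. Exactness survives on the images
    of the idempotents, which is where the comparison map from the given resolution takes its
    values. FP is a condition over the integers, so over a finite field cycles are first lifted to
    integral cycles; this works because the integral complex is torsion-free and exact on these
    images. *)

Lemma fsum_seqE (I : choiceType) (V : zmodType) (F : I -> V) (r : seq I) :
  uniq r -> (forall i, F i != 0 -> i \in r) ->
  \sum_(i \in [set: I]) F i = \sum_(i <- r) F i.
Proof.
move=> ur Fr; rewrite -(fsbig_widen [set` r] setT F)//.
  by rewrite -fsbig_seq.
by move=> i [_ ir]; apply/eqP/negPn/negP => /Fr.
Qed.

Section XRingTheory.
Variables (G : groupType) (A : nzRingType) (act : ring_action G A).
Local Notation xprod := (xring act).
Implicit Types u v : xprod.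

Lemma xringP u v : (forall g, u g = v g) -> u = v.
Proof. by move=> uv; apply: val_inj; apply: funext. Qed.

Lemma xring_supp u : exists2 r : seq G, uniq r & forall h, u h != 0 -> h \in r.
Proof.
have /asboolP/finite_seqP[r ur] := valP u.
exists (undup r) => [|h uh]; first exact: undup_uniq.
by rewrite mem_undup; have : [set` r] h by rewrite -ur.
Qed.

Lemma xcoefD u v g : (u + v) g = u g + v g. Proof. by []. Qed.
Lemma xcoef0 g : (0 : xprod) g = 0. Proof. by []. Qed.

Lemma xcoefMn u n g : (u *+ n) g = u g *+ n.
Proof. by elim: n => [|n IH]; rewrite ?mulr0n// !mulrS xcoefD IH. Qed.

Lemma xcoef_sum (I : Type) (r : seq I) (P : pred I) (F : I -> xprod) g :
  (\sum_(i <- r | P i) F i) g = \sum_(i <- r | P i) F i g.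
Proof. by apply: (big_morph (fun u : xprod => u g)). Qed.

Lemma xcoef_elt a h g : xelt act a h g = if g == h then a else 0.
Proof. by []. Qed.

Lemma xcoef1 g : (1 : xprod) g = (g == 1%g)%:R. Proof. by []. Qed.

Lemma xcoefM u v (r : seq G) g : uniq r -> (forall h, u h != 0 -> h \in r) ->
  (u * v) g = \sum_(h <- r) u h * act h (v (h^-1 * g)%g).
Proof.
move=> ur ru; apply: fsum_seqE => // h; apply: contraNT => hr.
have /eqP -> : u h == 0 by apply: contraNT hr; exact: ru.
by rewrite mul0r.
Qed.

Lemma xelt_neq0 (a : A) h k : xelt act a h k != 0 -> k \in [:: h].
Proof. by rewrite xcoef_elt inE; case: ifP => //; rewrite eqxx. Qed.

Lemma xcoef_eltM a h v g : (xelt act a h * v) g = a * act h (v (h^-1 * g)%g).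
Proof.
rewrite (@xcoefM _ _ [:: h])//; last exact: xelt_neq0.
by rewrite big_seq1 xcoef_elt eqxx.
Qed.

Lemma xcoef_Melt1 u a g : (u * xelt act a 1%g) g = u g * act g a.
Proof.
have [r ur ru] := xring_supp u.
rewrite (xcoefM _ _ ur ru); have [gr|gr] := boolP (g \in r).
  rewrite (bigD1_seq g)// xcoef_elt mulVg eqxx big1; [by rewrite /= addr0|move=> h hg].
  rewrite xcoef_elt; case: eqP => [e|_]; last by rewrite rmorph0 mulr0.
  by move: hg; rewrite -[h]mulg1 -e mulVKg eqxx.
have /eqP -> : u g == 0 by apply: contraNT gr; exact: ru.
rewrite mul0r big1_seq// => h /andP[_ hr]; rewrite xcoef_elt.
case: eqP => [e|_]; last by rewrite rmorph0 mulr0.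
by move: gr; rewrite -(mulVKg h g) e mulg1 hr.
Qed.

Lemma xeltM a b g h :
  xelt act a g * xelt act b h = xelt act (a * act g b) (g * h)%g.
Proof.
apply: xringP => k; rewrite xcoef_eltM !xcoef_elt.
rewrite -(inj_eq (mulgI g)) mulVKg; case: ifP => // _.
by rewrite rmorph0 mulr0.
Qed.

Lemma xring_sum_elt u (r : seq G) : uniq r -> (forall h, u h != 0 -> h \in r) ->
  u = \sum_(h <- r) xelt act (u h) h.
Proof.
move=> ur ru; apply: xringP => g; rewrite xcoef_sum.
have [gr|gr] := boolP (g \in r).
  rewrite (bigD1_seq g)// xcoef_elt eqxx big1; [by rewrite /= addr0|move=> h hg].
  by rewrite xcoef_elt eq_sym (negbTE hg).
have /eqP -> : u g == 0 by apply: contraNT gr; exact: ru.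
rewrite big1_seq// => h /andP[_ hr]; rewrite xcoef_elt; case: eqP => // e.
by rewrite e hr in gr.
Qed.

End XRingTheory.

(* A crossed product A * G acts on every abelian group V with compatible actions
   of A and G; rho a g stands for the action of (a, g). *)
Section XRingAction.
Variables (G : groupType) (A : nzRingType) (act : ring_action G A).
Variables (V : zmodType) (rho : A -> G -> V -> V).
Hypothesis rhoDl : forall a b g v, rho (a + b) g v = rho a g v + rho b g v.
Hypothesis rhoDr : forall a g v w, rho a g (v + w) = rho a g v + rho a g w.
Hypothesis rhoA : forall a b g h v,
  rho a g (rho b h v) = rho (a * act g b) (g * h)%g v.
Hypothesis rho1 : forall v, rho 1 1%g v = v.
Implicit Types (s t : xring act) (v w : V).

Definition xact s v : V := \sum_(h \in [set: G]) rho (s h) h v.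

Let rho0l g v : rho 0 g v = 0.
Proof. by apply: (@addrI _ (rho 0 g v)); rewrite -rhoDl !addr0. Qed.
Let rho0r a g : rho a g 0 = 0.
Proof. by apply: (@addrI _ (rho a g 0)); rewrite -rhoDr !addr0. Qed.

Lemma xactE s v (r : seq G) : uniq r -> (forall h, s h != 0 -> h \in r) ->
  xact s v = \sum_(h <- r) rho (s h) h v.
Proof.
move=> ur ru; apply: fsum_seqE => // h; apply: contraNT => hr.
have /eqP -> : s h == 0 by apply: contraNT hr; exact: ru.
by rewrite rho0l.
Qed.

Lemma xact_elt a g v : xact (xelt act a g) v = rho a g v.
Proof.
rewrite (@xactE _ _ [:: g])//; last exact: xelt_neq0.
by rewrite big_seq1 xcoef_elt eqxx.
Qed.

Lemma xactDr s : {morph xact s : v w / v + w}.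
Proof.
move=> v w; have [r ur ru] := xring_supp s.
by rewrite !(xactE _ ur ru) -big_split; apply: eq_bigr => h _; exact: rhoDr.
Qed.

Lemma xactDl v : {morph xact^~ v : s t / s + t}.
Proof.
move=> s t; have [r ur ru] := xring_supp s; have [q uq qt] := xring_supp t.
have up : uniq (undup (r ++ q)) by exact: undup_uniq.
have rp h : s h != 0 -> h \in undup (r ++ q).
  by move=> /ru hr; rewrite mem_undup mem_cat hr.
have qp h : t h != 0 -> h \in undup (r ++ q).
  by move=> /qt hr; rewrite mem_undup mem_cat hr orbT.
rewrite /= (xactE _ up rp) (xactE _ up qp) (@xactE (s + t) _ _ up); last first.
  move=> h; apply: contraNT => hp; rewrite xcoefD.
  have /eqP -> : s h == 0 by apply: contraNT hp; exact: rp.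
  by rewrite add0r; apply: contraNT hp; exact: qp.
by rewrite -big_split; apply: eq_bigr => h _; exact: rhoDl.
Qed.

Lemma xact0l v : xact 0 v = 0.
Proof. by apply: (@addrI _ (xact 0 v)); rewrite -xactDl !addr0. Qed.

Lemma xact1 v : xact 1 v = v.
Proof.
rewrite (_ : 1 = xelt act 1 1%g) ?xact_elt ?rho1//.
by apply: xringP => g; rewrite xcoef_elt xcoef1; case: eqP.
Qed.

Lemma xactA s t v : xact (s * t) v = xact s (xact t v).
Proof.
have [r ur ru] := xring_supp s; have [q uq qt] := xring_supp t.
rewrite {1}(xring_sum_elt ur ru) {1}(xring_sum_elt uq qt) mulr_suml.
rewrite (big_morph _ (xactDl v) (xact0l v)) (xactE _ ur ru).
apply: eq_bigr => h _; rewrite mulr_sumr (big_morph _ (xactDl v) (xact0l v)).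
rewrite (xactE _ uq qt) (big_morph _ (rhoDr _ _) (rho0r _ _)).
by apply: eq_bigr => k _; rewrite xeltM xact_elt rhoA.
Qed.

End XRingAction.

(* A function u : G -> A stands for the infinite formal sum of the (u g, g). *)
Section FormalSums.
Variables (G : groupType) (A : nzRingType) (act : ring_action G A).
Implicit Types (s t : xring act) (u v : G -> A).

Definition formal_rho (a : A) (h : G) (u : G -> A) : G -> A :=
  fun g => a * act h (u (h^-1 * g)%g).

Definition xscale : xring act -> (G -> A) -> (G -> A) := xact formal_rho.

Let rhoDl a b g u : formal_rho (a + b) g u = formal_rho a g u + formal_rho b g u.
Proof. by apply: funext => k; rewrite /formal_rho/= mulrDl. Qed.
Let rhoDr a g u v : formal_rho a g (u + v) = formal_rho a g u + formal_rho a g v.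
Proof.
apply: funext => k.
rewrite /formal_rho [RHS]/(_ + _) [(u + v) _]/(_ + _).
by rewrite rmorphD mulrDr.
Qed.
Let rhoA a b g h u :
  formal_rho a g (formal_rho b h u) = formal_rho (a * act g b) (g * h)%g u.
Proof.
by apply: funext => k; rewrite /formal_rho/= rmorphM mulrA ractM invgM mulgA.
Qed.

Lemma xscaleDr s : {morph xscale s : u v / u + v}. Proof. exact: xactDr. Qed.
Lemma xscaleDl u : {morph xscale^~ u : s t / s + t}. Proof. exact: xactDl. Qed.
Lemma xscaleA s t u : xscale (s * t) u = xscale s (xscale t u).
Proof. exact: xactA. Qed.

Lemma xscaleE s u (r : seq G) g : uniq r -> (forall h, s h != 0 -> h \in r) ->
  xscale s u g = \sum_(h <- r) s h * act h (u (h^-1 * g)%g).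
Proof. by move=> ur ru; rewrite /xscale (xactE _ _ ur ru)// fct_sumE. Qed.

Lemma xscale_elt a h u g : xscale (xelt act a h) u g = a * act h (u (h^-1 * g)%g).
Proof. by rewrite /xscale xact_elt. Qed.

Lemma xscale_xcoef s t : xscale s (xcoef t) = xcoef (s * t).
Proof.
apply: funext => g; have [r ur ru] := xring_supp s.
by rewrite (xscaleE _ _ ur ru) (xcoefM _ _ ur ru).
Qed.

End FormalSums.

Section XRingMap.
Variables (G : groupType) (A B : nzRingType).
Variables (actA : ring_action G A) (actB : ring_action G B).
Variable phi : {rmorphism A -> B}.
Hypothesis phi_act : forall g a, phi (actA g a) = actB g (phi a).

Fact xmap_supp (s : xring actA) : fin_supp (fun g => phi (s g)).
Proof.
apply/asboolP; have /asboolP := valP s; apply: sub_finite_set => g /=.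
by apply: contraNN => /eqP ->; rewrite rmorph0.
Qed.
Definition xmap (s : xring actA) : xring actB := XRing actB (xmap_supp s).

Lemma xcoef_map s g : xmap s g = phi (s g). Proof. by []. Qed.

Lemma xmap_is_zmod : zmod_morphism xmap.
Proof. by move=> s t; apply: xringP => g; rewrite xcoef_map/= rmorphB. Qed.

Lemma xmap_is_monoid : monoid_morphism xmap.
Proof.
split; first by apply: xringP => g; rewrite xcoef_map !xcoef1 rmorph_nat.
move=> s t; apply: xringP => g; have [r ur ru] := xring_supp s.
rewrite xcoef_map (xcoefM _ _ ur ru) (@xcoefM _ _ _ (xmap s) _ _ _ ur).
  by rewrite rmorph_sum; apply: eq_bigr => h _; rewrite rmorphM/= phi_act.
move=> h; rewrite xcoef_map => sh; apply: ru; apply: contraNN sh => /eqP ->.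
by rewrite rmorph0.
Qed.

End XRingMap.

(** * Measurability and orbits *)

(** Countably many sets [U] separate the points, so the complement of the diagonal is the union of
    the products of such a [U] with its complement. The [U] are the interiors of balls of radius
    1/(n+1) around a countable dense set. *)
Lemma standard_borel_diag d (X : measurableType d) (R : realType) :
  standard_borel X R -> measurable [set p : X * X | p.1 = p.2].
Proof.
move=> [P [f [hP [D cD dD] bf mX]]].
pose e (n : nat) : R := n.+1%:R^-1.
have e0 n : 0 < e n by rewrite invr_gt0 ltr0n.
pose U (a : P) n := f @^-1` (ball a (e n))°.
have mU a n : measurable (U a n).
  by apply/mX; exists (ball a (e n))° => //; apply: sub_gen_smallest;
     exact: open_interior.
rewrite -[X in measurable X]setCK; apply: measurableC.
have /countable_injP[h hinj] := cD.
(* The dense set is indexed by its codes under the injection [h]; a number that is no code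
   contributes the empty set. *)
pose F k n : set (X * X) := if pselect (exists2 a, D a & h a = k) is left w
  then U (s2val (cid2 w)) n `*` ~` U (s2val (cid2 w)) n else set0.
have mF k n : measurable (F k n).
  rewrite /F; case: pselect => [w|_] //; apply: measurableX => //.
  exact: measurableC.
rewrite (_ : ~` _ = \bigcup_k \bigcup_n F k n); last first.
  apply/seteqP; split => -[x y]/=; last first.
    move=> [k _ [n _]]; rewrite /F; case: pselect => // w [/= Ux Uy] xy.
    by apply: Uy; rewrite -xy.
  move=> /eqP xy; have fxy : f x != f y by rewrite (inj_eq (bij_inj bf)).
  move: hP; rewrite ball_hausdorff => /(_ _ _ fxy)[[r s]]/= /eqP rs.
  (* The centre [a] is taken within [e n / 2] of [f x]. If [f y] were in the ball of radius [e n]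
     around [a], it would be within [e n + e n <= r] of [f x], against the disjointness of the two
     balls. *)
  have [n ner] : exists n, e n + e n <= r%:num.
    have := @near_infty_natSinv_lt R (PosNum (divr_gt0 (gt0 r) (ltr0n R 2))).
    move=> [N _ /(_ N (leqnn N))] /= Nr; exists N; rewrite [leRHS]splitr.
    by apply: lerD; exact: ltW.
  have e2 : 0 < e n / 2 by rewrite divr_gt0.
  have [a [ha Da]] := dD (ball (f x) (e n / 2))°
    (ex_intro _ (f x) (nbhsx_ballx (f x) _ e2)) (@open_interior _ _).
  have xa : ball (f x) (e n / 2) a by exact: interior_subset ha.
  exists (h a) => //; exists n => //; rewrite /F.
  case: pselect => [w|[]]; last by exists a.
  case: cid2 => /= b Db hb; have -> : b = a by apply: hinj => //; rewrite inE.
  split => /=.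
    apply: (@filterS _ (nbhs (f x)) _ (ball (f x) (e n / 2))).
      by move=> z; exact: ball_splitr.
    exact: nbhsx_ballx.
  move=> /interior_subset ay.
  suff : (ball (f x) r%:num `&` ball (f y) s%:num) (f y) by rewrite rs.
  split; last exact: ballxx.
  apply: (le_ball ner); apply: ball_triangle ay.
  by apply: le_ball xa; rewrite ler_pdivrMr// ler_peMr ?ler1n// ltW.
by apply: bigcupT_measurable => k; exact: bigcupT_measurable.
Qed.

(** * Countable index sets and measurability of functions with countably many values *)

Section Enumeration.
Variables (I : choiceType) (c : I -> nat).
Hypothesis c_inj : injective c.

Definition uncode (k : nat) : option I :=
  if pselect (exists i, c i = k) is left w then Some (sval (cid w)) else None.

Lemma uncodeK : ocancel uncode c.
Proof. by rewrite /uncode => k; case: pselect => //= w; case: cid. Qed.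

Lemma uncode_pcancel : pcancel c uncode.
Proof.
move=> i; rewrite /uncode; case: pselect => [w|[]]; last by exists i.
by case: cid => /= j /c_inj ->.
Qed.

Lemma countable_enum : countable [set: I].
Proof. by apply/countable_injP; exists c => i j _ _ /c_inj. Qed.

Lemma ae_forall d (X : measurableType d) (R : realType) (mu : probability X R)
    (P : I -> X -> Prop) :
  (forall i, \forall x \ae mu, P i x) -> \forall x \ae mu, forall i, P i x.
Proof.
move=> aeP; have : \forall x \ae mu, forall k,
    if uncode k is Some i then P i x else True.
  by apply: ae_foralln => k; case: (uncode k) => [i|]//; exact: nearW.
by apply: filterS => x Px i; have := Px (c i); rewrite uncode_pcancel.
Qed.

Lemma big_uncode (V : zmodType) (F : I -> V) (N : nat) :
  (forall i, (N <= c i)%N -> F i = 0) ->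
  \sum_(i \in [set: I]) F i =
  \sum_(0 <= k < N) (if uncode k is Some i then F i else 0).
Proof.
move=> FN; rewrite (@fsum_seqE _ _ _ (pmap uncode (index_iota 0 N))).
- by rewrite big_pmap.
- by apply: (pmap_uniq uncodeK); exact: iota_uniq.
- move=> i Fi; rewrite mem_pmap; apply/mapP; exists (c i); last first.
    by rewrite uncode_pcancel.
  by rewrite mem_index_iota ltnNge; apply: contraNN Fi => /FN ->.
Qed.

End Enumeration.

Section DiscreteMeasurability.
Context d (Y : measurableType d) (Z : coefficient).
Implicit Types F : Y -> Z.

Definition dmeas F := forall B : set Z, measurable (F @^-1` B).

Lemma dmeas_cst z : dmeas (fun=> z).
Proof.
move=> B; rewrite (_ : _ @^-1` _ = if `[< B z >] then setT else set0).
  by case: ifP.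
by case: asboolP => Bz; apply/seteqP; split.
Qed.

Lemma dmeas_indic (A : set Y) : measurable A -> dmeas (fun y => (y \in A)%:R).
Proof.
move=> mA B; rewrite (_ : _ @^-1` _ =
    (A `&` (fun=> 1) @^-1` B) `|` (~` A `&` (fun=> 0) @^-1` B)).
  apply: measurableU; apply: measurableI => //; try exact: dmeas_cst.
  exact: measurableC.
apply/seteqP; split => y /=.
  by have [yA|yA] := pselect (A y); [rewrite mem_set//; left|
    rewrite memNset//; right].
by move=> [[yA]|[yA]]; [rewrite mem_set|rewrite memNset].
Qed.

Lemma dmeasD F F' : dmeas F -> dmeas F' -> dmeas (fun y => F y + F' y).
Proof. by move=> mF mF' B; exact: (preimage_op2_measurable (fun a b => a + b)). Qed.

Lemma dmeasM F F' : dmeas F -> dmeas F' -> dmeas (fun y => F y * F' y).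
Proof. by move=> mF mF' B; exact: (preimage_op2_measurable (fun a b => a * b)). Qed.

Lemma dmeas_sum (I : Type) (r : seq I) (F : I -> Y -> Z) :
  (forall i, dmeas (F i)) -> dmeas (fun y => \sum_(i <- r) F i y).
Proof.
move=> mF; elim: r => [|i r IH].
  rewrite (_ : (fun y => _) = fun=> 0); first exact: dmeas_cst.
  by apply: funext => y; rewrite big_nil.
rewrite (_ : (fun y => _) = fun y => F i y + \sum_(j <- r) F j y).
  exact: dmeasD.
by apply: funext => y; rewrite big_cons.
Qed.

(** The sum is 0 by convention where infinitely many terms are nonzero. On [tail N], where all terms
    of code at least N vanish, it is a finite sum, and off the union of these measurable sets it is
    the constant 0. *)
Lemma dmeas_fsum (I : choiceType) (c : I -> nat) (F : I -> Y -> Z) :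
  injective c -> (forall i, dmeas (F i)) ->
  dmeas (fun y => \sum_(i \in [set: I]) F i y).
Proof.
move=> ci mF B.
pose Fk k y := if uncode c k is Some i then F i y else 0.
have mFk k : dmeas (Fk k).
  by rewrite /Fk; case: (uncode c k) => [i|]; [exact: mF|exact: dmeas_cst].
have mFk0 k : measurable [set y | Fk k y = 0] by exact: (mFk k [set 0]).
pose tail N := \bigcap_(k in [set k | (N <= k)%N]) [set y | Fk k y = 0].
have mtail N : measurable (tail N) by exact: bigcap_measurableType.
have tailE N y : tail N y ->
    \sum_(i \in [set: I]) F i y = \sum_(0 <= k < N) Fk k y.
  move=> ty; apply: big_uncode => // i Ni.
  by have := ty (c i) Ni; rewrite /Fk/= uncode_pcancel.
rewrite (_ : _ @^-1` _ =
  (\bigcup_N (tail N `&` (fun y => \sum_(0 <= k < N) Fk k y) @^-1` B)) `|`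
  (~` (\bigcup_N tail N) `&` (fun=> 0) @^-1` B)).
  apply: measurableU; last first.
    apply: measurableI; last exact: dmeas_cst.
    by apply: measurableC; exact: bigcupT_measurable.
  by apply: bigcupT_measurable => N; apply: measurableI => //; exact: dmeas_sum.
have nt0 y : ~ (\bigcup_N tail N) y -> \sum_(i \in [set: I]) F i y = 0.
  move=> nt; rewrite fsbig_dflt// => fin; apply: nt.
  have /finite_seqP[r rE] := fin.
  exists (\max_(i <- r) c i).+1 => // k /= Nk; rewrite /Fk.
  have := uncodeK c k; case: (uncode c k) => //= i ik.
  apply: contrapT => Fi; have : [set` r] i by rewrite -rE.
  by move=> /= ir; have := @leq_bigmax_seq _ r xpredT c i ir isT; rewrite leqNgt ik Nk.
apply/seteqP; split => y /=.
  have [[N _ tN]|nt] := pselect ((\bigcup_N tail N) y).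
    by rewrite (tailE _ _ tN) => By; left; exists N.
  by rewrite nt0// => B0; right.
by move=> [[N _ [tN By]]|[nt By]]; [rewrite (tailE _ _ tN)|rewrite nt0].
Qed.

End DiscreteMeasurability.

Lemma dmeas_comp d d' (Y : measurableType d) (Y' : measurableType d')
    (Z : coefficient) (h : Y' -> Y) (F : Y -> Z) :
  measurable_fun setT h -> dmeas F -> dmeas (fun y => F (h y)).
Proof.
move=> mh mF B; rewrite (_ : _ @^-1` B = h @^-1` (F @^-1` B))//.
by rewrite -[X in measurable X]setTI; exact: mh.
Qed.

(** Stated with duplicate-free lists, a cardinality bound transfers along injections by mapping
    lists, without deciding first whether the sets are finite. *)
Lemma counting_leP (T : choiceType) (R : realType) (A : set T) (N : nat) :
  (counting A <= N%:R%:E :> \bar R)%E <->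
  (forall s : seq T, uniq s -> {in s, forall x, A x} -> (size s <= N)%N).
Proof.
rewrite /counting; case: asboolP => finA; last first.
  split=> // sN; have [B BA NB] := infinite_set_fset N.+1 finA.
  have := sN _ (finmap.fset_uniq B) BA.
  by rewrite leqNgt NB.
rewrite lee_fin ler_nat; split=> [AN s us sA|]; last first.
  by apply; [exact: finmap.fset_uniq|move=> x; rewrite in_fset_set// inE].
apply: leq_trans AN; apply: uniq_leq_size => // x xs.
by rewrite in_fset_set// inE; exact: sA.
Qed.

Section ZRTheory.
Context d (X : measurableType d) (R : realType) (mu : probability X R).
Variables (Z : coefficient) (E : measured_equivalence mu).
Implicit Types (a b : ZR Z E) (lam : X * X -> Z).

Lemma zr_reprP a : is_zr E (zr_repr a).
Proof. exact/asboolP/(valP (repr a)). Qed.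

Lemma zr_eqP a b : a = b <->
  \forall x \ae mu, forall y, meq_rel E (x, y) -> zr_repr a (x, y) = zr_repr b (x, y).
Proof.
split=> [->|ab]; first exact: nearW.
rewrite -[a]reprK -[b]reprK; apply/eqP; rewrite -Quotient.idealrBE.
apply/asboolP; apply: filterS ab => x h y Exy.
by rewrite -[LHS]/(zr_repr a (x, y) - zr_repr b (x, y)) h// subrr.
Qed.

Lemma zr_classK lam : is_zr E lam -> \forall x \ae mu,
  forall y, meq_rel E (x, y) -> zr_repr (zr_class E lam) (x, y) = lam (x, y).
Proof.
move=> lf; have fP : zr_pred E lam by exact/asboolP.
have : repr (zr_class E lam) - ZrFun fP \in @zr_null _ _ _ mu Z E.
  rewrite Quotient.idealrBE reprK /zr_class.
  have -> // : insubd (0 : zr_fun Z E) lam = ZrFun fP.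
  by apply: val_inj; rewrite insubdK.
move=> /asboolP; apply: filterS => x h y Exy.
by move: (h y Exy); rewrite -[X in X -> _]/(zr_repr _ (x, y) - lam (x, y) = 0) => /subr0_eq.
Qed.

Lemma zr_reprD a b : \forall x \ae mu, forall y, meq_rel E (x, y) ->
  zr_repr (a + b) (x, y) = zr_repr a (x, y) + zr_repr b (x, y).
Proof.
have e : \pi_(ZR Z E)%qT (repr a + repr b) = a + b.
  by rewrite -[RHS]/(Quotient.add a b) Quotient.pi_add !reprK.
have := zr_classK (elimT (asboolP _) (valP (repr a + repr b))).
by rewrite /zr_class valKd e.
Qed.

End ZRTheory.

(** * Orbits of a countable group *)

Section Orbits.
Context d (X : measurableType d) (R : realType) (mu : probability X R).
Variables (G : groupType) (alpha : standard_action mu G).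
Variables (c : G -> nat) (c_inj : injective c).
Hypothesis diagX : measurable [set p : X * X | p.1 = p.2].

Definition free_pt x := forall g, alpha g x = x -> g = 1%g.

Lemma sactK g : cancel (alpha g) (alpha g^-1%g).
Proof. by move=> x; rewrite -sactM mulVg sact1. Qed.
Lemma sactVK g : cancel (alpha g^-1%g) (alpha g).
Proof. by move=> x; rewrite -sactM mulgV sact1. Qed.

Lemma free_pt_inj x g h : free_pt x -> alpha g^-1%g x = alpha h^-1%g x -> g = h.
Proof.
move=> fx e; suff /(congr1 (fun k => k * h)%g) : (g * h^-1)%g = 1%g.
  by rewrite mulgVK mul1g.
by apply: fx; rewrite sactM -e sactVK.
Qed.

Lemma orbitP x y : orbit_rel alpha (x, y) <-> exists g, y = alpha g^-1%g x.
Proof.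
split=> -[g /= ->]; exists g; first by rewrite sactK.
by rewrite sactVK.
Qed.

Lemma orbit_sact x g : orbit_rel alpha (x, alpha g^-1%g x).
Proof. by apply/orbitP; exists g. Qed.

Lemma ae_orbit (P : X -> Prop) : (\forall x \ae mu, P x) ->
  \forall x \ae mu, forall g, P (alpha g x).
Proof. by move=> aeP; apply: (ae_forall c_inj) => g; exact: sact_ae. Qed.

Lemma measurable_sact g : measurable_fun setT (alpha g).
Proof. exact: sact_measurable. Qed.

Lemma measurable_graph g : measurable [set p : X * X | p.1 = alpha g p.2].
Proof.
rewrite (_ : [set _ | _] = (fun p : X * X => (p.1, alpha g p.2)) @^-1`
  [set p : X * X | p.1 = p.2])//.
rewrite -[X in measurable X]setTI.
have mf : measurable_fun setT (fun p : X * X => (p.1, alpha g p.2)).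
  apply: measurable_fun_pair; first exact: measurable_fst.
  by apply: measurableT_comp; [exact: measurable_sact|exact: measurable_snd].
exact: mf.
Qed.

(* The first element of G in the enumeration taking x to a given point: it makes
   sums over orbits into sums over G also at the points that are not free. *)
Definition first_at g : set X := fun x =>
  forall h, (c h < c g)%N -> alpha h^-1%g x <> alpha g^-1%g x.

Lemma measurable_first g : measurable (first_at g).
Proof.
rewrite (_ : first_at g = \bigcap_h (if (c h < c g)%N then
   ~` [set x | alpha h^-1%g x = alpha g^-1%g x] else setT)); last first.
  apply/seteqP; split=> x fx h; first by move=> _; case: ifPn => // /fx.
  by move=> hg; have := fx h I; rewrite hg.
rewrite -[X in measurable X]setCK setC_bigcap; apply: measurableC.
apply: countable_bigcupT_measurable; first exact: countable_enum c_inj.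
move=> h; apply: measurableC; case: ifPn => // _; apply: measurableC.
rewrite (_ : [set _ | _] = (fun x => (alpha h^-1%g x, alpha g^-1%g x)) @^-1`
  [set p : X * X | p.1 = p.2])// -[X in measurable X]setTI.
have mf : measurable_fun setT (fun x => (alpha h^-1%g x, alpha g^-1%g x)).
  by apply: measurable_fun_pair; exact: measurable_sact.
exact: mf.
Qed.

Lemma first_bij x : set_bij [set g | first_at g x]
  [set y | orbit_rel alpha (x, y)] (fun g => alpha g^-1%g x).
Proof.
split.
- by move=> g _; exact: orbit_sact.
- move=> g h /[!inE] fg fh e; apply: c_inj; have [gh|hg|//] := ltngtP (c g) (c h).
    by have := fh g gh; rewrite e.
  by have := fg h hg; rewrite e.
- move=> y /orbitP[g yE].
  have ex : exists n, `[< exists2 h, c h = n & y = alpha h^-1%g x >].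
    by exists (c g); apply/asboolP; exists g.
  have [n /asboolP[h hn hy] nmin] := ex_minnP ex.
  exists h => //= k kh e; have := nmin (c k); rewrite leqNgt -hn kh => /(_ _)/negP.
  by apply => //; apply/asboolP; exists k => //; rewrite e.
Qed.

Section OrbitSums.
Variable Z : coefficient.

Lemma orbit_sum (F : X -> Z) x :
  \sum_(y \in [set y | orbit_rel alpha (x, y)]) F y =
  \sum_(g \in [set: G]) (x \in first_at g)%:R * F (alpha g^-1%g x).
Proof.
rewrite (reindex_fsbig (fun g => alpha g^-1%g x) _ _ _ (first_bij x)).
rewrite fsbig_mkcond; apply: eq_fsbigr => g _.
rewrite /patch; have [fx|fx] := pselect (first_at g x).
  by rewrite !mem_set// mul1r.
by rewrite !memNset// mul0r.
Qed.

Lemma orbit_sum_free (F : X -> Z) x : free_pt x ->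
  \sum_(y \in [set y | orbit_rel alpha (x, y)]) F y =
  \sum_(g \in [set: G]) F (alpha g^-1%g x).
Proof.
move=> fx; rewrite orbit_sum; apply: eq_fsbigr => g _.
rewrite mem_set ?mul1r// => h hg /(free_pt_inj fx) hg'.
by rewrite hg' ltnn in hg.
Qed.

(** The maps x to g^-1 x are countably many Borel sections covering the orbit relation; they play
    the part that Lusin-Novikov has for a general relation. *)
Lemma dmeas_orbit_sum d' (Y : measurableType d') (p : Y -> X) (F : Y -> X -> Z) :
  measurable_fun setT p -> (forall g, dmeas (fun y => F y (alpha g^-1%g (p y)))) ->
  dmeas (fun y => \sum_(w \in [set w | orbit_rel alpha (p y, w)]) F y w).
Proof.
move=> mp mF; rewrite (_ : (fun y => _) = fun y => \sum_(g \in [set: G])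
    (p y \in first_at g)%:R * F y (alpha g^-1%g (p y))); last first.
  by apply: funext => y; rewrite (orbit_sum (F y)).
apply: (dmeas_fsum c_inj) => g; apply: dmeasM; last exact: mF.
exact: (@dmeas_comp _ _ _ _ Z p (fun x => (x \in first_at g)%:R) mp
  (dmeas_indic (measurable_first g))).
Qed.

Lemma dmeas_kernel (s : crossed_product alpha Z) : dmeas (cp_kernel s).
Proof.
rewrite (_ : cp_kernel s = fun p => \sum_(g \in [set: G])
    (p \in [set p : X * X | p.1 = alpha g p.2])%:R *
     linf_repr (xcoef s g) p.1); last first.
  apply: funext => p; rewrite /cp_kernel fsbig_mkcond; apply: eq_fsbigr => g _.
  rewrite /patch; have [h|h] := pselect (p.1 = alpha g p.2).
    by rewrite !mem_set// mul1r.
  by rewrite !memNset// mul0r.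
apply: (dmeas_fsum c_inj) => g; apply: dmeasM.
  exact: (dmeas_indic (measurable_graph g)).
apply: (dmeas_comp (F := linf_repr (xcoef s g)) measurable_fst).
by case: (linf_reprP (xcoef s g)).
Qed.

Lemma cp_kernel_free (s : crossed_product alpha Z) x g : free_pt x ->
  cp_kernel s (x, alpha g^-1%g x) = linf_repr (xcoef s g) x.
Proof.
move=> fx; rewrite /cp_kernel/= (_ : [set h | _] = [set g]) ?fsbig_set1//.
apply/seteqP; split=> h /=; last by move=> ->; rewrite sactVK.
by move=> e; apply: (free_pt_inj fx); rewrite {1}e sactK.
Qed.

End OrbitSums.

End Orbits.

(** * The crossed product inside the equivalence relation ring *)

Section LinfMore.
Context d (X : measurableType d) (R : realType) (mu : probability X R).
Variable Z : coefficient.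
Implicit Types a : Linf mu Z.

Lemma linf_repr_sum (I : Type) (r : seq I) (F : I -> Linf mu Z) :
  \forall x \ae mu, linf_repr (\sum_(i <- r) F i) x = \sum_(i <- r) linf_repr (F i) x.
Proof.
elim: r => [|i r IH].
  by apply: filterS (linf_repr0 mu Z) => x; rewrite !big_nil.
rewrite big_cons; apply: filterS2 IH (linf_reprD (F i) (\sum_(j <- r) F j)).
by move=> x IH ->; rewrite IH big_cons.
Qed.

Lemma linf_indicE (A : set X) : measurable A ->
  \forall x \ae mu, linf_repr (linf_indic mu Z A) x = (x \in A)%:R.
Proof.
move=> mA; apply: linf_classK; split; first exact: dmeas_indic.
exists (coef_norm R (1 : Z)); apply: nearW => x; case: (x \in A) => //.
by rewrite coef_norm0 coef_norm_ge0.
Qed.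

End LinfMore.

Section Embedding.
Context d (X : measurableType d) (R : realType) (mu : probability X R).
Variables (Z : coefficient) (E : measured_equivalence mu).
Variables (G : groupType) (alpha : standard_action mu G).
Variables (c : G -> nat) (c_inj : injective c).
Hypothesis diagX : measurable [set p : X * X | p.1 = p.2].
Hypothesis hE : meq_rel E = orbit_rel alpha.
Local Notation CP := (crossed_product alpha Z).
Implicit Types (s : CP) (t : ZR Z E) (lam : X * X -> Z).

Let freeP : \forall x \ae mu, free_pt alpha x := sact_free alpha.

(** As the group is countable, equality nu-almost everywhere splits into one mu-almost everywhere
    statement for each g. An element of the ring is therefore determined by its coefficients. *)
Lemma ae_kernel_coords lam lam' :
  (\forall x \ae mu, forall y, meq_rel E (x, y) -> lam (x, y) = lam' (x, y)) <->
  forall g, \forall x \ae mu, lam (x, alpha g^-1%g x) = lam' (x, alpha g^-1%g x).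
Proof.
rewrite hE; split=> [h g|h].
  by apply: filterS h => x; apply; exact: orbit_sact.
apply: filterS (ae_forall c_inj h) => x hx y /orbitP[g ->]; exact: hx.
Qed.

(** Products are formed through [zr_class], which is 0 unless its argument is shown to lie in the
    ring; this shows it by comparison with a better known function. The column bound at y concerns
    the points (g y, y), so the exceptional null set must be avoided along the whole orbit of y. *)
Lemma is_zr_ext lam lam' : is_zr E lam' -> (forall p, lam p != 0 -> meq_rel E p) ->
  dmeas lam ->
  (\forall x \ae mu, forall y, meq_rel E (x, y) -> lam (x, y) = lam' (x, y)) ->
  is_zr E lam.
Proof.
move=> [s' m' [k b'] [N r'] [M c']] sl ml e.
have off (l : X * X -> Z) p : (forall p, l p != 0 -> meq_rel E p) ->
    ~ meq_rel E p -> l p = 0.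
  by move=> sp; apply: contra_notP => /eqP /sp.
have eE : \forall x \ae mu, forall y, lam (x, y) = lam' (x, y).
  apply: filterS e => x h y; have [/h//|nE] := pselect (meq_rel E (x, y)).
  by rewrite !off.
split => //.
- by exists k; apply: filterS2 b' eE => x bx ex y Exy; rewrite ex; exact: bx.
- by exists N; apply: filterS2 r' eE => x rx ex; rewrite /supp_card;
    under [X in counting X]eq_set do rewrite ex.
- exists M; apply: filterS2 c' (ae_orbit alpha c_inj eE) => y cy ey.
  rewrite /supp_card (_ : [set x | _] = [set x | lam' (x, y) != 0])//.
  apply/seteqP; split => x /=.
    have [|nE] := pselect (meq_rel E (x, y)); last by rewrite (off _ _ sl nE) eqxx.
    by rewrite {1}hE => -[g /= ->]; rewrite ey.
  have [|nE] := pselect (meq_rel E (x, y)); last by rewrite (off _ _ s' nE) eqxx.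
  by rewrite {1}hE => -[g /= ->]; rewrite ey.
Qed.

Lemma is_linf_zr lam g : is_zr E lam -> is_linf mu (fun x => lam (x, alpha g^-1%g x)).
Proof.
move=> [_ ml [k b] _ _]; split.
  apply: (@dmeas_comp _ _ _ _ _ (fun x => (x, alpha g^-1%g x)) lam) => //.
  by apply: measurable_fun_pair => //; exact: measurable_sact.
by exists k; apply: filterS b => x bx; apply: bx; rewrite hE; exact: orbit_sact.
Qed.

(* The coefficients of an element of the equivalence relation ring, written as an
   infinite formal sum of the (u g, g). *)
Definition zcoef t : G -> Linf mu Z :=
  fun g => linf_class mu (fun x => zr_repr t (x, alpha g^-1%g x)).

Lemma zcoefE t g :
  \forall x \ae mu, linf_repr (zcoef t g) x = zr_repr t (x, alpha g^-1%g x).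
Proof. by apply: linf_classK; apply: is_linf_zr; exact: zr_reprP. Qed.

Lemma zcoef_class lam g : is_zr E lam -> \forall x \ae mu,
  linf_repr (zcoef (zr_class E lam) g) x = lam (x, alpha g^-1%g x).
Proof.
move=> zl; apply: filterS2 (zcoefE (zr_class E lam) g) (zr_classK zl) => x -> ->//.
by rewrite hE; exact: orbit_sact.
Qed.

Lemma zcoef_inj t t' : (forall g, zcoef t g = zcoef t' g) -> t = t'.
Proof.
move=> e; apply/zr_eqP/(ae_kernel_coords (zr_repr t) (zr_repr t')) => g.
by apply: filterS2 (zcoefE t g) (zcoefE t' g) => x <- <-; rewrite e.
Qed.

Lemma zcoefD t t' g : zcoef (t + t') g = zcoef t g + zcoef t' g.
Proof.
apply/linf_eqP.
apply: filterS2 (filterI (zcoefE (t + t') g) (zcoefE t g)) (filterI (zcoefE t' g)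
  (filterI (linf_reprD (zcoef t g) (zcoef t' g)) (zr_reprD t t'))).
move=> x [-> t1] [t2 [-> ->]]; first by rewrite t1 t2.
by rewrite hE; exact: orbit_sact.
Qed.

Lemma cp_kernel_supp s p : cp_kernel s p != 0 -> meq_rel E p.
Proof.
apply: contraNP => /= nE; rewrite /cp_kernel (_ : [set g | _] = set0) ?fsbig_set0//.
by apply/seteqP; split=> g //= e; apply: nE; rewrite hE; exists g.
Qed.

Lemma cp_kernel_zr s : is_zr E (cp_kernel s).
Proof.
have [r ur ru] := xring_supp s.
have s0 g : g \notin r -> xcoef s g = 0.
  by move=> gr; apply/eqP; apply: contraNT gr; exact: ru.
have off : \forall x \ae mu, forall g, g \notin r -> linf_repr (xcoef s g) x = 0.
  apply: (ae_forall c_inj) => g; have [gr|gr] := boolP (g \in r); first exact: nearW.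
  by rewrite s0//; apply: filterS (linf_repr0 mu Z).
split.
- exact: cp_kernel_supp.
- exact: (dmeas_kernel c_inj diagX s).
- pose b g := `|projT1 (cid (linf_reprP (xcoef s g)).2)|.
  have bP : \forall x \ae mu, forall g, coef_norm R (linf_repr (xcoef s g) x) <= b g.
    apply: (ae_forall c_inj) => g; rewrite /b; case: cid => k /=.
    by apply: filterS => x kx; exact: le_trans kx (ler_norm k).
  have b0 g : 0 <= b g by exact: normr_ge0.
  exists (\sum_(g <- r) b g).
  apply: filterS3 freeP off bP => x fx ox bx y; rewrite {1}hE => /orbitP[g ->].
  rewrite cp_kernel_free//; have [gr|gr] := boolP (g \in r); last first.
    by rewrite ox// coef_norm0 sumr_ge0.
  by rewrite (bigD1_seq g)//= (le_trans (bx g))// lerDl sumr_ge0.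
- exists (size r); apply: filterS2 freeP off => x fx ox.
  apply/counting_leP => q uq qx.
  rewrite -(size_map (fun g => alpha g^-1%g x)); apply: uniq_leq_size => // y yq.
  have : orbit_rel alpha (x, y) by rewrite -hE; apply: cp_kernel_supp (qx y yq).
  move=> /orbitP[g yE]; apply/mapP; exists g => //; apply: contraTT isT => gr.
  by have := qx y yq; rewrite /= yE cp_kernel_free// ox// eqxx.
- exists (size r); apply: filterS2 (ae_orbit alpha c_inj freeP)
    (ae_orbit alpha c_inj off) => y fy oy.
  apply/counting_leP => q uq qx.
  rewrite -(size_map (fun g => alpha g y)); apply: uniq_leq_size => // x xq.
  have : orbit_rel alpha (x, y) by rewrite -hE; apply: cp_kernel_supp (qx x xq).
  move=> [g /= xE]; apply/mapP; exists g => //; apply: contraTT isT => gr.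
  have e : cp_kernel s (alpha g y, y) = linf_repr (xcoef s g) (alpha g y).
    by rewrite -{2}(sactK alpha g y) cp_kernel_free.
  by have := qx x xq; rewrite /= xE e oy// eqxx.
Qed.

Definition zr_incl s : ZR Z E := zr_class E (cp_kernel s).

Lemma zcoef_incl s : zcoef (zr_incl s) = xcoef s.
Proof.
apply: funext => g; apply/linf_eqP.
apply: filterS2 (zcoef_class g (cp_kernel_zr s)) freeP => x -> fx.
by rewrite cp_kernel_free.
Qed.

Lemma zr_conv_supp t t' p :
  \sum_(w \in [set w | meq_rel E (p.1, w)]) zr_repr t (p.1, w) * zr_repr t' (w, p.2)
    != 0 -> meq_rel E p.
Proof.
apply: contraNP => nE; rewrite fsbig1// => w /= Ew.
have [//|/eqP h] := eqVneq (zr_repr t' (w, p.2)) 0; first by move=> ->; rewrite mulr0.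
case: (zr_reprP t') => sp _ _ _ _; case: nE.
by case: p Ew h => x y /= Ew /eqP /sp; exact: meq_trans.
Qed.

Lemma zr_conv_dmeas t t' : dmeas (fun p : X * X =>
  \sum_(w \in [set w | meq_rel E (p.1, w)]) zr_repr t (p.1, w) * zr_repr t' (w, p.2)).
Proof.
rewrite hE; apply: (dmeas_orbit_sum c_inj diagX (p := fst)
  (F := fun p w => zr_repr t (p.1, w) * zr_repr t' (w, p.2))).
  exact: measurable_fst.
have mg g : measurable_fun setT (fun p : X * X => alpha g^-1%g p.1).
  by apply: measurableT_comp; [exact: measurable_sact|exact: measurable_fst].
move=> g; apply: dmeasM.
  apply: (@dmeas_comp _ _ _ _ _ (fun p : X * X => (p.1, alpha g^-1%g p.1)) (zr_repr t)).
    by apply: measurable_fun_pair => //; exact: measurable_fst.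
  by case: (zr_reprP t).
apply: (@dmeas_comp _ _ _ _ _ (fun p : X * X => (alpha g^-1%g p.1, p.2)) (zr_repr t')).
  by apply: measurable_fun_pair => //; exact: measurable_snd.
by case: (zr_reprP t').
Qed.

(** This is the product of (a, h) with t. A product with an element of the crossed product is almost
    everywhere a finite sum of such terms, so no bound on general convolutions has to be proved. *)
Lemma is_zr_shift (a : Linf mu Z) (h : G) t :
  is_zr E (fun p => linf_repr a p.1 * zr_repr t (alpha h^-1%g p.1, p.2)).
Proof.
have [ma [k ka]] := linf_reprP a.
have [st mt [b bt] [N rt] [M ct]] := zr_reprP t.
split.
- move=> p; apply: contraNP => nE; have -> : zr_repr t (alpha h^-1%g p.1, p.2) = 0.
    apply/eqP; apply: contraT => /st Et; case: nE; case: p Et => x y /=.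
    by apply: meq_trans; rewrite hE; exact: orbit_sact.
  by rewrite mulr0.
- apply: dmeasM; first exact: (dmeas_comp (F := linf_repr a) measurable_fst).
  apply: (@dmeas_comp _ _ _ _ _ (fun p : X * X => (alpha h^-1%g p.1, p.2)) (zr_repr t)).
    apply: measurable_fun_pair; last exact: measurable_snd.
    by apply: measurableT_comp; [exact: measurable_sact|exact: measurable_fst].
  exact: mt.
- exists (k * b); apply: filterS2 ka (sact_ae alpha h^-1%g bt) => x kx bx y Exy.
  rewrite coef_normM ler_pM ?coef_norm_ge0//; apply: bx.
  by apply: meq_trans Exy; apply: meq_sym; rewrite hE; exact: orbit_sact.
- exists N; apply: filterS (sact_ae alpha h^-1%g rt) => x rx.
  apply/counting_leP => q uq qx; move/counting_leP : rx; apply => // y yq /=.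
  by apply: contraNN (qx y yq) => /eqP ->; rewrite /= mulr0.
- exists M; apply: filterS ct => y cy.
  apply/counting_leP => q uq qx; rewrite -(size_map (alpha h^-1%g)).
  move/counting_leP : cy; apply.
    by rewrite map_inj_uniq//; exact: can_inj (sactVK alpha h).
  move=> _ /mapP[x xq ->] /=.
  by apply: contraNN (qx x xq) => /eqP ->; rewrite /= mulr0.
Qed.

Lemma is_zr_sum (I : Type) (r : seq I) (F : I -> X * X -> Z) :
  (forall i, is_zr E (F i)) -> is_zr E (fun p => \sum_(i <- r) F i p).
Proof.
move=> zF; have : \sum_(i <- r) F i \in @zr_pred _ _ _ _ Z E.
  by apply: rpred_sum => i _; apply/asboolP.
by move=> /asboolP; rewrite fct_sumE.
Qed.

(** The quantifier over [F] stands inside the almost everywhere statement: the null set depends on s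
    alone, so [F] may be an entry function of another kernel with a varying second point. *)
Lemma zr_conv_incl s (r : seq G) : uniq r -> (forall h, xcoef s h != 0 -> h \in r) ->
  \forall x \ae mu, forall F : X -> Z,
   \sum_(w \in [set w | meq_rel E (x, w)]) zr_repr (zr_incl s) (x, w) * F w =
   \sum_(h <- r) linf_repr (xcoef s h) x * F (alpha h^-1%g x).
Proof.
move=> ur ru; have s0 g : g \notin r -> xcoef s g = 0.
  by move=> gr; apply/eqP; apply: contraNT gr; exact: ru.
have off : \forall x \ae mu, forall g, g \notin r -> linf_repr (xcoef s g) x = 0.
  apply: (ae_forall c_inj) => g; have [gr|gr] := boolP (g \in r); first exact: nearW.
  by rewrite s0//; apply: filterS (linf_repr0 mu Z).
apply: filterS3 freeP off (zr_classK (cp_kernel_zr s)) => x fx ox ix F.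
rewrite hE (orbit_sum_free c_inj)//.
transitivity (\sum_(g \in [set: G]) linf_repr (xcoef s g) x * F (alpha g^-1%g x)).
  apply: eq_fsbigr => g _; rewrite ix; last by rewrite hE; exact: orbit_sact.
  by rewrite cp_kernel_free.
apply: fsum_seqE => // g; apply: contraNT => gr; by rewrite ox// mul0r.
Qed.

Lemma xscale_repr s (u : G -> Linf mu Z) (r : seq G) g :
  uniq r -> (forall h, xcoef s h != 0 -> h \in r) ->
  \forall x \ae mu, linf_repr (xscale s u g) x =
   \sum_(h <- r) linf_repr (xcoef s h) x * linf_repr (u (h^-1 * g)%g) (alpha h^-1%g x).
Proof.
move=> ur ru; rewrite (xscaleE u g ur ru).
pose F h := xcoef s h * linf_action alpha Z h (u (h^-1 * g)%g).
have h1 : \forall x \ae mu, forall h, linf_repr (F h) x =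
    linf_repr (xcoef s h) x * linf_repr (u (h^-1 * g)%g) (alpha h^-1%g x).
  apply: (ae_forall c_inj) => h.
  apply: filterS2 (linf_reprM (xcoef s h) (linf_action alpha Z h (u (h^-1 * g)%g)))
    (linf_transE alpha h (u (h^-1 * g)%g)) => x -> e.
  by rewrite -e.
apply: filterS2 h1 (linf_repr_sum r F) => x h1 ->.
by apply: eq_bigr => h _; exact: h1.
Qed.

Lemma zr_mul_incl s t : zcoef (zr_mul (zr_incl s) t) = xscale s (zcoef t).
Proof.
apply: funext => g; apply/linf_eqP; have [r ur ru] := xring_supp s.
have zl : is_zr E (fun p => \sum_(h <- r)
    linf_repr (xcoef s h) p.1 * zr_repr t (alpha h^-1%g p.1, p.2)).
  by apply: is_zr_sum => h; exact: is_zr_shift.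
have cE : \forall x \ae mu, forall y, meq_rel E (x, y) ->
   \sum_(w \in [set w | meq_rel E (x, w)]) zr_repr (zr_incl s) (x, w) * zr_repr t (w, y) =
   \sum_(h <- r) linf_repr (xcoef s h) x * zr_repr t (alpha h^-1%g x, y).
  apply: filterS (zr_conv_incl ur ru) => x ex y _.
  exact: (ex (fun w => zr_repr t (w, y))).
have zc := is_zr_ext zl (@zr_conv_supp (zr_incl s) t) (zr_conv_dmeas (zr_incl s) t) cE.
have tE : \forall x \ae mu, forall h, linf_repr (zcoef t (h^-1 * g)%g) (alpha h^-1%g x) =
    zr_repr t (alpha h^-1%g x, alpha g^-1%g x).
  apply: (ae_forall c_inj) => h.
  apply: filterS (sact_ae alpha h^-1%g (zcoefE t (h^-1 * g)%g)) => x ->.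
  by rewrite -sactM invgM invgK mulgK.
apply: filterS2 (filterI (zcoef_class g zc) cE)
  (filterI tE (xscale_repr (zcoef t) g ur ru)) => x [-> e1] [e2 ->].
rewrite /= e1; last by rewrite hE; exact: orbit_sact.
by apply: eq_bigr => h _; rewrite e2.
Qed.

Lemma zr_act_incl s (f : Linf mu Z) : zr_act (zr_incl s) f = cp_act s f.
Proof.
have [r ur ru] := xring_supp s.
have -> : cp_act s f = \sum_(h <- r) xcoef s h * linf_trans alpha h f.
  apply: fsum_seqE => // h; apply: contraNT => hr.
  have /eqP -> : xcoef s h == 0 by apply: contraNT hr; exact: ru.
  by rewrite mul0r.
set a := \sum_(h <- r) _.
have aE : \forall x \ae mu, linf_repr a x =
    \sum_(h <- r) linf_repr (xcoef s h) x * linf_repr f (alpha h^-1%g x).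
  have h1 : \forall x \ae mu, forall h,
     linf_repr (xcoef s h * linf_trans alpha h f) x =
     linf_repr (xcoef s h) x * linf_repr f (alpha h^-1%g x).
    apply: (ae_forall c_inj) => h.
    apply: filterS2 (linf_reprM (xcoef s h) (linf_trans alpha h f))
      (linf_transE alpha h f) => x -> e.
    by rewrite -e.
  apply: filterS2 h1 (linf_repr_sum r (fun h => xcoef s h * linf_trans alpha h f)).
  by move=> x h1 ->; apply: eq_bigr => h _; exact: h1.
pose b x := \sum_(y \in [set y | meq_rel E (x, y)]) zr_repr (zr_incl s) (x, y) * linf_repr f y.
have bE : \forall x \ae mu, b x = linf_repr a x.
  apply: filterS2 (zr_conv_incl ur ru) aE => x ex ->.
  exact: (ex (linf_repr f)).
suff lb : is_linf mu b.
  by apply/linf_eqP; apply: filterS2 bE (linf_classK lb) => x <-.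
split.
  rewrite /b hE; apply: (dmeas_orbit_sum c_inj diagX (p := id)
    (F := fun x y => zr_repr (zr_incl s) (x, y) * linf_repr f y)) => // g.
  apply: dmeasM.
    apply: (@dmeas_comp _ _ _ _ _ (fun x => (x, alpha g^-1%g x)) (zr_repr (zr_incl s))).
      by apply: measurable_fun_pair => //; exact: measurable_sact.
    by case: (zr_reprP (zr_incl s)).
  apply: (@dmeas_comp _ _ _ _ _ (alpha g^-1%g) (linf_repr f)).
    exact: measurable_sact.
  by case: (linf_reprP f).
have [_ [k ak]] := linf_reprP a.
by exists k; apply: filterS2 bE ak => x ->.
Qed.

Lemma is_zr_indic (A : set X) : measurable A ->
  is_zr E (fun p => ((p.1 == p.2) && (p.1 \in A))%:R : Z).
Proof.
move=> mA; split.
- move=> [x y] /=; have [->|] := eqVneq x y; last by rewrite eqxx.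
  by move=> _; exact: meq_refl.
- rewrite (_ : (fun p => _) = (fun p => (p \in [set p : X * X | p.1 = p.2] `&`
     (fst @^-1` A))%:R)).
    apply: dmeas_indic; apply: measurableI => //.
    by rewrite -[X in measurable X]setTI; exact: measurable_fst.
  apply: funext => p; congr (_%:R); rewrite in_setI; congr (_ && _).
  by apply/eqP/idP; rewrite inE.
- exists (coef_norm R (1 : Z)); apply: nearW => x y _ /=.
  by case: (_ && _) => //; rewrite coef_norm0 coef_norm_ge0.
- exists 1%N; apply: nearW => x; apply/counting_leP => q uq qx.
  apply: (@uniq_leq_size _ q [:: x]) => // y /qx /=.
  by have [->|_] := eqVneq x y; rewrite ?mem_seq1 ?eqxx.
- exists 1%N; apply: nearW => x; apply/counting_leP => q uq qx.
  apply: (@uniq_leq_size _ q [:: x]) => // y /qx /=.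
  by have [->|_] := eqVneq y x; rewrite ?mem_seq1 ?eqxx.
Qed.

Lemma zr_indicE (A : set X) : measurable A -> \forall x \ae mu,
  forall y, meq_rel E (x, y) ->
    zr_repr (zr_indic Z E A) (x, y) = ((x == y) && (x \in A))%:R.
Proof. by move=> mA; exact: (zr_classK (is_zr_indic mA)). Qed.

(** Right multiplication by the indicator keeps the entries whose second point lies in A. The
    coefficient of g at x has second point g^-1 x, whence the translate of the indicator by g. *)
Lemma zr_mul_indic t (A : set X) g : measurable A ->
  zcoef (zr_mul t (zr_indic Z E A)) g =
  zcoef t g * linf_trans alpha g (linf_indic mu Z A).
Proof.
move=> mA; have [st mt [b bt] [N rt] [M ct]] := zr_reprP t.
pose lam (p : X * X) := zr_repr t p * (p.2 \in A)%:R.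
have zl : is_zr E lam.
  split.
  - by move=> p; apply: contraNP => nE; rewrite /lam (_ : zr_repr t p = 0) ?mul0r//;
      apply: contra_notP nE => /eqP /st.
  - apply: dmeasM => //; apply: (@dmeas_comp _ _ _ _ _ snd (fun x => (x \in A)%:R)).
      exact: measurable_snd.
    exact: dmeas_indic.
  - exists b; apply: filterS bt => x bx y Exy; rewrite /lam coef_normM.
    apply: le_trans (bx y Exy); rewrite ler_piMr ?coef_norm_ge0//=.
    case: (_ \in _); last by rewrite coef_norm0.
    (* The norm of 1 is positive and equal to its own square, hence at most 1. *)
    by rewrite -(ler_pM2l (_ : 0 < coef_norm R (1 : Z))) ?mulr1 -?coef_normM ?mulr1//;
       move: (coef_norm_ge0 R (1 : Z)); rewrite le_eqVlt => /orP[/eqP|//];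
       case: Z => [|F] /=; rewrite ?normr1 ?oner_neq0.
  - exists N; apply: filterS rt => x rx.
    apply/counting_leP => q uq qx; move/counting_leP : rx; apply => // y yq /=.
    by apply: contraNN (qx y yq) => /eqP e; rewrite /lam /= e mul0r.
  - exists M; apply: filterS ct => x cx.
    apply/counting_leP => q uq qx; move/counting_leP : cx; apply => // y yq /=.
    by apply: contraNN (qx y yq) => /eqP e; rewrite /lam /= e mul0r.
have cE : \forall x \ae mu, forall y, meq_rel E (x, y) ->
    \sum_(w \in [set w | meq_rel E (x, w)])
      zr_repr t (x, w) * zr_repr (zr_indic Z E A) (w, y) = lam (x, y).
  apply: filterS (ae_orbit alpha c_inj (zr_indicE mA)) => x ix y Exy.
  have iE w : meq_rel E (x, w) ->
      zr_repr (zr_indic Z E A) (w, y) = ((w == y) && (w \in A))%:R.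
    move=> Exw; have := Exw; rewrite hE => /orbitP[g' wg]; move: (ix g'^-1%g y).
    by rewrite -wg; apply; apply: meq_trans Exy; exact: meq_sym.
  rewrite -(fsbig_widen [set y]); first by rewrite fsbig_set1 iE// eqxx.
    by move=> w /= ->.
  by move=> w [/= Exw /eqP wy]; rewrite iE// (negbTE wy) mulr0.
have zc := is_zr_ext zl (@zr_conv_supp t (zr_indic Z E A))
  (zr_conv_dmeas t (zr_indic Z E A)) cE.
apply/linf_eqP; apply: filterS2 (filterI (zcoef_class g zc) (filterI cE (zcoefE t g)))
  (filterI (linf_reprM (zcoef t g) (linf_trans alpha g (linf_indic mu Z A)))
   (filterI (linf_transE alpha g (linf_indic mu Z A))
    (sact_ae alpha g^-1%g (linf_indicE mu Z mA)))).
move=> x [-> [e1 e2]] [-> [e3 e4]] /=; rewrite e1; last by rewrite hE; exact: orbit_sact.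
by rewrite e2 e3 e4.
Qed.

End Embedding.

(** * Small exceptional sets *)

Section Vanishing.
Context d (X : measurableType d) (R : realType) (mu : probability X R).
Implicit Types (V W : nat -> set X).

Definition vanishing V := (forall p, measurable (V p)) /\
  forall e : R, 0 < e -> \forall p \near \oo, (mu (V p) <= e%:E)%E.

Lemma vanishing0 : vanishing (fun=> set0).
Proof.
by split=> // e e0; apply: nearW => p; rewrite measure0 lee_fin ltW.
Qed.

Lemma vanishingU V W : vanishing V -> vanishing W -> vanishing (fun p => V p `|` W p).
Proof.
move=> [mV vV] [mW vW]; split=> [p|e e0]; first exact: measurableU.
have e2 : 0 < e / 2 by rewrite divr_gt0.
apply: filterS2 (vV _ e2) (vW _ e2) => p Vp Wp.
rewrite [e]splitr EFinD; apply: (le_trans (measureU2 _ (mV p) (mW p))).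
exact: leeD.
Qed.

Lemma vanishing_bigcup (I : finType) (V : I -> nat -> set X) :
  (forall i, vanishing (V i)) -> vanishing (fun p => \bigcup_i V i p).
Proof.
move=> vV; have -> : (fun p => \bigcup_i V i p) =
    fun p => \big[setU/set0]_(i <- enum I) V i p.
  apply: funext => p; rewrite -bigcup_seq; congr bigcup.
  by apply/seteqP; split => i //= _; rewrite mem_enum.
elim: (enum I) => [|i r IH].
  by rewrite (_ : (fun p => _) = fun=> set0); [exact: vanishing0|
    apply: funext => p; rewrite big_nil].
rewrite (_ : (fun p => _) = fun p => V i p `|` \big[setU/set0]_(j <- r) V j p).
  exact: vanishingU.
by apply: funext => p; rewrite big_cons.
Qed.

End Vanishing.

Section BadSets.
Context d (X : measurableType d) (R : realType) (mu : probability X R).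
Variables (Z : coefficient) (G : groupType) (alpha : standard_action mu G).
Variables (c : G -> nat) (c_inj : injective c).
Implicit Types (u : G -> Linf mu Z) (V : nat -> set X).

(* The points at which u has a coefficient outside of the first p elements of G,
   or a coefficient ending in V. *)
Definition bad u (p : nat) (V : set X) : set X :=
  [set x | exists2 g, linf_repr (u g) x != 0 & (p <= c g)%N \/ V (alpha g^-1%g x)].

Definition row_finite u :=
  \forall x \ae mu, exists N, forall g, (N <= c g)%N -> linf_repr (u g) x = 0.

Lemma measurable_linf_neq0 (a : Linf mu Z) : measurable [set x | linf_repr a x != 0].
Proof. by case: (linf_reprP a) => ma _; exact: (ma [set z | z != 0]). Qed.

Lemma measurable_preim g (V : set X) : measurable V -> measurable (alpha g @^-1` V).
Proof.
by move=> mV; rewrite -[X in measurable X]setTI; exact: (sact_measurable alpha).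
Qed.

Lemma measurable_bad u p (V : set X) : measurable V -> measurable (bad u p V).
Proof.
move=> mV; rewrite (_ : bad u p V = \bigcup_g ([set x | linf_repr (u g) x != 0] `&`
    ((if (p <= c g)%N then setT else set0) `|` alpha g^-1%g @^-1` V))); last first.
  apply/seteqP; split=> x /=.
    by move=> [g ug [pg|Vg]]; exists g => //; split => //; [left; rewrite pg|right].
  by move=> [g _ [ug [h|Vg]]]; exists g => //; [left; move: h; case: ifP|right].
apply: countable_bigcupT_measurable; first exact: countable_enum c_inj.
move=> g; apply: measurableI; first exact: measurable_linf_neq0.
by apply: measurableU; [case: ifP|exact: measurable_preim].
Qed.

(** With V empty, only the condition on the code of g is left in [bad]. These sets decrease with q
    and their intersection is null by row finiteness, so continuity from above applies. *)
Lemma tail_small u (e : R) : row_finite u -> 0 < e ->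
  exists q, (mu (bad u q set0) <= e%:E)%E.
Proof.
move=> fu e0; pose T q := bad u q set0.
have mT q : measurable (T q) by exact: measurable_bad.
have mTI : measurable (\bigcap_q T q) by exact: bigcapT_measurable.
have T0 : mu (\bigcap_q T q) = 0%E.
  move: fu => [N [mN N0 sN]]; apply/eqP; rewrite eq_le measure_ge0 andbT -N0.
  apply: le_measure; rewrite ?inE//.
  move=> x Tx; apply: sN => /= -[n nx].
  by have [g /eqP ug [/nx//|]] := Tx n I.
have : mu (T n) @[n --> \oo] --> 0%:E.
  rewrite (_ : 0%:E = mu (\bigcap_q T q)); last by rewrite T0.
  apply: (@nonincreasing_cvg_mu _ _ _ mu T) => //.
    by rewrite (le_lt_trans (probability_le1 mu (mT 0%N)))// ltry.
  move=> m n mn; apply/subsetPset => x [g ug [ng|//]]; exists g => //; left.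
  exact: leq_trans ng.
move=> /fine_cvgP[Tf /cvgrPdist_le /(_ e e0) Te].
have [q _ hq] : \forall q \near \oo, (mu (T q) <= e%:E)%E.
  apply: filterS2 Tf Te => q Tq; rewrite sub0r normrN => h.
  by rewrite -(fineK Tq) lee_fin (le_trans (ler_norm _) h).
by exists q; exact: (hq q (leqnn q)).
Qed.

(** Half of e pays for the tail of u beyond some fixed q. For p at least q, the remaining points
    have a nonzero coefficient at one of the at most q elements of code below q, ending in [V p].
    The action preserves the measure, so they lie in q sets of measure at most that of [V p], which
    is made at most e/2 divided by q+1. *)
Lemma vanishing_bad u V : row_finite u -> vanishing mu V ->
  vanishing mu (fun p => bad u p (V p)).
Proof.
move=> fu [mV vV]; split=> [p|e e0]; first exact: measurable_bad.
have e2 : 0 < e / 2 by rewrite divr_gt0.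
have [q hq] := tail_small fu e2.
have q1 : 0 < q.+1%:R :> R by rewrite ltr0n.
have eq0 : 0 < e / 2 / q.+1%:R by rewrite divr_gt0.
pose W p k := if uncode c k is Some g then alpha g^-1%g @^-1` (V p) else set0.
have mW p k : measurable (W p k).
  by rewrite /W; case: uncode => [g|//]; exact: measurable_preim.
have muW p k : (mu (W p k) <= mu (V p))%E.
  by rewrite /W; case: uncode => [g|]; rewrite ?sact_preserving ?measure0.
apply: filterS2 (vV _ eq0) (nbhs_infty_ge q) => p Vp qp.
apply: (@le_trans _ _ (mu (bad u q set0 `|` \big[setU/set0]_(k < q) W p k))).
  apply: le_measure; rewrite ?inE; first exact: measurable_bad.
    apply: measurableU; first exact: measurable_bad.
    exact: bigsetU_measurable.
  move=> x [g ug h]; have [qg|gq] := leqP q (c g).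
    by left; exists g => //; left.
  right; rewrite -bigcup_mkord; exists (c g) => //.
  rewrite /W uncode_pcancel//; case: h => // pg.
  by move: gq; rewrite ltnNge (leq_trans qp pg).
rewrite [e in leRHS]splitr EFinD.
apply: (le_trans (measureU2 _ _ _)); first exact: measurable_bad.
  exact: bigsetU_measurable.
apply: leeD => //.
apply: (le_trans (Boole_inequality _ _)) => //.
apply: (@le_trans _ _ (\sum_(k < q) (e / 2 / q.+1%:R)%:E)%E).
  by apply: lee_sum => k _; exact: le_trans (muW p k) Vp.
rewrite sumEFin lee_fin sumr_const card_ord -[leLHS]mulr_natr.
rewrite -(mulrA (e / 2)) ler_piMr ?(ltW e2)//.
by rewrite mulrC ler_pdivrMr// mul1r ler_nat.
Qed.

(** Over Y every nonzero coefficient of u ends outside V, so right multiplication by the indicator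
    of the complement of V has no effect. This is what allows cuts in consecutive degrees to be
    composed. *)
Lemma bad_avoid u p (V Y : set X) (g : G) : measurable V -> measurable Y ->
  Y `&` bad u p V = set0 ->
  linf_indic mu Z Y * u g =
  linf_indic mu Z Y * u g * linf_trans alpha g (linf_indic mu Z (~` V)).
Proof.
move=> mV mY Y0; apply/linf_eqP.
have := linf_reprM (linf_indic mu Z Y * u g) (linf_trans alpha g (linf_indic mu Z (~` V))).
apply: filterS3 (filterI (linf_indicE mu Z mY) (linf_reprM (linf_indic mu Z Y) (u g)))
  (filterI (linf_transE alpha g (linf_indic mu Z (~` V)))
  (sact_ae alpha g^-1%g (linf_indicE mu Z (measurableC mV)))) => x [e1 e2] [e3 e4] ->.
rewrite e3 e4 e2 e1; have [Yx|nY] := pselect (Y x); last by rewrite memNset// !mul0r.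
rewrite mem_set// mul1r; have [->|ug] := eqVneq (linf_repr (u g) x) 0.
  by rewrite mul0r.
rewrite mem_set ?mulr1//= => Vg.
suff : (Y `&` bad u p V) x by rewrite Y0.
by split=> //; exists g => //; right.
Qed.

Lemma bad_finite u p (V Y : set X) (g : G) : measurable Y ->
  Y `&` bad u p V = set0 -> (p <= c g)%N -> linf_indic mu Z Y * u g = 0.
Proof.
move=> mY Y0 pg; apply/linf_eqP; apply: filterS3 (linf_indicE mu Z mY)
  (linf_reprM (linf_indic mu Z Y) (u g)) (linf_repr0 mu Z) => x e1 -> ->.
rewrite e1; have [Yx|nY] := pselect (Y x); last by rewrite memNset// mul0r.
rewrite mem_set// mul1r; apply/eqP; apply: contraT => ug.
suff : (Y `&` bad u p V) x by rewrite Y0.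
by split=> //; exists g => //; left.
Qed.

Lemma row_finite_xring (s : crossed_product alpha Z) : row_finite (xcoef s).
Proof.
have [r ur ru] := xring_supp s.
have s0 g : g \notin r -> xcoef s g = 0.
  by move=> gr; apply/eqP; apply: contraNT gr; exact: ru.
have off : \forall x \ae mu, forall g, g \notin r -> linf_repr (xcoef s g) x = 0.
  apply: (ae_forall c_inj) => g; have [gr|gr] := boolP (g \in r); first exact: nearW.
  by rewrite s0//; apply: filterS (linf_repr0 mu Z).
apply: filterS off => x ox; exists (\max_(g <- r) c g).+1 => g Ng; apply: ox.
apply: contraTN Ng => gr; rewrite -ltnNge ltnS.
exact: (@leq_bigmax_seq _ r xpredT c g gr isT).
Qed.

Section ZRRows.
Variable E : measured_equivalence mu.
Hypothesis hE : meq_rel E = orbit_rel alpha.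

(** At a free point different group elements lead to different points of the class, so the row bound
    of the kernel bounds the number of nonzero coefficients. *)
Lemma zr_rows (t : ZR Z E) : exists N : nat, \forall x \ae mu,
  forall r : seq G, uniq r -> {in r, forall g, linf_repr (zcoef alpha t g) x != 0} ->
   (size r <= N)%N.
Proof.
have [_ _ _ [N rt] _] := zr_reprP t; exists N.
apply: filterS3 rt (sact_free alpha) (ae_forall c_inj (zcoefE hE t)) => x rx fx tx r ur rr.
rewrite -(size_map (fun g => alpha g^-1%g x)); move/counting_leP : rx; apply.
  rewrite map_inj_in_uniq// => g h _ _; exact: free_pt_inj.
by move=> _ /mapP[g gr ->]; rewrite /= -tx; exact: rr.
Qed.

Lemma row_finite_zr (t : ZR Z E) : row_finite (zcoef alpha t).
Proof.
have [N tN] := zr_rows t; apply: filterS tN => x tN.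
have [fin|inf] := pselect (finite_set [set g | linf_repr (zcoef alpha t g) x != 0]).
  have /finite_seqP[r rE] := fin; exists (\max_(g <- r) c g).+1 => g Ng.
  apply/eqP; apply: contraTT Ng => tg; rewrite -ltnNge ltnS.
  have gr : [set` r] g by rewrite -rE.
  exact: (@leq_bigmax_seq _ r xpredT c g gr isT).
have [B BA NB] := infinite_set_fset N.+1 inf.
have := tN _ (finmap.fset_uniq B) BA.
by rewrite leqNgt NB.
Qed.

End ZRRows.

End BadSets.

(** * Norms *)

(* It allows us to integrate against nu, which is not given as a measure, by means
   of a series of measures with the same values. *)
Lemma eq_set_function_integral d (T : measurableType d) (R : realType)
    (m m' : set T -> \bar R) (D : set T) (f : T -> \bar R) :
  (forall A, measurable A -> m A = m' A) ->
  (\int[m]_(x in D) f x = \int[m']_(x in D) f x)%E.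
Proof.
move=> mm'; have sE (h : {nnsfun T >-> R}) : sintegral m h = sintegral m' h.
  by apply: eq_fsbigr => x _; rewrite mm'.
have eS (P : set {nnsfun T >-> R}) :
    [set sintegral m h | h in P] = [set sintegral m' h | h in P].
  by apply/seteqP; split => _ [h Ph <-]; exists h.
by rewrite /integral !eS.
Qed.

Lemma measurable_coef_norm d (T : measurableType d) (R : realType) (Z : coefficient)
    (f : T -> Z) :
  dmeas f -> measurable_fun setT (fun x => (coef_norm R (f x))%:E).
Proof. by move=> mf _ B _; rewrite setTI; exact: (mf [set z | B (coef_norm R z)%:E]). Qed.

Section OrbitIntegral.
Context d (X : measurableType d) (R : realType) (mu : probability X R).
Variables (G : groupType) (alpha : standard_action mu G).
Variables (c : G -> nat) (c_inj : injective c).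
Hypothesis diagX : measurable [set p : X * X | p.1 = p.2].
Hypothesis orbitX : measurable (orbit_rel alpha).

Let phi g (x : X) : X * X := (x, alpha g^-1%g x).

Let mphi g : measurable_fun setT (phi g).
Proof. by apply: measurable_fun_pair => //; exact: measurable_sact. Qed.

Let mphi_preim g A : measurable A -> measurable (phi g @^-1` A).
Proof. by move=> mA; rewrite -[X in measurable X]setTI; exact: mphi. Qed.

Let m1 (g : G) : {measure set (X * X) -> \bar R}.
Proof.
unshelve refine (pushforward mu (phi g) : {measure set (X * X) -> \bar R}).
exact: mphi.
Defined.

Let mk (k : nat) : {measure set (X * X) -> \bar R} :=
  if uncode c k is Some g then m1 g else mzero.

(** The elements g in [first_at] enumerate the class of x without repetition, so the fibre is a
    disjoint union of singletons or empty sets indexed by codes. *)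
Let counting_section A x : measurable A ->
  counting (xsection (A `&` orbit_rel alpha) x) =
  (\sum_(0 <= k <oo) (if uncode c k is Some g
     then \1_(first_at alpha c g `&` phi g @^-1` A) x else 0)%:E)%E :> \bar R.
Proof.
move=> mA.
pose F k : set X := if uncode c k is Some g then
  [set y | y = alpha g^-1%g x /\ (first_at alpha c g `&` phi g @^-1` A) x] else set0.
have FE k g : uncode c k = Some g -> F k =
    if x \in first_at alpha c g `&` phi g @^-1` A then [set alpha g^-1%g x] else set0.
  move=> kg; rewrite /F kg; apply/seteqP; split => y /=.
    by move=> [-> h]; rewrite mem_set.
  by case: ifP => // /[!inE] h ->.
have m1x (y : X) : measurable [set y].
  rewrite (_ : [set y] = xsection [set p : X * X | p.1 = p.2] y).
    exact: measurable_xsection.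
  by apply/seteqP; split => z /=; rewrite /xsection/= ?inE//= => ->.
have mF k : measurable (F k).
  case kE : (uncode c k) => [g|]; last by rewrite /F kE.
  by rewrite (FE _ _ kE); case: ifP.
have -> : xsection (A `&` orbit_rel alpha) x = \bigcup_k F k.
  apply/seteqP; split => y; rewrite /xsection /= ?inE.
    move=> [Ay] Oy; have [_ _ /(_ y Oy)[g fg gy]] := first_bij alpha c_inj x.
    exists (c g) => //; rewrite /F uncode_pcancel//; split => //.
    by split => //; rewrite /phi/= gy.
  move=> [k _]; rewrite /F; case: (uncode c k) => [g|//] [-> [_ Ap]].
  by split => //; exact: orbit_sact.
have tF : trivIset setT F.
  apply/trivIsetP => k l _ _ /eqP kl; apply/seteqP; split => // y [].
  rewrite /F; have := uncodeK c k; have := uncodeK c l.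
  case: (uncode c k) => [g|//]; case: (uncode c l) => [h|//] /= ch cg.
  move=> [-> [fg _]] [e [fh _]]; apply: kl; rewrite -ch -cg.
  by have [_ /(_ g h) inj _] := first_bij alpha c_inj x; rewrite inj ?inE.
rewrite (measure_semi_bigcup (counting : {measure set X -> \bar R}) mF tF); last first.
  exact: bigcupT_measurable.
apply: eq_eseriesr => k _; case kE : (uncode c k) => [g|]; last first.
  by rewrite /F kE measure0.
rewrite (FE _ _ kE) indicE; case: ifP => // _; last exact: measure0.
by rewrite /= /counting asboolT// fset_set1 finmap.cardfs1.
Qed.

(** On measurable sets [nu] is the sum over g of the images of mu under x to (x, g^-1 x). The
    restriction to [first_at] disappears because almost every point is free. *)
Let nu_series A : measurable A -> nu mu (orbit_rel alpha) A = mseries mk 0 A.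
Proof.
move=> mA; rewrite /nu.
under eq_integral => x _ do rewrite counting_section//.
have mfirst g : measurable (first_at alpha c g `&` phi g @^-1` A).
  by apply: measurableI; [exact: measurable_first|exact: mphi_preim].
rewrite integral_nneseries//; last 2 first.
- move=> k; case: (uncode c k) => [g|]; last exact: measurable_cst.
  by apply/measurable_EFinP; exact: measurable_indic.
- by move=> k x _; rewrite lee_fin; case: (uncode c k).
rewrite /mseries; apply: eq_eseriesr => k _; rewrite /mk.
case: (uncode c k) => [g|]; last by rewrite integral0_eq.
rewrite (@ae_eq_integral _ _ _ _ _ (fun x => (\1_(phi g @^-1` A) x)%:E))//.
- rewrite integral_indic//; last exact: mphi_preim.
  by rewrite setIT.
- by apply/measurable_EFinP; exact: measurable_indic.
- by apply/measurable_EFinP; apply: measurable_indic; exact: mphi_preim.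
- apply: filterS (sact_free alpha) => x fx _; rewrite !indicE in_setI.
  rewrite [x \in first_at _ _ _]mem_set// => h hg /(free_pt_inj fx) hg'.
  by rewrite hg' ltnn in hg.
Qed.

Lemma integral_nu (F : X * X -> \bar R) : (forall p, (0 <= F p)%E) ->
  measurable_fun setT F ->
  (\int[nu mu (orbit_rel alpha)]_(p in orbit_rel alpha) F p =
   \sum_(0 <= k <oo) (if uncode c k is Some g
      then \int[mu]_x F (x, alpha g^-1%g x) else 0))%E.
Proof.
move=> F0 mF; rewrite (eq_set_function_integral _ _ nu_series).
rewrite ge0_integral_measure_series//; last exact: measurable_funTS.
apply: eq_eseriesr => k _; rewrite /mk; case: (uncode c k) => [g|]; last first.
  exact: integral_measure_zero.
rewrite ge0_integral_pushforward//; last exact: measurable_funTS.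
by rewrite (_ : _ @^-1` _ = setT)//; apply/seteqP; split => // x _; exact: orbit_sact.
Qed.

End OrbitIntegral.

Lemma big_subseq_eq0 (R : Type) (idx : R) (op : Monoid.com_law idx) (I : eqType)
    (r q : seq I) (F : I -> R) :
  uniq r -> uniq q -> {subset r <= q} -> (forall i, i \notin r -> F i = idx) ->
  \big[op/idx]_(i <- q) F i = \big[op/idx]_(i <- r) F i.
Proof.
move=> ur uq rq F0; rewrite (bigID (mem r)) /= [X in op _ X]big1 ?Monoid.mulm1//.
rewrite -big_filter; apply: perm_big; apply: uniq_perm => //; first exact: filter_uniq.
by move=> i; rewrite mem_filter andb_idr// => /rq.
Qed.

Section Norms.
Context d (X : measurableType d) (R : realType) (mu : probability X R).
Variables (Z : coefficient) (E : measured_equivalence mu).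
Variables (G : groupType) (alpha : standard_action mu G).
Variables (c : G -> nat) (c_inj : injective c).
Hypothesis diagX : measurable [set p : X * X | p.1 = p.2].
Hypothesis hE : meq_rel E = orbit_rel alpha.
Local Notation CP := (crossed_product alpha Z).
Implicit Types (s t : CP) (u v : G -> Linf mu Z) (r : seq G).

Definition mass u r (x : X) : R := \sum_(g <- r) coef_norm R (linf_repr (u g) x).

(** An essential bound k on the l1 norms of the rows of u. Finite lists stand in for the sum over
    the group, since u may have infinite support. Such a k bounds right multiplication for the norm
    [nrm], see [nrmM]. *)
Definition rbound u (k : R) :=
  0 <= k /\ forall r, uniq r -> \forall x \ae mu, mass u r x <= k.

Lemma mass_ge0 u r x : 0 <= mass u r x.
Proof. by apply: sumr_ge0 => g _; exact: coef_norm_ge0. Qed.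

Lemma measurable_mass u r : measurable_fun setT (fun x => (mass u r x)%:E).
Proof.
rewrite (_ : (fun x => _) =
    fun x => (\sum_(g <- r) (coef_norm R (linf_repr (u g) x))%:E)%E); last first.
  by apply: funext => x; rewrite sumEFin.
apply: emeasurable_sum => g; apply: measurable_coef_norm.
by case: (linf_reprP (u g)).
Qed.

Lemma coef_norm_sum (I : Type) (q : seq I) (F : I -> Z) :
  coef_norm R (\sum_(i <- q) F i) <= \sum_(i <- q) coef_norm R (F i).
Proof.
elim: q => [|i q IH]; first by rewrite !big_nil coef_norm0.
by rewrite !big_cons (le_trans (coef_normD _ _ _))// lerD2l.
Qed.

Let orbitX : measurable (orbit_rel alpha).
Proof. by rewrite -hE; exact: meq_measurable. Qed.

Lemma l1normE s (lam : X * X -> Z) r : dmeas lam ->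
  (forall g, \forall x \ae mu, lam (x, alpha g^-1%g x) = linf_repr (xcoef s g) x) ->
  uniq r -> (forall h, xcoef s h != 0 -> h \in r) ->
  l1norm mu (orbit_rel alpha) lam = (\int[mu]_x (mass (xcoef s) r x)%:E)%E.
Proof.
move=> ml ls ur ru.
pose I g := (\int[mu]_x (coef_norm R (linf_repr (xcoef s g) x))%:E)%E.
have mI g : measurable_fun setT (fun x => (coef_norm R (linf_repr (xcoef s g) x))%:E).
  by apply: measurable_coef_norm; case: (linf_reprP (xcoef s g)).
have I0 g : g \notin r -> I g = 0%E.
  move=> gr; have s0 : xcoef s g = 0 by apply/eqP; apply: contraNT gr; exact: ru.
  rewrite /I (@ae_eq_integral _ _ _ _ _ (fun=> 0%E))//.
    by rewrite integral0_eq.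
  apply: filterS (linf_repr0 mu Z) => x e _.
  by rewrite s0 e coef_norm0.
rewrite /l1norm (integral_nu c_inj diagX orbitX); last 2 first.
- by move=> p; rewrite lee_fin coef_norm_ge0.
- exact: measurable_coef_norm.
have -> : (\int[mu]_x (mass (xcoef s) r x)%:E = \sum_(g <- r) I g)%E.
  rewrite -ge0_integral_sum//; last by move=> g x _; rewrite lee_fin coef_norm_ge0.
  by apply: eq_integral => x _; rewrite sumEFin.
pose N := (\max_(g <- r) c g).+1.
have cN g : g \in r -> (c g < N)%N.
  by move=> gr; rewrite ltnS; exact: (@leq_bigmax_seq _ r xpredT c g gr isT).
have IE k : (if uncode c k is Some g
    then \int[mu]_x (coef_norm R (lam (x, alpha g^-1%g x)))%:E else 0)%E =
    oapp I 0%E (uncode c k).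
  case: (uncode c k) => [g|//] /=; apply: ae_eq_integral => //.
    apply: (measurable_coef_norm (f := fun x => lam (x, alpha g^-1%g x))).
    apply: (@dmeas_comp _ _ _ _ _ (fun x => (x, alpha g^-1%g x)) lam) => //.
    by apply: measurable_fun_pair => //; exact: measurable_sact.
  by apply: filterS (ls g) => x -> _.
under eq_eseriesr => k _ do rewrite IE.
rewrite (nneseries_split 0 N)//; last first.
  by move=> k _; case: (uncode c k) => [g|]//=; apply: integral_ge0 => x _;
     rewrite lee_fin coef_norm_ge0.
rewrite add0n eseries0 ?adde0; last first.
  move=> k Nk _; have := uncodeK c k; case: (uncode c k) => //= g gk.
  by rewrite I0//; apply/negP => /cN; rewrite gk ltnNge Nk.
rewrite -(big_pmap (uncode c) I); apply: big_subseq_eq0 => //.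
  by apply: (pmap_uniq (uncodeK c)); exact: iota_uniq.
move=> g gr; rewrite mem_pmap; apply/mapP; exists (c g).
  by rewrite mem_index_iota cN.
by rewrite uncode_pcancel.
Qed.

Definition nrm s := l1norm mu (orbit_rel alpha) (cp_kernel s).

Lemma nrmE s r : uniq r -> (forall h, xcoef s h != 0 -> h \in r) ->
  nrm s = (\int[mu]_x (mass (xcoef s) r x)%:E)%E.
Proof.
apply: l1normE; first exact: (dmeas_kernel c_inj diagX).
by move=> g; apply: filterS (sact_free alpha) => x fx; rewrite cp_kernel_free.
Qed.

Lemma nrm_incl s : l1norm mu (meq_rel E) (zr_repr (zr_incl E s)) = nrm s.
Proof.
have [r ur ru] := xring_supp s; rewrite (nrmE ur ru) hE; apply: l1normE => //.
  by case: (zr_reprP (zr_incl E s)).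
move=> g; have := zcoefE hE (zr_incl E s) g.
by apply: filterS => x <-; rewrite (zcoef_incl c_inj diagX hE).
Qed.

Lemma nrm_ge0 s : (0 <= nrm s)%E.
Proof.
have [r ur ru] := xring_supp s; rewrite (nrmE ur ru).
by apply: integral_ge0 => x _; rewrite lee_fin mass_ge0.
Qed.

Lemma nrm0 : nrm 0 = 0%E.
Proof.
rewrite (@nrmE 0 [::])//; last by move=> h; rewrite eqxx.
by rewrite integral0_eq// => x _; rewrite /mass big_nil.
Qed.

Lemma massD u v r : \forall x \ae mu, mass (u + v) r x <= mass u r x + mass v r x.
Proof.
have h : \forall x \ae mu, forall g,
    linf_repr ((u + v) g) x = linf_repr (u g) x + linf_repr (v g) x.
  by apply: (ae_forall c_inj) => g; exact: (linf_reprD (u g) (v g)).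
apply: filterS h => x h; rewrite -big_split; apply: ler_sum => g _ /=.
by rewrite h coef_normD.
Qed.

Lemma common_supp s t : exists r, [/\ uniq r, forall h, xcoef s h != 0 -> h \in r &
  forall h, xcoef t h != 0 -> h \in r].
Proof.
have [r ur ru] := xring_supp s; have [q uq qt] := xring_supp t.
exists (undup (r ++ q)); split; first exact: undup_uniq.
- by move=> h /ru hr; rewrite mem_undup mem_cat hr.
- by move=> h /qt hr; rewrite mem_undup mem_cat hr orbT.
Qed.

Lemma ae_ge0_le_integral (f f' : X -> \bar R) : (forall x, 0 <= f x)%E ->
  (forall x, 0 <= f' x)%E -> measurable_fun setT f -> measurable_fun setT f' ->
  (\forall x \ae mu, (f x <= f' x)%E) -> (\int[mu]_x f x <= \int[mu]_x f' x)%E.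
Proof.
by move=> f0 f0' mf mf' ff'; apply: ae_ge0_le_integral => //; apply: filterS ff' => x.
Qed.

Lemma nrmD s t : (nrm (s + t) <= nrm s + nrm t)%E.
Proof.
have [r [ur ru rv]] := common_supp s t.
rewrite (nrmE ur ru) (nrmE ur rv) (@nrmE (s + t) r)//; last first.
  move=> h; apply: contraNT => hr; rewrite xcoefD.
  have /eqP -> : xcoef s h == 0 by apply: contraNT hr; exact: ru.
  by rewrite add0r; apply: contraNT hr; exact: rv.
rewrite -ge0_integralD//; last 4 first.
- by move=> x _; rewrite lee_fin mass_ge0.
- exact: measurable_mass.
- by move=> x _; rewrite lee_fin mass_ge0.
- exact: measurable_mass.
apply: ae_ge0_le_integral.
- by move=> x; rewrite lee_fin mass_ge0.
- by move=> x; rewrite -EFinD lee_fin addr_ge0// mass_ge0.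
- exact: measurable_mass.
- by apply: emeasurable_funD; exact: measurable_mass.
- by apply: filterS (massD (xcoef s) (xcoef t) r) => x; rewrite -EFinD lee_fin.
Qed.

Lemma nrm_sum (I : Type) (q : seq I) (F : I -> CP) :
  (nrm (\sum_(i <- q) F i) <= \sum_(i <- q) nrm (F i))%E.
Proof.
elim: q => [|i q IH]; first by rewrite !big_nil nrm0.
by rewrite !big_cons (le_trans (nrmD _ _))// leeD2l.
Qed.

(** The row of the product at x is the sum over h of the row of u at h^-1 x, weighted by the
    coefficient of s at h and reindexed by left translation. Translating q keeps it free of
    duplicates, so the bound k applies to each of these rows. *)
Lemma mass_scale s u k (r q : seq G) : rbound u k -> uniq r ->
  (forall h, xcoef s h != 0 -> h \in r) -> uniq q ->
  \forall x \ae mu, mass (xscale s u) q x <= k * mass (xcoef s) r x.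
Proof.
move=> [k0 uk] ur ru uq.
have h1 : \forall x \ae mu, forall h : G,
    mass u [seq (h^-1 * g)%g | g <- q] (alpha h^-1%g x) <= k.
  apply: (ae_forall c_inj) => h.
  have uh : uniq [seq (h^-1 * g)%g | g <- q] by rewrite map_inj_uniq//; exact: mulgI.
  exact: (sact_ae alpha h^-1%g (uk _ uh)).
have h2 : \forall x \ae mu, forall g, linf_repr (xscale s u g) x =
    \sum_(h <- r) linf_repr (xcoef s h) x * linf_repr (u (h^-1 * g)%g) (alpha h^-1%g x).
  by apply: (ae_forall c_inj) => g; exact: (xscale_repr c_inj u g ur ru).
apply: filterS2 h1 h2 => x h1 h2; rewrite /mass.
apply: (@le_trans _ _ (\sum_(g <- q) \sum_(h <- r) coef_norm R (linf_repr (xcoef s h) x) *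
   coef_norm R (linf_repr (u (h^-1 * g)%g) (alpha h^-1%g x)))).
  apply: ler_sum => g _; rewrite h2 (le_trans (coef_norm_sum _ _))//.
  by apply: ler_sum => h _; rewrite coef_normM.
rewrite exchange_big mulr_sumr; apply: ler_sum => h _.
rewrite -mulr_sumr mulrC ler_wpM2r ?coef_norm_ge0//.
by have := h1 h; rewrite /mass big_map.
Qed.

Lemma nrmM s t k : rbound (xcoef t) k -> (nrm (s * t) <= k%:E * nrm s)%E.
Proof.
move=> kt; have [r ur ru] := xring_supp s; have [q uq qu] := xring_supp (s * t).
rewrite (nrmE ur ru) (nrmE uq qu) -ge0_integralZl//; last 3 first.
- exact: measurable_mass.
- by move=> x _; rewrite lee_fin mass_ge0.
- by rewrite lee_fin; case: kt.
apply: ae_ge0_le_integral.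
- by move=> x; rewrite lee_fin mass_ge0.
- by move=> x; rewrite -EFinM lee_fin mulr_ge0// ?mass_ge0//; case: kt.
- exact: measurable_mass.
- by apply: emeasurable_funM; [exact: measurable_cst|exact: measurable_mass].
- rewrite -(xscale_xcoef s t).
  by apply: filterS (mass_scale kt ur ru uq) => x; rewrite -EFinM lee_fin.
Qed.

Lemma rbound_le u v k :
  (forall g, \forall x \ae mu,
    coef_norm R (linf_repr (u g) x) <= coef_norm R (linf_repr (v g) x)) ->
  rbound v k -> rbound u k.
Proof.
move=> uv [k0 vk]; split=> // r ur; apply: filterS2 (vk r ur) (ae_forall c_inj uv).
by move=> x vx uvx; apply: le_trans vx; apply: ler_sum => g _; exact: uvx.
Qed.

Lemma rbound0 : rbound 0 0.
Proof.
split=> // r _; apply: filterS (linf_repr0 mu Z) => x x0.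
by rewrite /mass big1// => g _; rewrite [(0 : G -> _) g]/(0 : Linf mu Z) x0 coef_norm0.
Qed.

Lemma rboundD u v k l : rbound u k -> rbound v l -> rbound (u + v) (k + l).
Proof.
move=> [k0 uk] [l0 vl]; split; first exact: addr_ge0.
move=> r ur; apply: filterS3 (massD u v r) (uk r ur) (vl r ur) => x h h1 h2.
exact: le_trans h (lerD h1 h2).
Qed.

Lemma rboundM s u k l : rbound (xcoef s) l -> rbound u k -> rbound (xscale s u) (k * l).
Proof.
move=> [l0 sl] uk; have k0 : 0 <= k by case: uk.
split=> [|q uq]; first exact: mulr_ge0.
have [r ur ru] := xring_supp s.
apply: filterS2 (mass_scale uk ur ru uq) (sl r ur) => x h1 h2.
by apply: le_trans h1 _; rewrite ler_wpM2l.
Qed.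

Lemma coef_norm1_le (b : bool) : coef_norm R (b%:R : Z) <= 1.
Proof.
case: b; last by rewrite coef_norm0.
by case: Z => [|F] /=; rewrite ?normr1// oner_neq0.
Qed.

Lemma rbound_indicM (Y : set X) u k : measurable Y -> rbound u k ->
  rbound (fun g => linf_indic mu Z Y * u g) k.
Proof.
move=> mY; apply: rbound_le => g.
apply: filterS2 (linf_indicE mu Z mY) (linf_reprM (linf_indic mu Z Y) (u g)) => x e ->.
by rewrite e coef_normM ler_piMl ?coef_norm_ge0// coef_norm1_le.
Qed.

(** The constant is a bound for the entries times a bound for the number of nonzero entries in a
    row; the absolute value makes it nonnegative. *)
Lemma rbound_zr (t : ZR Z E) : exists k, rbound (zcoef alpha t) k.
Proof.
have [N tN] := zr_rows c_inj hE t; have [_ _ [k bt] _ _] := zr_reprP t.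
exists (`|k| * N%:R); split; first by rewrite mulr_ge0// ler0n.
move=> r ur; apply: filterS3 tN bt (ae_forall c_inj (zcoefE hE t)) => x tN bt tx.
rewrite /mass (bigID (fun g => linf_repr (zcoef alpha t g) x != 0)) /=.
rewrite [X in _ + X]big1 ?addr0; last first.
  by move=> g /negPn/eqP ->; rewrite coef_norm0.
rewrite -big_filter; set q := [seq g <- r | _].
have qN : (size q <= N)%N.
  by apply: tN; [exact: filter_uniq|move=> g; rewrite mem_filter => /andP[]].
apply: (@le_trans _ _ (\sum_(g <- q) `|k|)).
  apply: ler_sum => g _; rewrite tx; apply: le_trans (ler_norm k); apply: bt.
  by rewrite hE; exact: orbit_sact.
by rewrite big_const_seq count_predT iter_addr_0 -[leLHS]mulr_natr ler_wpM2l// ler_nat.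
Qed.

Lemma rbound_xring s : exists k, rbound (xcoef s) k.
Proof. by rewrite -(zcoef_incl c_inj diagX hE s); exact: rbound_zr. Qed.

Lemma rbound_indic (Y : set X) : measurable Y ->
  rbound (xcoef (cp_indic alpha Z Y)) 1.
Proof.
move=> mY; split=> // r ur.
apply: filterS2 (linf_indicE mu Z mY) (linf_repr0 mu Z) => x e e0.
have nE g : coef_norm R (linf_repr (xcoef (cp_indic alpha Z Y) g) x) <= (g == 1%g)%:R.
  by rewrite xcoef_elt; case: eqP => _; rewrite ?e ?coef_norm1_le// e0 coef_norm0.
apply: (@le_trans _ _ (\sum_(g <- r) (g == 1%g)%:R)); first by apply: ler_sum => g _.
have [r1|r1] := boolP (1%g \in r).
  by rewrite (bigD1_seq 1%g)//= eqxx big1 ?addr0// => g /negbTE ->.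
rewrite big1_seq// => g /andP[_ gr]; case: eqP => // g1; by rewrite -g1 gr in r1.
Qed.

End Norms.

(** * Indicator functions and restrictions *)

Section IndicatorAlgebra.
Context d (X : measurableType d) (R : realType) (mu : probability X R).
Variables (Z : coefficient) (G : groupType) (alpha : standard_action mu G).
Local Notation CP := (crossed_product alpha Z).
Local Notation chi := (cp_indic alpha Z).
Implicit Types (s t : CP) (A B : set X).

Lemma linf_indicI A B : measurable A -> measurable B ->
  linf_indic mu Z (A `&` B) = linf_indic mu Z A * linf_indic mu Z B.
Proof.
move=> mA mB; apply/linf_eqP.
apply: filterS2 (filterI (linf_indicE mu Z mA) (linf_indicE mu Z mB))
  (filterI (linf_indicE mu Z (measurableI _ _ mA mB))
    (linf_reprM (linf_indic mu Z A) (linf_indic mu Z B))).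
move=> x [eA eB] [-> ->]; rewrite eA eB in_setI.
by case: (x \in A); rewrite ?mul1r ?mul0r.
Qed.

Lemma linf_indicT : linf_indic mu Z setT = 1.
Proof.
apply/linf_eqP; apply: filterS2 (linf_indicE mu Z measurableT) (linf_repr1 mu Z).
by move=> x -> ->; rewrite in_setT.
Qed.

Lemma linf_indic0 : linf_indic mu Z set0 = 0.
Proof.
apply/linf_eqP; apply: filterS2 (linf_indicE mu Z measurable0) (linf_repr0 mu Z).
by move=> x -> ->; rewrite in_set0.
Qed.

Lemma linf_indicC A : measurable A ->
  linf_indic mu Z A + linf_indic mu Z (~` A) = 1.
Proof.
move=> mA; apply/linf_eqP.
apply: filterS2 (filterI (linf_indicE mu Z mA) (linf_indicE mu Z (measurableC mA)))
  (filterI (linf_repr1 mu Z) (linf_reprD (linf_indic mu Z A) (linf_indic mu Z (~` A)))).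
move=> x [eA eB] [-> ->]; rewrite eA eB in_setC.
by case: (x \in A); rewrite ?addr0 ?add0r.
Qed.

Lemma cp_indicI A B : measurable A -> measurable B -> chi (A `&` B) = chi A * chi B.
Proof.
by move=> mA mB; rewrite /cp_indic xeltM linf_indicI// mulg1 ract1.
Qed.

Lemma cp_indicT : chi setT = 1.
Proof. by apply: xringP => g; rewrite xcoef_elt xcoef1 linf_indicT; case: eqP. Qed.

Lemma cp_indic0 : chi set0 = 0.
Proof. by apply: xringP => g; rewrite xcoef_elt linf_indic0 if_same. Qed.

Lemma cp_indicC A : measurable A -> chi A + chi (~` A) = 1.
Proof.
move=> mA; rewrite -cp_indicT; apply: xringP => g.
rewrite xcoefD !xcoef_elt; case: eqP => _; last by rewrite addr0.
by rewrite linf_indicC// linf_indicT.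
Qed.

Lemma cp_indicM A : measurable A -> chi A * chi A = chi A.
Proof. by move=> mA; rewrite -cp_indicI// setIid. Qed.

Lemma xcoef_indicM A s g : xcoef (chi A * s) g = linf_indic mu Z A * xcoef s g.
Proof. by rewrite xcoef_eltM ract1 invg1 mul1g. Qed.

Lemma xcoef_Mindic A s g :
  xcoef (s * chi A) g = xcoef s g * linf_trans alpha g (linf_indic mu Z A).
Proof. by rewrite xcoef_Melt1. Qed.

Lemma cp_mem_indic A s : measurable A ->
  (exists t, s = t * chi A) <-> s * chi A = s.
Proof.
move=> mA; split=> [[t ->]|e]; last by exists s.
by rewrite -mulrA cp_indicM.
Qed.

Lemma cp_indic_sub A B s : measurable A -> measurable B -> A `<=` B ->
  s * chi A = s -> s * chi B = s.
Proof.
move=> mA mB AB e; rewrite -{1}e -mulrA -cp_indicI//.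
by rewrite (_ : A `&` B = A)//; exact: setIidl.
Qed.

Lemma cp_indic_setD A B s : measurable A -> measurable B ->
  s * chi A = s -> s * chi (~` B) = s -> s * chi (A `\` B) = s.
Proof.
by move=> mA mB eA eB; rewrite setDE cp_indicI//; [rewrite mulrA eA|exact: measurableC].
Qed.

Let rho (a : Linf mu Z) (g : G) (f : Linf mu Z) : Linf mu Z := a * linf_trans alpha g f.

Let rhoDl a b g f : rho (a + b) g f = rho a g f + rho b g f.
Proof. exact: mulrDl. Qed.
Let rhoDr a g f f' : rho a g (f + f') = rho a g f + rho a g f'.
Proof. by rewrite /rho linf_transD mulrDr. Qed.
Let rhoA a b g h f :
  rho a g (rho b h f) = rho (a * linf_action alpha Z g b) (g * h)%g f.
Proof. by rewrite /rho linf_transM mulrA linf_trans_comp. Qed.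
Let rho1 f : rho 1 1%g f = f.
Proof. by rewrite /rho mul1r linf_trans_id. Qed.

Lemma cp_actDr s : {morph cp_act s : f f' / f + f'}.
Proof. exact: (xactDr (act := linf_action alpha Z) rhoDl rhoDr). Qed.
Lemma cp_actDl f : {morph (fun s => cp_act s f) : s t / s + t}.
Proof. exact: (xactDl (act := linf_action alpha Z) rhoDl). Qed.
Lemma cp_actA s t f : cp_act (s * t) f = cp_act s (cp_act t f).
Proof. exact: (xactA rhoDl rhoDr rhoA). Qed.
Lemma cp_act1 f : cp_act (1 : CP) f = f.
Proof. exact: (xact1 (linf_action alpha Z) rhoDl rho1). Qed.
Lemma cp_act_elt a g f : cp_act (xelt (linf_action alpha Z) a g) f = a * linf_trans alpha g f.
Proof. exact: (xact_elt (linf_action alpha Z) rhoDl). Qed.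
Lemma cp_act0r s : cp_act s 0 = 0.
Proof. by apply: (@addrI _ (cp_act s 0)); rewrite -cp_actDr !addr0. Qed.
Lemma cp_act0l f : cp_act (0 : CP) f = 0.
Proof. by apply: (@addrI _ (cp_act (0 : CP) f)); rewrite -cp_actDl !addr0. Qed.

Lemma cp_act_suml (I : Type) (r : seq I) (F : I -> CP) f :
  cp_act (\sum_(i <- r) F i) f = \sum_(i <- r) cp_act (F i) f.
Proof. exact: (big_morph _ (cp_actDl f) (cp_act0l f)). Qed.
Lemma cp_act_sumr (I : Type) (r : seq I) s (F : I -> Linf mu Z) :
  cp_act s (\sum_(i <- r) F i) = \sum_(i <- r) cp_act s (F i).
Proof. exact: (big_morph _ (cp_actDr s) (cp_act0r s)). Qed.

End IndicatorAlgebra.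

(* What the argument uses of the equivalence relation ring: it is a left module
   over the crossed product which embeds into the formal sums. *)
Record crossed_extension d (X : measurableType d) (R : realType) (mu : probability X R)
    (Z : coefficient) (S : scalars mu Z) (G : groupType) (alpha : standard_action mu G)
    (c : G -> nat) := CrossedExtension {
  ce_incl : crossed_product alpha Z -> S;
  ce_coef : S -> G -> Linf mu Z;
  ce_coef_inj : forall t t', ce_coef t = ce_coef t' -> t = t';
  ce_coefD : forall t t', ce_coef (t + t') = ce_coef t + ce_coef t';
  ce_coef_incl : forall s, ce_coef (ce_incl s) = xcoef s;
  ce_coefM : forall s t, ce_coef (sc_mul (ce_incl s) t) = xscale s (ce_coef t);
  ce_coef_indic : forall t A g, measurable A ->
    ce_coef (sc_mul t (sc_indic S A)) g =
    ce_coef t g * linf_trans alpha g (linf_indic mu Z A);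
  ce_act : forall s f, sc_act (ce_incl s) f = cp_act s f;
  ce_norm : forall s, sc_norm (ce_incl s) = @sc_norm _ _ _ mu Z (cp_scalars Z alpha) s;
  ce_row_finite : forall t, row_finite c (ce_coef t);
  ce_rbound : forall t, exists k, rbound (ce_coef t) k }.

Arguments ce_coef_inj {d X R mu Z S G alpha c} _ _ _ _.
Arguments ce_coef_incl {d X R mu Z S G alpha c} _ _.

Definition zr_extension d (X : measurableType d) (R : realType) (mu : probability X R)
    (Z : coefficient) (E : measured_equivalence mu) (G : groupType)
    (alpha : standard_action mu G) (c : G -> nat) (c_inj : injective c)
    (diagX : measurable [set p : X * X | p.1 = p.2])
    (hE : meq_rel E = orbit_rel alpha) :
  crossed_extension (ZR_scalars Z E) alpha c.
Proof.
apply: (@CrossedExtension _ _ _ _ _ (ZR_scalars Z E) _ alpha c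
  (@zr_incl _ _ _ _ Z E _ alpha) (@zcoef _ _ _ _ Z E _ alpha)).
- by move=> t t' e; apply: (zcoef_inj c_inj hE) => g; rewrite e.
- by move=> t t'; apply: funext => g; exact: (zcoefD hE t t' g).
- exact: (zcoef_incl c_inj diagX hE).
- exact: (zr_mul_incl c_inj diagX hE).
- by move=> t A g mA; exact: (zr_mul_indic c_inj diagX hE).
- exact: (zr_act_incl c_inj diagX hE).
- exact: (nrm_incl c_inj diagX hE).
- exact: (row_finite_zr c_inj hE).
- exact: (rbound_zr c_inj hE).
Qed.

(** * The larger ring as a module over the crossed product, and its elements cut to a set *)

Section CrossedModule.
Context d (X : measurableType d) (R : realType) (mu : probability X R).
Variables (Z : coefficient) (S : scalars mu Z).
Variables (G : groupType) (alpha : standard_action mu G).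
Variables (c : G -> nat) (c_inj : injective c).
Variable ext : crossed_extension S alpha c.
Local Notation CP := (crossed_product alpha Z).
Local Notation chi := (cp_indic alpha Z).
Local Notation incl := (ce_incl ext).
Local Notation coef := (ce_coef ext).
Local Notation "s *! t" := (sc_mul (incl s) t) (at level 40).
Implicit Types (s : CP) (t : S) (A B Y V : set X).

Lemma zmulDr s t t' : s *! (t + t') = s *! t + s *! t'.
Proof. by apply: (ce_coef_inj ext); rewrite ce_coefD !ce_coefM ce_coefD xscaleDr. Qed.
Lemma zmulDl t s s' : (s + s') *! t = s *! t + s' *! t.
Proof. by apply: (ce_coef_inj ext); rewrite ce_coefD !ce_coefM xscaleDl. Qed.
Lemma zmulA s s' t : (s * s') *! t = s *! (s' *! t).
Proof. by apply: (ce_coef_inj ext); rewrite !ce_coefM xscaleA. Qed.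
Lemma zmul0r s : s *! 0 = 0.
Proof. by apply: (@addrI _ (s *! 0)); rewrite -zmulDr !addr0. Qed.
Lemma zmul0l t : 0 *! t = 0.
Proof. by apply: (@addrI _ (0 *! t)); rewrite -zmulDl !addr0. Qed.

Lemma zinclM s s' : incl (s * s') = s *! incl s'.
Proof. by apply: (ce_coef_inj ext); rewrite ce_coefM !ce_coef_incl xscale_xcoef. Qed.
Lemma zinclD s s' : incl (s + s') = incl s + incl s'.
Proof. by apply: (ce_coef_inj ext); rewrite ce_coefD !ce_coef_incl. Qed.
Lemma zincl0 : incl 0 = 0.
Proof. by apply: (@addrI _ (incl 0)); rewrite -zinclD !addr0. Qed.
Lemma zincl_sum (I : Type) (r : seq I) (F : I -> CP) :
  incl (\sum_(i <- r) F i) = \sum_(i <- r) incl (F i).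
Proof. exact: (big_morph incl zinclD zincl0). Qed.
Lemma zincl_inj : injective incl.
Proof. by move=> s s' e; apply: xringP => g; rewrite -!(ce_coef_incl ext) e. Qed.

Lemma zmul_indicM s t A : measurable A ->
  sc_mul (s *! t) (sc_indic S A) = s *! sc_mul t (sc_indic S A).
Proof.
move=> mA; apply: (ce_coef_inj ext); apply: funext => g.
have [r ur ru] := xring_supp s.
rewrite ce_coef_indic// !ce_coefM !(xscaleE _ _ ur ru) mulr_suml.
apply: eq_bigr => h _; rewrite ce_coef_indic// rmorphM/= mulrA.
by rewrite -linf_trans_comp mulVKg.
Qed.

Lemma zmul_indicK t A : measurable A ->
  sc_mul (sc_mul t (sc_indic S A)) (sc_indic S A) = sc_mul t (sc_indic S A).
Proof.
move=> mA; apply: (ce_coef_inj ext); apply: funext => g.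
by rewrite !ce_coef_indic// -mulrA -linf_transM -linf_indicI// setIid.
Qed.

Lemma zmem_indic t A : measurable A ->
  (exists t', t = sc_mul t' (sc_indic S A)) <-> sc_mul t (sc_indic S A) = t.
Proof. by move=> mA; split=> [[t' ->]|e]; [rewrite zmul_indicK|exists t]. Qed.

Lemma zincl_Mindic s A : measurable A ->
  sc_mul (incl s) (sc_indic S A) = incl (s * chi A).
Proof.
move=> mA; apply: (ce_coef_inj ext); apply: funext => g.
by rewrite ce_coef_indic// !ce_coef_incl xcoef_Mindic.
Qed.

Lemma coef_indicM t A g : coef (chi A *! t) g = linf_indic mu Z A * coef t g.
Proof. by rewrite ce_coefM xscale_elt ract1 invg1 mul1g. Qed.

(* The part of t over Y, as an element of the crossed product; it is 0 by default
   if that part has infinitely many coefficients. *)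
Definition zcut (Y : set X) t : CP :=
  insubd (0 : CP) (fun g => linf_indic mu Z Y * coef t g).

Section Cut.
Variables (Y V : set X) (t : S) (p : nat).
Hypotheses (mY : measurable Y) (mV : measurable V).
Hypothesis Yt : Y `&` bad alpha c (coef t) p V = set0.

Lemma xcoef_zcut g : xcoef (zcut Y t) g = linf_indic mu Z Y * coef t g.
Proof.
suff fs : (fun g => linf_indic mu Z Y * coef t g) \in @fin_supp G (Linf mu Z).
  exact: (congr1 (fun u => u g) (insubdK (0 : CP) fs)).
apply/asboolP.
pose r := pmap (uncode c) (iota 0 p).
apply: (@sub_finite_set _ _ [set` r]); last exact: finite_seq.
move=> h /= hn; rewrite mem_pmap; apply/mapP; exists (c h); last first.
  by rewrite uncode_pcancel.
rewrite mem_iota /= ltnNge; apply: contraNN hn => ph.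
by rewrite (bad_finite mY Yt ph).
Qed.

Lemma zincl_zcut : incl (zcut Y t) = chi Y *! t.
Proof.
apply: (ce_coef_inj ext); rewrite ce_coef_incl; apply: funext => g.
by rewrite xcoef_zcut coef_indicM.
Qed.

Lemma zcut_avoid : zcut Y t * chi (~` V) = zcut Y t.
Proof.
apply: xringP => g; rewrite xcoef_Mindic xcoef_zcut.
by rewrite -(bad_avoid g mV mY Yt).
Qed.

Lemma zcut_mem A : measurable A -> sc_mul t (sc_indic S A) = t ->
  zcut Y t * chi A = zcut Y t.
Proof.
move=> mA e; apply: xringP => g; rewrite xcoef_Mindic xcoef_zcut -mulrA.
by rewrite -ce_coef_indic// e.
Qed.

End Cut.

(** The bound of t serves for every Y, also when the cut takes its default value 0; this makes the
    later constants independent of p. *)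
Lemma rbound_zcut Y t k : measurable Y -> rbound (coef t) k ->
  rbound (xcoef (zcut Y t)) k.
Proof.
move=> mY bt; rewrite /zcut /insubd; case: insubP => [u _ ue|_].
  by move: ue => /= ->; exact: (rbound_indicM c_inj).
apply: (rbound_le c_inj) bt => // g; apply: filterS (linf_repr0 mu Z) => x x0.
by rewrite -[xcoef (odflt _ _) _]/(0 : Linf mu Z) x0 coef_norm0 coef_norm_ge0.
Qed.

End CrossedModule.

(** * A finite free model of the resolution of G *)

(* Z is free over int / p, with p = 0 for Z = int. *)
Definition int_basis (Z : nzRingType) (p q : nat) (b : 'I_q -> Z) :=
  [/\ p%:R = 0 :> Z, forall z, exists l : 'I_q -> int, z = \sum_i (l i)%:~R * b i &
      forall l : 'I_q -> int, \sum_i (l i)%:~R * b i = 0 -> forall i, (p %| l i)%Z].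

(** A finite field is a vector space over its prime field. Coordinates read as natural numbers give
    the integers l, and linear independence becomes divisibility by the characteristic. *)
Lemma coefficient_int_basis (Z : coefficient) :
  exists p q (b : 'I_q -> Z), int_basis p b.
Proof.
case: Z => [|F].
  exists 0%N, 1%N, (fun=> 1); split => //= [z|l].
    by exists (fun=> z); rewrite big_ord1 mulr1 intz.
  by rewrite big_ord1 mulr1 intz => l0 i; rewrite ord1 l0.
have [p pr_p pF] := finPcharP F.
pose L := pPrimeCharType pF; pose e : seq L := vbasis (fullv : {vspace L}).
exists p, (\dim (fullv : {vspace L})), (fun i => e`_i); split => /=.
- exact: pcharf0 pF.
- move=> z; exists (fun i => (coord (vbasis fullv) i (z : L) : nat)%:Z).
  by rewrite {1}(coord_vbasis (memvf (z : L))); apply: eq_bigr.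
- move=> l l0 i.
  have lE k : (l k)%:~R * e`_k = ((l k)%:~R : 'F_p) *: e`_k.
    by rewrite scaler_int; exact: (@mulrzl F).
  have : \sum_k ((l k)%:~R : 'F_p) *: e`_k = 0.
    by rewrite -[RHS]l0; apply: eq_bigr => k _; rewrite lE.
  have /freeP fe := basis_free (vbasisP (fullv : {vspace L})).
  by move=> /fe /(_ i) /eqP; rewrite -(dvdz_pcharf (pchar_Fp pr_p)).
Qed.

Section Augmentation.
Variables (A : nzRingType) (G : groupType).
Implicit Types s t : grpring A G.

Let rho (a : A) (g : G) (v : A) : A := a * v.
Let rhoDl a b g v : rho (a + b) g v = rho a g v + rho b g v.
Proof. exact: mulrDl. Qed.
Let rhoDr a g v w : rho a g (v + w) = rho a g v + rho a g w.
Proof. exact: mulrDr. Qed.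
Let rhoA a b g h v :
  rho a g (rho b h v) = rho (a * trivial_action A G g b) (g * h)%g v.
Proof. exact: mulrA. Qed.

Let augE s v : xact rho s v = grpring_aug s * v.
Proof.
have [r ur ru] := xring_supp s.
rewrite (xactE rhoDl v ur ru) /grpring_aug (fsum_seqE ur) ?mulr_suml//.
Qed.

Lemma grpring_augD s t : grpring_aug (s + t) = grpring_aug s + grpring_aug t.
Proof. by have := xactDl rhoDl 1 s t; rewrite !augE !mulr1. Qed.

Lemma grpring_augM s t : grpring_aug (s * t) = grpring_aug s * grpring_aug t.
Proof. by have := xactA rhoDl rhoDr rhoA s t 1; rewrite !augE !mulr1. Qed.

Lemma grpring_aug0 : grpring_aug (0 : grpring A G) = 0.
Proof. by apply: (@addrI _ (grpring_aug (0 : grpring A G))); rewrite -grpring_augD !addr0. Qed.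

Lemma grpring_aug_elt a g : grpring_aug (xelt (trivial_action A G) a g) = a.
Proof.
by have := xact_elt (trivial_action A G) rhoDl a g 1; rewrite augE /rho !mulr1.
Qed.

Lemma grpring_aug1 : grpring_aug (1 : grpring A G) = 1.
Proof.
rewrite -[RHS](grpring_aug_elt 1 1%g); congr grpring_aug.
by apply: xringP => g; rewrite xcoef_elt xcoef1; case: eqP.
Qed.

Definition row_aug r (eps : 'I_r -> A) (u : 'rV[grpring A G]_r) : A :=
  \sum_j grpring_aug (u 0 j) * eps j.

Lemma row_augP r (eps : 'I_r -> A) s (u v : 'rV[grpring A G]_r) :
  row_aug eps (s *: u + v) = grpring_aug s * row_aug eps u + row_aug eps v.
Proof.
rewrite mulr_sumr -big_split; apply: eq_bigr => j _ /=.
by rewrite !mxE grpring_augD grpring_augM mulrDl mulrA.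
Qed.

Lemma row_aug0 r (eps : 'I_r -> A) : row_aug eps 0 = 0.
Proof. by rewrite /row_aug big1// => j _; rewrite mxE grpring_aug0 mul0r. Qed.

Lemma row_augZ r (eps : 'I_r -> A) s u :
  row_aug eps (s *: u) = grpring_aug s * row_aug eps u.
Proof. by rewrite -[s *: u]addr0 row_augP row_aug0 addr0. Qed.

Lemma row_augD r (eps : 'I_r -> A) u v :
  row_aug eps (u + v) = row_aug eps u + row_aug eps v.
Proof. by rewrite -[u in LHS]scale1r row_augP grpring_aug1 mul1r. Qed.

Lemma row_augMn r (eps : 'I_r -> A) u n : row_aug eps (u *+ n) = row_aug eps u *+ n.
Proof. by elim: n => [|n IH]; rewrite ?mulr0n ?row_aug0// !mulrS row_augD IH. Qed.

Lemma row_augN r (eps : 'I_r -> A) u : row_aug eps (- u) = - row_aug eps u.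
Proof. by apply/eqP; rewrite -addr_eq0 -row_augD addNr row_aug0. Qed.

Lemma row_aug_sum r (eps : 'I_r -> A) (I : Type) (q : seq I) (F : I -> 'rV_r) :
  row_aug eps (\sum_(i <- q) F i) = \sum_(i <- q) row_aug eps (F i).
Proof. exact: (big_morph _ (row_augD eps) (row_aug0 eps)). Qed.

End Augmentation.

Section GroupRingMap.
Variables (A B : nzRingType) (G : groupType) (phi : {rmorphism A -> B}).

Definition gmap : grpring A G -> grpring B G :=
  @xmap G A B (trivial_action A G) (trivial_action B G) phi.

HB.instance Definition _ := GRing.isZmodMorphism.Build (grpring A G) (grpring B G)
  gmap (xmap_is_zmod (actA := trivial_action A G) (trivial_action B G) phi).
HB.instance Definition _ := GRing.isMonoidMorphism.Build (grpring A G) (grpring B G)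
  gmap (@xmap_is_monoid G A B (trivial_action A G) (trivial_action B G) phi
    (fun _ _ => erefl)).

Lemma grpring_aug_map s : grpring_aug (gmap s) = phi (grpring_aug s).
Proof.
have [r ur ru] := xring_supp s.
rewrite /grpring_aug (fsum_seqE ur)// => [|h]; first by rewrite (fsum_seqE ur)// rmorph_sum.
by rewrite xcoef_map => sh; apply: ru; apply: contraNN sh => /eqP ->; rewrite rmorph0.
Qed.

Lemma row_aug_map r (eps : 'I_r -> A) u :
  row_aug (fun j => phi (eps j)) (map_mx gmap u) = phi (row_aug eps u).
Proof.
by rewrite rmorph_sum; apply: eq_bigr => j _; rewrite mxE grpring_aug_map rmorphM.
Qed.

End GroupRingMap.

Section IntegralLift.
Variables (Z : nzRingType) (G : groupType) (p q : nat) (b : 'I_q -> Z).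
Hypothesis bZ : int_basis p b.
Hypothesis Zcomm : forall x y : Z, x * y = y * x.
Local Notation ZG := (grpring Z G).
Local Notation IG := (grpring int G).
Local Notation red := (@gmap int Z G (intmul 1)).

Local Notation be i := (xelt (trivial_action Z G) (b i) 1%g).

Let be_coef i (s : ZG) g : (be i * s) g = b i * s g.
Proof. by rewrite xcoef_eltM invg1 mul1g. Qed.

(** The second clause forces 0 to be lifted to 0, so that lifting coefficient by coefficient keeps
    supports finite. *)
Let lift_ex (z : Z) : exists l : 'I_q -> int,
  z = \sum_i b i * (l i)%:~R /\ (z = 0 -> forall i, l i = 0).
Proof.
have [->|z0] := pselect (z = 0).
  by exists (fun=> 0); split => //; rewrite big1// => i _; rewrite mulr0.
case: bZ => _ /(_ z)[l zl] _; exists l; split => //.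
by rewrite {1}zl; apply: eq_bigr => i _; exact: Zcomm.
Qed.

Let lift_coef z := projT1 (cid (lift_ex z)).

Let lift_coefE z : z = \sum_i b i * (lift_coef z i)%:~R.
Proof. by rewrite /lift_coef; case: cid => l []. Qed.

Let lift_coef0 i : lift_coef 0 i = 0.
Proof. by rewrite /lift_coef; case: cid => l [_ /= ->]. Qed.

Let lift_supp i (s : ZG) : fin_supp (fun g => lift_coef (s g) i).
Proof.
apply/asboolP; have /asboolP := valP s; apply: sub_finite_set => g /=.
by apply: contraNN => /eqP ->; rewrite lift_coef0.
Qed.

Let lift i (s : ZG) : IG := XRing (trivial_action int G) (lift_supp i s).

Lemma row_lift r (u : 'rV[ZG]_r) :
  exists w : 'I_q -> 'rV[IG]_r, u = \sum_i be i *: map_mx red (w i).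
Proof.
exists (fun i => map_mx (lift i) u); apply/rowP => j; rewrite summxE.
apply: xringP => g; rewrite xcoef_sum {1}[u 0 j g]lift_coefE.
by apply: eq_bigr => i _; rewrite !mxE be_coef.
Qed.

Lemma row_lift_eq0 r (w : 'I_q -> 'rV[IG]_r) :
  \sum_i be i *: map_mx red (w i) = 0 -> forall i, exists v, w i = v *+ p.
Proof.
move=> w0 i; case: bZ => _ _ indep.
have pw (j : 'I_r) (g : G) : (p %| (w i ord0 j : IG) g)%Z.
  apply: (indep (fun i => (w i 0 j : IG) g)).
  have := congr1 (fun u : 'rV_r => (u 0 j : ZG) g) w0; rewrite mxE => e.
  rewrite -[RHS]e summxE xcoef_sum; apply: eq_bigr => k _.
  by rewrite !mxE be_coef Zcomm.
have fs (j : 'I_r) : fin_supp (fun g : G => ((w i ord0 j : IG) g %/ p)%Z).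
  apply/asboolP; have /asboolP := valP (w i 0 j : IG); apply: sub_finite_set => g /=.
  by apply: contraNN => /eqP ->; rewrite div0z.
exists (\row_j XRing (trivial_action int G) (fs j)); apply/rowP => j.
apply: xringP => g; rewrite mulmxnE mxE.
by rewrite xcoefMn -mulr_natr natz /= divzK.
Qed.

Lemma row_red_pmul r (w : 'rV[IG]_r) : map_mx red (w *+ p) = 0.
Proof.
case: bZ => p0 _ _; apply/rowP => j; rewrite mxE mulmxnE rmorphMn mxE.
by apply: xringP => g; rewrite xcoefMn -mulr_natr p0 mulr0.
Qed.

Lemma aug_lift_eq0 (l : 'I_q -> int) :
  \sum_i b i * (l i)%:~R = 0 -> forall i, exists k, l i = k *+ p.
Proof.
case: bZ => _ _ indep l0 i; have /dvdzP[k ->] : (p %| l i)%Z.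
  by apply: indep; rewrite -[RHS]l0; apply: eq_bigr => k _; exact: Zcomm.
by exists k; rewrite -mulr_natr natz.
Qed.

End IntegralLift.

(** Dependent choice with a type that varies with the degree, used to construct chain maps one
    degree at a time. *)
Lemma dependent_family (T : nat -> Type) (P : forall k, T k -> Prop)
    (Q : forall k, T k -> T k.+1 -> Prop) :
  (exists x, P 0%N x) ->
  (forall k x, P k x -> exists2 y, P k.+1 y & Q k x y) ->
  exists s : forall k, T k, (forall k, P k (s k)) /\ forall k, Q k (s k) (s k.+1).
Proof.
move=> ex0 step.
pose T' k := {x : T k | P k x}.
pose s0 : T' 0%N := exist _ _ (projT2 (cid ex0)).
pose next k (x : T' k) : T' k.+1 :=
  let y := cid2 (step k _ (proj2_sig x)) in exist _ (s2val y) (s2valP y).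
pose s := nat_rect T' s0 next.
exists (fun k => sval (s k)); split=> k; first exact: proj2_sig.
exact: (s2valP' (cid2 (step k _ (proj2_sig (s k))))).
Qed.

(* Maps of free modules are lifted along p by choosing the values on a basis;
   op is the action of the ring on N. *)
Lemma free_lifting (A : nzRingType) (M N' : lmodType A) (N : zmodType)
    (op : A -> N -> N) (p : N' -> N) (f : M -> N) (Q : N' -> Prop) :
  free_module M ->
  (forall a x y, p (a *: x + y) = op a (p x) + p y) -> p 0 = 0 ->
  (forall a x y, f (a *: x + y) = op a (f x) + f y) -> f 0 = 0 ->
  Q 0 -> (forall a x y, Q x -> Q y -> Q (a *: x + y)) ->
  (forall x, exists2 y, Q y & p y = f x) ->
  exists g : M -> N', [/\ forall a x y, g (a *: x + y) = a *: g x + g y,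
    forall x, Q (g x) & forall x, p (g x) = f x].
Proof.
move=> [I [b bP]] pL p0 fL f0 Q0 QL ex.
pose c x := projT1 (cid (bP x)).
have cP x : finite_set [set i | c x i != 0] /\ x = \sum_(i \in [set: I]) c x i *: b i.
  by rewrite /c; case: cid => l /= [].
have cU x l : finite_set [set i | l i != 0] ->
    x = \sum_(i \in [set: I]) l i *: b i -> c x = l.
  by rewrite /c; case: cid => l' /= [_ u] fl xl; apply: u.
pose v i := s2val (cid2 (ex (b i))).
have Qv i : Q (v i) by rewrite /v; case: cid2.
have pv i : p (v i) = f (b i) by rewrite /v; case: cid2.
have sumE (V : lmodType A) (l : I -> A) (w : I -> V) (r : seq I) : uniq r ->
    (forall i, l i != 0 -> i \in r) ->
    \sum_(i \in [set: I]) l i *: w i = \sum_(i <- r) l i *: w i.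
  move=> ur lr; apply: fsum_seqE => // i; apply: contraNT => ir.
  have /eqP -> : l i == 0 by apply: contraNT ir; exact: lr.
  by rewrite scale0r.
have supp x : exists2 r : seq I, uniq r & forall i, c x i != 0 -> i \in r.
  have [/finite_seqP[r rE] _] := cP x; exists (undup r); first exact: undup_uniq.
  by move=> i ci; rewrite mem_undup; have : [set` r] i by rewrite -rE.
pose g x := \sum_(i \in [set: I]) c x i *: v i.
exists g; split.
- move=> a x y; have [r ur rx] := supp x; have [q uq qy] := supp y.
  pose s := undup (r ++ q); have us : uniq s by exact: undup_uniq.
  have sx i : c x i != 0 -> i \in s by move=> /rx h; rewrite mem_undup mem_cat h.
  have sy i : c y i != 0 -> i \in s by move=> /qy h; rewrite mem_undup mem_cat h orbT.
  have sxy i : a * c x i + c y i != 0 -> i \in s.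
    apply: contraNT => is_; have /eqP -> : c x i == 0 by apply: contraNT is_; exact: sx.
    have /eqP -> : c y i == 0 by apply: contraNT is_; exact: sy.
    by rewrite mulr0 addr0.
  have lin (V : lmodType A) (w : I -> V) :
      \sum_(i \in [set: I]) (a * c x i + c y i) *: w i =
      a *: (\sum_(i \in [set: I]) c x i *: w i) + \sum_(i \in [set: I]) c y i *: w i.
    rewrite (sumE V (fun i => a * c x i + c y i) w s us sxy).
    rewrite (sumE V (c x) w s us sx) (sumE V (c y) w s us sy).
    rewrite scaler_sumr -big_split; apply: eq_bigr => i _ /=.
    by rewrite scalerDl scalerA.
  have -> : g (a *: x + y) = \sum_(i \in [set: I]) (a * c x i + c y i) *: v i.
    have cxy : c (a *: x + y) = fun i => a * c x i + c y i.
      apply: cU; last by rewrite lin -(cP x).2 -(cP y).2.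
      apply: (@sub_finite_set _ _ [set` s]); last exact: finite_seq.
      by move=> i /= /sxy.
    by rewrite /g cxy.
  exact: lin.
- move=> x; have [r ur rx] := supp x; rewrite /g (sumE _ (c x) v r ur rx).
  elim: r {ur rx} => [|i r IH]; first by rewrite big_nil.
  by rewrite big_cons; exact: QL.
- move=> x; have [r ur rx] := supp x; rewrite /g (sumE _ (c x) v r ur rx).
  rewrite [x in RHS](cP x).2 (sumE _ (c x) b r ur rx).
  elim: r {ur rx} => [|i r IH]; first by rewrite !big_nil p0 f0.
  by rewrite !big_cons pL fL IH pv.
Qed.

Lemma fg_projective_retract (A : nzRingType) (M : lmodType A) :
  projective_module M -> fg_module M ->
  exists r (pi : {linear 'rV[A]_r -> M}) (sg : {linear M -> 'rV[A]_r}),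
    cancel sg pi.
Proof.
move=> pM [r [b bP]]; pose pi (u : 'rV[A]_r) : M := \sum_i u 0 i *: b i.
have pi_lin : linear pi.
  move=> a u v; rewrite /pi scaler_sumr -big_split; apply: eq_bigr => i _ /=.
  by rewrite !mxE scalerDl scalerA.
pose piL : {linear 'rV[A]_r -> M} := HB.pack pi (GRing.isLinear.Build _ _ _ _ pi pi_lin).
have surj x : exists u, piL u = x.
  have [l ->] := bP x; exists (\row_i l i); apply: eq_bigr => i _.
  by rewrite mxE.
have [g gP] := pM _ _ piL idfun surj.
by exists r, piL, g.
Qed.

Lemma mulmxMnl (A : nzRingType) r s t (u : 'M[A]_(r, s)) (M : 'M[A]_(s, t)) n :
  (u *+ n) *m M = (u *m M) *+ n.
Proof. by elim: n => [|n IH]; rewrite ?mulr0n ?mul0mx// !mulrS mulmxDl IH. Qed.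

Record free_complex (A : nzRingType) (G : groupType) := FreeComplex {
  fc_rank : nat -> nat;
  fc_d : forall k, 'M[grpring A G]_(fc_rank k.+1, fc_rank k);
  fc_aug : 'I_(fc_rank 0) -> A;
  fc_dd : forall k, fc_d k.+1 *m fc_d k = 0;
  fc_aug_d : forall i, row_aug fc_aug (row i (fc_d 0)) = 0 }.

Arguments fc_aug {A G} f _.
Arguments fc_d {A G} f k.

(* The projective modules of P are retracts of free ones in degrees <= m: e k is the
   idempotent matrix with image P_k, and D k is the differential of P read on the
   free modules. The resulting complex is exact on the images of the e k, and lifting
   along a basis of Z over int / p makes this survive the base change to Z. *)
Section FiniteModel.
Variables (Z : coefficient) (G : groupType) (m : nat) (P : resolution int G).
Hypothesis m_gt0 : (0 < m)%N.
Local Notation ZG := (grpring Z G).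
Local Notation IG := (grpring int G).
Local Notation red := (@gmap int Z G (intmul 1)).

Variables (rk : nat -> nat).
Variable pi : forall k, {linear 'rV[IG]_(rk k) -> res_mod P k}.
Variable sg : forall k, {linear res_mod P k -> 'rV[IG]_(rk k)}.
Hypothesis piK : forall k, (k <= m)%N -> cancel (sg k) (pi k).
Hypothesis pi0 : forall k, (m < k)%N -> forall u, pi k u = 0.

Let D k : 'M[IG]_(rk k.+1, rk k) := lin1_mx (sg k \o res_d P k \o pi k.+1).
Let e k : 'M[IG]_(rk k) := lin1_mx (sg k \o pi k).
Let eps j : int := res_aug P (pi 0 (delta_mx 0 j)).

Let DE k (u : 'rV_(rk k.+1)) : u *m D k = sg k (res_d P k (pi k.+1 u)).
Proof. by rewrite mul_rV_lin1. Qed.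
Let eE k (u : 'rV_(rk k)) : u *m e k = sg k (pi k u).
Proof. by rewrite mul_rV_lin1. Qed.

Let epsE u : row_aug eps u = res_aug P (pi 0 u).
Proof.
have aug0 : res_aug P 0 = 0.
  by apply: (@addrI _ (res_aug P 0)); rewrite -res_augD !addr0.
rewrite {2}[u]row_sum_delta linear_sum (big_morph _ (@res_augD _ _ P) aug0).
by apply: eq_bigr => j _; rewrite linearZ res_augZ.
Qed.

(** The composite of D contains [pi k.+1] after [sg k.+1], which cancel only up to degree m; above m
    the map [pi] is 0. *)
Let DD k : D k.+1 *m D k = 0.
Proof.
apply/row_matrixP => i; rewrite row0 row_mul DE rowE DE.
have [km|mk] := leqP k.+1 m; last by rewrite pi0// !linear0.
by rewrite piK// (@res_exactS _ _ P k _).2 ?linear0//; exists (pi k.+2 (delta_mx 0 i)).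
Qed.

Let De k : (k <= m)%N -> D k *m e k = D k.
Proof.
move=> km; apply/row_matrixP => i; rewrite row_mul eE rowE DE piK//.
Qed.

Let eps_D i : row_aug eps (row i (D 0)) = 0.
Proof.
rewrite epsE rowE DE piK//.
by apply/res_exact0; exists (pi 1%N (delta_mx 0 i)).
Qed.

Let epsDv u : row_aug eps (u *m D 0) = 0.
Proof.
by rewrite epsE DE piK//; apply/res_exact0; exists (pi 1%N u).
Qed.

Let exact0 (u : 'rV_(rk 0)) : u *m e 0 = u -> row_aug eps u = 0 ->
  exists2 v, v *m e 1%N = v & v *m D 0 = u.
Proof.
move=> ue; rewrite epsE => /(@res_exact0 _ _ P _)[y dy]; exists (sg 1%N y).
  by rewrite eE piK.
by rewrite DE piK// dy -eE.
Qed.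

Let exactS k (u : 'rV_(rk k.+1)) : (k.+1 < m)%N -> u *m e k.+1 = u -> u *m D k = 0 ->
  exists2 v, v *m e k.+2 = v & v *m D k.+1 = u.
Proof.
move=> km ue; rewrite DE => du.
have : res_d P k (pi k.+1 u) = 0.
  by rewrite -[LHS]piK ?du ?linear0// ltnW// ltnW.
move=> /(@res_exactS _ _ P k _)[y dy]; exists (sg k.+2 y); first by rewrite eE piK.
by rewrite DE piK// dy -eE.
Qed.

Let eps_surj (a : int) : exists2 u, u *m e 0 = u & row_aug eps u = a.
Proof.
have [x <-] := @res_aug_surj _ _ P a; exists (sg 0 x); first by rewrite eE piK.
by rewrite epsE piK.
Qed.

Let ee k : (k <= m)%N -> e k *m e k = e k.
Proof.
by move=> km; apply/row_matrixP => i; rewrite row_mul eE rowE eE piK.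
Qed.

Let DZ k := map_mx red (D k).
Let eZ k := map_mx red (e k).
Let epsZ j : Z := (eps j)%:~R.

Let Zcomm (x y : Z) : x * y = y * x.
Proof. exact: mulrC. Qed.

Section Lift.
Variables (p q : nat) (b : 'I_q -> Z).
Hypothesis bZ : int_basis p b.
Local Notation be i := (xelt (trivial_action Z G) (b i) 1%g).

Let sum_red r s (w : 'I_q -> 'rV[IG]_r) (M : 'M[IG]_(r, s)) :
  (\sum_i be i *: map_mx red (w i)) *m map_mx red M =
  \sum_i be i *: map_mx red (w i *m M).
Proof.
by rewrite mulmx_suml; apply: eq_bigr => i _; rewrite -scalemxAl -map_mxM.
Qed.

(** Any lift can be moved into the image of the integral idempotent by applying it once, as its
    reduction fixes u. *)
Let lift_e k (u : 'rV[ZG]_(rk k)) : (k <= m)%N -> u *m eZ k = u ->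
  exists2 w : 'I_q -> 'rV[IG]_(rk k), u = \sum_i be i *: map_mx red (w i) &
    forall i, w i *m e k = w i.
Proof.
move=> km ue; have [w uw] := row_lift bZ Zcomm u.
exists (fun i => w i *m e k); last by move=> i; rewrite -mulmxA ee.
by rewrite -[LHS]ue {1}uw sum_red.
Qed.

(** Multiples of p die in Z, so each [w i] may first be corrected by some p-fold [y i] to become an
    integral boundary. *)
Let lift_boundary r s (M : 'M[IG]_(r, s)) (E : 'M[IG]_r) (w y : 'I_q -> 'rV[IG]_s) :
  (forall i, exists2 v, v *m E = v & v *m M = w i - y i *+ p) ->
  exists2 v, v *m map_mx red E = v &
    v *m map_mx red M = \sum_i be i *: map_mx red (w i).
Proof.
move=> ex; pose v i := s2val (cid2 (ex i)).
exists (\sum_i be i *: map_mx red (v i)).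
  by rewrite sum_red; apply: eq_bigr => i _; rewrite /v; case: cid2 => /= ? ->.
rewrite sum_red; apply: eq_bigr => i _; rewrite /v; case: cid2 => /= x _ ->.
by rewrite map_mxB (row_red_pmul bZ) subr0.
Qed.

(** The integral lifts have augmentations divisible by p. Surjectivity of the integral augmentation
    on the image of [e 0] supplies corrections after which these augmentations vanish, and integral
    exactness applies. *)
Lemma exactZ0 (u : 'rV_(rk 0)) : u *m eZ 0 = u -> row_aug epsZ u = 0 ->
  exists2 v, v *m eZ 1%N = v & v *m DZ 0 = u.
Proof.
move=> ue u0; have [w uw we] := lift_e (leq0n m) ue.
have wp i : exists k : int, row_aug eps (w i) = k *+ p.
  apply: (aug_lift_eq0 bZ Zcomm (l := fun i => row_aug eps (w i))).
  rewrite -[RHS]u0 uw row_aug_sum; apply: eq_bigr => j _.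
  by rewrite row_augZ grpring_aug_elt row_aug_map.
pose l i := projT1 (cid (wp i)).
have lP i : row_aug eps (w i) = l i *+ p by rewrite /l; case: cid.
pose y i := s2val (cid2 (eps_surj (l i))).
have yP i : row_aug eps (y i) = l i by rewrite /y; case: cid2.
have ye i : y i *m e 0 = y i by rewrite /y; case: cid2.
rewrite uw; apply: (lift_boundary (y := y)) => i; apply: exact0.
  by rewrite mulmxBl mulmxMnl we ye.
by rewrite row_augD row_augN row_augMn lP yP subrr.
Qed.

(** The boundary of an integral lift is p v for some v. If p is 0, the lift is a cycle already.
    Otherwise multiplication by p is injective, so v lies in the image of the idempotent and is a
    cycle, in degree 0 for the augmentation. By exactness v is the boundary of some y, and the lift
    minus p y is an integral cycle, hence a boundary. *)
Lemma exactZS k (u : 'rV_(rk k.+1)) : (k.+1 < m)%N -> u *m eZ k.+1 = u -> u *m DZ k = 0 ->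
  exists2 v, v *m eZ k.+2 = v & v *m DZ k.+1 = u.
Proof.
move=> km ue u0; have [w uw we] := lift_e (ltnW km) ue.
have wp i : exists v, w i *m D k = v *+ p.
  by apply: (row_lift_eq0 bZ Zcomm (w := fun i => w i *m D k)); rewrite -sum_red -uw.
have yex i : exists2 y, y *m e k.+1 = y & (w i - y *+ p) *m D k = 0.
  have [v vP] := wp i; have [p0|p_gt0] := posnP p.
    by exists 0; rewrite ?mul0mx// p0 mulr0n subr0 vP p0 mulr0n.
  have pinj r (x : 'rV[IG]_r) : x *+ p = 0 -> x = 0.
    move=> xp; apply/rowP => j; apply: xringP => g; rewrite mxE xcoef0.
    have := congr1 (fun x : 'rV_r => (x 0 j : IG) g) xp.
    rewrite mulmxnE mxE xcoefMn xcoef0 => /eqP; rewrite mulrn_eq0 => /orP[|/eqP//].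
    by rewrite eqn0Ngt p_gt0.
  have [y ye yv] : exists2 y, y *m e k.+1 = y & y *m D k = v.
    have km' : (k <= m)%N by apply: ltnW; apply: ltnW.
    have ve : v *m e k = v.
      apply/subr0_eq/pinj.
      by rewrite mulrnBl -mulmxMnl -vP -mulmxA De// subrr.
    case: k km km' {u ue u0 uw we wp} w v vP ve => [|k] km km' w v vP ve.
      apply: exact0 => //; apply/eqP.
      have := epsDv (w i); rewrite vP row_augMn => /eqP.
      by rewrite mulrn_eq0 eqn0Ngt p_gt0.
    apply: exactS => //; first exact: ltnW.
    by apply: pinj; rewrite -mulmxMnl -vP -mulmxA DD mulmx0.
  by exists y => //; rewrite mulmxBl mulmxMnl yv vP subrr.
pose y i := s2val (cid2 (yex i)).
rewrite uw; apply: (lift_boundary (y := y)) => i; rewrite /y.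
case: cid2 => /= x xe xD; apply: exactS => //.
by rewrite mulmxBl mulmxMnl we xe.
Qed.

End Lift.

Let eps_surjZ (a : Z) : exists2 u, u *m eZ 0 = u & row_aug epsZ u = a.
Proof.
have [v ve v1] := eps_surj 1.
exists (xelt (trivial_action Z G) a 1%g *: map_mx red v).
  by rewrite -scalemxAl -map_mxM ve.
by rewrite row_augZ grpring_aug_elt row_aug_map v1 mulr1.
Qed.

Let DDZ k : DZ k.+1 *m DZ k = 0.
Proof. by rewrite -map_mxM DD map_mx0. Qed.

Let eps_DZ i : row_aug epsZ (row i (DZ 0)) = 0.
Proof. by rewrite -map_row row_aug_map eps_D. Qed.

Definition fin_model := FreeComplex DDZ eps_DZ.

Lemma fin_model_map (C : resolution Z G) : free_resolution C ->
  exists psi : forall k, res_mod C k -> 'rV[ZG]_(rk k),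
    [/\ forall k a x y, (k <= m)%N -> psi k (a *: x + y) = a *: psi k x + psi k y,
        forall k x, (k < m)%N -> psi k (res_d C k x) = psi k.+1 x *m fc_d fin_model k &
        forall x, row_aug (fc_aug fin_model) (psi 0%N x) = res_aug C x].
Proof.
move=> freeC; have [p [q [b bZ]]] := coefficient_int_basis Z.
(* The second clause is exactly what the next lifting needs. It follows from exactness because the
   values lie in the image of the idempotent, which is the condition Q handed to [free_lifting]. *)
pose good k (f : res_mod C k -> 'rV[ZG]_(rk k)) :=
  (forall a x y, f (a *: x + y) = a *: f x + f y) /\
  ((k < m)%N -> forall x, exists2 y, y *m eZ k.+1 = y & y *m DZ k = f (res_d C k x)).
pose P0 k : (res_mod C k -> 'rV[ZG]_(rk k)) -> Prop :=
  match k return (res_mod C k -> 'rV[ZG]_(rk k)) -> Prop with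
  | 0 => fun f => @good 0%N f /\ forall x, row_aug epsZ (f x) = res_aug C x
  | j.+1 => fun f => (j.+1 <= m)%N -> @good j.+1 f
  end.
pose Q0 k (f : res_mod C k -> 'rV[ZG]_(rk k)) (f' : res_mod C k.+1 -> 'rV[ZG]_(rk k.+1)) :=
  (k < m)%N -> forall x, f (res_d C k x) = f' x *m DZ k.
have lin0 (V W : lmodType ZG) (f : V -> W) :
    (forall a x y, f (a *: x + y) = a *: f x + f y) -> f 0 = 0.
  move=> fL; have := fL 1 0 0; rewrite !scale1r !addr0 => h.
  by apply: (@addrI _ (f 0)); rewrite -h addr0.
have [psi [psiP psiQ]] : exists s : forall k, res_mod C k -> 'rV[ZG]_(rk k),
    (forall k, P0 k (s k)) /\ forall k, Q0 k (s k) (s k.+1).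
  apply: dependent_family.
    have [|||||||g [gL ge gp]] := @free_lifting ZG (res_mod C 0) 'rV[ZG]_(rk 0) Z
      (fun a z => grpring_aug a * z) (row_aug epsZ) (res_aug C)
      (fun u => u *m eZ 0 = u) (freeC 0%N).
    - by move=> a x y; exact: row_augP.
    - exact: row_aug0.
    - by move=> a x y; rewrite res_augD res_augZ.
    - by apply: (@addrI _ (res_aug C 0)); rewrite -res_augD !addr0.
    - exact: mul0mx.
    - by move=> a x y xe ye; rewrite mulmxDl -scalemxAl xe ye.
    - by move=> x; have [u ue uP] := eps_surjZ (res_aug C x); exists u.
    - exists g; split => //; split => // _ x; apply: (exactZ0 bZ) => //.
      by rewrite gp; apply/res_exact0; exists x.
  move=> k f; rewrite /P0 => Pk.
  have [km|mk] := ltnP k m; last first.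
    have km : (k < m)%N -> False by rewrite ltnNge mk.
    by exists (fun=> 0) => // km'; case: (km km').
  have {Pk} [fL fex] : @good k f.
    by case: k f Pk km => [|k] f Pk km; [case: Pk|apply: Pk; exact: ltnW].
  have [|||||||g [gL ge gp]] := @free_lifting ZG (res_mod C k.+1) 'rV[ZG]_(rk k.+1)
      'rV[ZG]_(rk k) (fun a u => a *: u) (fun u => u *m DZ k) (fun x => f (res_d C k x))
      (fun u => u *m eZ k.+1 = u) (freeC k.+1).
  - by move=> a x y; rewrite mulmxDl -scalemxAl.
  - exact: mul0mx.
  - by move=> a x y; rewrite linearP fL.
  - by rewrite linear0; exact: lin0.
  - exact: mul0mx.
  - by move=> a x y xe ye; rewrite mulmxDl -scalemxAl xe ye.
  - exact: fex.
  - exists g; last by move=> _ x; rewrite gp.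
    move=> _; split => // km1 x; apply: (exactZS bZ) => //.
    rewrite gp [X in f X](_ : _ = 0) ?lin0//.
    by apply/res_exactS; exists x.
exists psi; split.
- by move=> [|k] a x y km; have := psiP _; [move=> /(_ 0%N)[[-> _] _]|move=> /(_ k.+1 km)[-> _]].
- by move=> k x km; exact: (psiQ k km).
- by move=> x; have [_ ->] := psiP 0%N.
Qed.

End FiniteModel.

Theorem type_FP_model (Z : coefficient) (G : groupType) (n : nat) (C : resolution Z G) :
  type_FP n.+1 G -> free_resolution C ->
  exists (L : free_complex Z G) (psi : forall k, res_mod C k -> 'rV_(fc_rank L k)),
    [/\ forall k a x y, (k <= n.+1)%N -> psi k (a *: x + y) = a *: psi k x + psi k y,
        forall k x, (k < n.+1)%N -> psi k (res_d C k x) = psi k.+1 x *m fc_d L k &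
        forall x, row_aug (fc_aug L) (psi 0%N x) = res_aug C x].
Proof.
move=> [P [projP fgP]] freeC.
have ex k : exists w : {r : nat & ({linear 'rV[grpring int G]_r -> res_mod P k} *
    {linear res_mod P k -> 'rV[grpring int G]_r})%type},
    ((k <= n.+1)%N -> cancel (projT2 w).2 (projT2 w).1) /\
    ((n.+1 < k)%N -> forall u, (projT2 w).1 u = 0).
  have [km|mk] := leqP k n.+1.
    have [r [pi [sg piK]]] := fg_projective_retract (projP k) (fgP k km).
    by exists (existT _ r (pi, sg)).
  (* Above degree n+1, where nothing is finitely generated by hypothesis, the model has rank 0. *)
  by exists (existT _ 0%N (\0 : {linear _ -> _}, \0 : {linear _ -> _})).
have [rk [pi [sg [piK pi0]]]] : exists (rk : nat -> nat)
    (pi : forall k, {linear 'rV[grpring int G]_(rk k) -> res_mod P k})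
    (sg : forall k, {linear res_mod P k -> 'rV[grpring int G]_(rk k)}),
    (forall k, (k <= n.+1)%N -> cancel (sg k) (pi k)) /\
    (forall k, (n.+1 < k)%N -> forall u, pi k u = 0).
  pose w k := sval (cid (ex k)).
  exists (fun k => projT1 (w k)), (fun k => (projT2 (w k)).1), (fun k => (projT2 (w k)).2).
  by split=> k; [exact: (svalP (cid (ex k))).1|exact: (svalP (cid (ex k))).2].
have [psi psiP] := fin_model_map (ltn0Sn n) piK pi0 freeC.
by exists (fin_model Z piK pi0), psi.
Qed.

(** * The approximating complex *)

Section GroupRingInclusion.
Context d (X : measurableType d) (R : realType) (mu : probability X R).
Variables (Z : coefficient) (G : groupType) (alpha : standard_action mu G).
Local Notation CP := (crossed_product alpha Z).
Local Notation ZG := (grpring Z G).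
Local Notation cst := (@linf_const _ _ _ mu Z).
Implicit Types (s t : ZG).

Lemma linf_constE z : \forall x \ae mu, linf_repr (cst z) x = z.
Proof. exact: (linf_classK (is_linf_cst mu z)). Qed.

Lemma linf_constD z z' : cst (z + z') = cst z + cst z'.
Proof.
apply/linf_eqP; apply: filterS2 (filterI (linf_constE z) (linf_constE z'))
  (filterI (linf_constE (z + z')) (linf_reprD (cst z) (cst z'))).
by move=> x [e1 e2] [-> ->]; rewrite e1 e2.
Qed.

Lemma linf_constM z z' : cst (z * z') = cst z * cst z'.
Proof.
apply/linf_eqP; apply: filterS2 (filterI (linf_constE z) (linf_constE z'))
  (filterI (linf_constE (z * z')) (linf_reprM (cst z) (cst z'))).
by move=> x [e1 e2] [-> ->]; rewrite e1 e2.
Qed.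

Lemma linf_const1 : cst 1 = 1.
Proof.
by apply/linf_eqP; apply: filterS2 (linf_constE 1) (linf_repr1 mu Z) => x -> ->.
Qed.

Lemma linf_const0 : cst 0 = 0.
Proof. by apply: (@addrI _ (cst 0)); rewrite -linf_constD !addr0. Qed.

Lemma linf_const_trans g z : linf_trans alpha g (cst z) = cst z.
Proof.
apply/linf_eqP; apply: filterS3 (linf_transE alpha g (cst z)) (linf_constE z)
  (sact_ae alpha g^-1%g (linf_constE z)) => x -> -> ->.
by [].
Qed.

Lemma linf_const_is_zmod : zmod_morphism cst.
Proof.
move=> z z'; apply/eqP; rewrite -(inj_eq (addIr (cst z'))) -linf_constD !subrK.
by [].
Qed.
HB.instance Definition _ := GRing.isZmodMorphism.Build Z (Linf mu Z) cst linf_const_is_zmod.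
HB.instance Definition _ := GRing.isMonoidMorphism.Build Z (Linf mu Z) cst
  (linf_const1, linf_constM).

Lemma linf_const_sum (I : Type) (r : seq I) (F : I -> Z) :
  cst (\sum_(i <- r) F i) = \sum_(i <- r) cst (F i).
Proof. exact: (big_morph _ linf_constD linf_const0). Qed.

Let gi := @grpring_incl _ _ _ _ _ alpha Z.

Let giE s : gi s = xmap (linf_action alpha Z) cst s.
Proof. exact: xringP. Qed.

Lemma grpring_inclB s t : grpring_incl alpha (s - t) =
  grpring_incl alpha s - grpring_incl alpha t.
Proof. by rewrite -/gi !giE; exact: xmap_is_zmod. Qed.

Lemma grpring_incl0 : grpring_incl alpha (0 : ZG) = 0.
Proof. by rewrite -(subrr (0 : ZG)) grpring_inclB subrr. Qed.

Lemma grpring_inclD s t : grpring_incl alpha (s + t) =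
  grpring_incl alpha s + grpring_incl alpha t.
Proof. by rewrite -{1}[t]opprK -[- t]add0r !grpring_inclB grpring_incl0 sub0r opprK. Qed.

Lemma grpring_inclM s t : grpring_incl alpha (s * t) =
  grpring_incl alpha s * grpring_incl alpha t.
Proof.
rewrite -/gi !giE; apply: (xmap_is_monoid (actA := trivial_action Z G) _).2.
by move=> g a; rewrite /= linf_const_trans.
Qed.

Lemma grpring_incl_sum (I : Type) (r : seq I) (F : I -> ZG) :
  grpring_incl alpha (\sum_(i <- r) F i) = \sum_(i <- r) grpring_incl alpha (F i).
Proof. exact: (big_morph _ grpring_inclD grpring_incl0). Qed.

Lemma cp_act_const s z : cp_act (grpring_incl alpha s) (cst z) = cst (grpring_aug s * z).
Proof.
have [r ur ru] := xring_supp s.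
rewrite /grpring_aug (fsum_seqE ur ru) mulr_suml rmorph_sum /cp_act (@fsum_seqE _ _ _ r)//.
  by apply: eq_bigr => g _; rewrite linf_const_trans; exact/esym/linf_constM.
move=> h; rewrite linf_const_trans -linf_constM => hn; apply: ru.
by apply: contraNN hn => /eqP ->; rewrite mul0r linf_const0.
Qed.

End GroupRingInclusion.

(** * Marked modules seen from the crossed product *)

Section MarkedModules.
Context d (X : measurableType d) (R : realType) (mu : probability X R).
Variables (Z : coefficient) (S : scalars mu Z).
Variables (G : groupType) (alpha : standard_action mu G).
Variables (c : G -> nat).
Variable ext : crossed_extension S alpha c.
Local Notation CP := (crossed_product alpha Z).
Local Notation chi := (cp_indic alpha Z).
Local Notation incl := (ce_incl ext).
Local Notation "s *! t" := (sc_mul (incl s) t) (at level 40).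
Implicit Types (M N : marked X).

Lemma in_modP M (z : vec S M) :
  in_mod z <-> forall i, sc_mul (z i) (sc_indic S (mk_set i)) = z i.
Proof.
by split=> h i; have := zmem_indic ext (z i) (mk_measurable i) => -[h1 h2]; auto.
Qed.

Lemma in_modD M (z z' : vec S M) : in_mod z -> in_mod z' -> @in_mod _ _ _ _ _ S M (z + z').
Proof.
move=> /in_modP hz /in_modP hz'; apply/in_modP => i.
apply: (ce_coef_inj ext); apply: funext => g.
rewrite ce_coef_indic; last exact: mk_measurable.
rewrite [(z + z') i]/(z i + z' i) ce_coefD [(_ + _) g]/(_ + _) mulrDl.
by congr (_ + _); rewrite -ce_coef_indic ?hz ?hz'//; exact: mk_measurable.
Qed.

Lemma in_mod_smul M s (z : vec S M) : in_mod z -> @in_mod _ _ _ _ _ S M (smul (incl s) z).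
Proof.
move=> /in_modP hz; apply/in_modP => i.
by rewrite /smul zmul_indicM ?hz//; exact: mk_measurable.
Qed.

Lemma in_mod0 M : @in_mod _ _ _ _ _ S M 0.
Proof.
apply/in_modP => i; have := zincl_Mindic ext 0 (mk_measurable i).
by rewrite mul0r zincl0.
Qed.

Lemma in_mod_comb M (I : Type) (r : seq I) (s : I -> CP) (F : I -> vec S M) :
  (forall i, in_mod (F i)) ->
  @in_mod _ _ _ _ _ S M (\sum_(i <- r) smul (incl (s i)) (F i)).
Proof.
move=> hF; elim: r => [|i r IH]; first by rewrite big_nil; exact: in_mod0.
by rewrite big_cons; apply: in_modD => //; exact: in_mod_smul.
Qed.

Lemma smulA M s t (z : vec S M) : smul (incl (s * t)) z = smul (incl s) (smul (incl t) z).
Proof. by apply: funext => i; exact: zmulA. Qed.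
Lemma smulDl M s t (z : vec S M) :
  smul (incl (s + t)) z = smul (incl s) z + smul (incl t) z.
Proof. by apply: funext => i; exact: zmulDl. Qed.
Lemma smulDr M s (z z' : vec S M) :
  smul (incl s) ((z + z') : vec S M) = smul (incl s) z + smul (incl s) z'.
Proof. by apply: funext => i; exact: zmulDr. Qed.
Lemma smul0 M s : smul (incl s) (0 : vec S M) = 0.
Proof. by apply: funext => i; exact: zmul0r. Qed.
Lemma smul0l M (z : vec S M) : smul (incl 0) z = 0.
Proof. by apply: funext => i; exact: zmul0l. Qed.

Lemma smul_sumr M (I : Type) (r : seq I) s (F : I -> vec S M) :
  smul (incl s) (\sum_(i <- r) F i : vec S M) = \sum_(i <- r) smul (incl s) (F i).
Proof. exact: (big_morph (fun z : vec S M => smul (incl s) z) (@smulDr M s) (smul0 M s)). Qed.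
Lemma smul_suml M (I : Type) (r : seq I) (F : I -> CP) (z : vec S M) :
  smul (incl (\sum_(i <- r) F i)) z = \sum_(i <- r) smul (incl (F i)) z.
Proof. exact: (big_morph (fun s => smul (incl s) z) (fun s t => smulDl s t z) (smul0l z)). Qed.

Section Hom.
Variables (M N : marked X) (f : vec S M -> vec S N).
Hypothesis f_hom : is_hom f.

Lemma hom0 : f 0 = 0.
Proof.
have [_ fD _] := f_hom; have := fD 0 0 (@in_mod0 M) (@in_mod0 M).
by rewrite addr0 => h; apply: (@addrI _ (f 0)); rewrite -h addr0.
Qed.

Lemma hom_comb (I : Type) (r : seq I) (s : I -> CP) (F : I -> vec S M) :
  (forall i, in_mod (F i)) ->
  f (\sum_(i <- r) smul (incl (s i)) (F i)) = \sum_(i <- r) smul (incl (s i)) (f (F i)).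
Proof.
move=> hF; have [_ fD fZ] := f_hom.
elim: r => [|i r IH]; first by rewrite !big_nil hom0.
rewrite !big_cons fD ?IH ?fZ//; first exact: in_mod_smul.
exact: in_mod_comb.
Qed.

End Hom.

Section AugHom.
Variables (M : marked X) (eta : vec S M -> Linf mu Z).
Hypothesis eta_hom : is_aug_hom eta.

Lemma aug_hom_comb (I : Type) (r : seq I) (s : I -> CP) (F : I -> vec S M) :
  (forall i, in_mod (F i)) ->
  eta (\sum_(i <- r) smul (incl (s i)) (F i)) = \sum_(i <- r) cp_act (s i) (eta (F i)).
Proof.
move=> hF; have [fD fZ] := eta_hom.
have e0 : eta 0 = 0.
  have := fD 0 0 (@in_mod0 M) (@in_mod0 M); rewrite addr0 => h.
  by apply: (@addrI _ (eta 0)); rewrite -h addr0.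
elim: r => [|i r IH]; first by rewrite !big_nil e0.
rewrite !big_cons fD ?IH ?fZ ?ce_act//; first exact: in_mod_smul.
exact: in_mod_comb.
Qed.

End AugHom.

Definition gen M (j : mk_ix M) : vec S M :=
  fun i => if i == j then incl (chi (mk_set j)) else 0.

Lemma in_mod_gen M (j : mk_ix M) : in_mod (gen j).
Proof.
apply/in_modP => i; rewrite /gen; case: eqP => [->|_].
  by rewrite zincl_Mindic ?cp_indicM//; exact: mk_measurable.
have := zincl_Mindic ext 0 (mk_measurable i).
by rewrite mul0r zincl0.
Qed.

Definition vincl M (w : mk_ix M -> CP) : vec S M := fun i => incl (w i).

Lemma vincl_gen M (w : mk_ix M -> CP) : (forall i, w i * chi (mk_set i) = w i) ->
  vincl w = \sum_j smul (incl (w j)) (gen j).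
Proof.
move=> hw; apply: funext => i; rewrite fct_sumE (bigD1 i)//= big1 ?addr0.
  by rewrite /smul /gen eqxx -zinclM hw.
by move=> j ji; rewrite /smul /gen eq_sym (negbTE ji) zmul0r.
Qed.

End MarkedModules.

Arguments mr_eta {d X R mu Z S m} _ _.
Arguments mr_d_hom {d X R mu Z S m} _ {k} _.
Arguments mr_eta_hom {d X R mu Z S m} _.
Arguments mr_eta_surj {d X R mu Z S m} _ _.
Arguments mr_exact0 {d X R mu Z S m} _ _ {z} _.
Arguments mr_exactS {d X R mu Z S m} _ {k} _ {z} _.

(** * The cut complex and its enlargement by summands for the generators of L *)

Section Assembly.
Context d (X : measurableType d) (R : realType) (mu : probability X R).
Variables (Z : coefficient) (S : scalars mu Z).
Variables (G : groupType) (alpha : standard_action mu G).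
Variables (c : G -> nat) (c_inj : injective c).
Variable ext : crossed_extension S alpha c.
Variables (n : nat) (D : marked_resolution S n.+1) (L : free_complex Z G).
Local Notation CP := (crossed_product alpha Z).
Local Notation ZG := (grpring Z G).
Local Notation chi := (cp_indic alpha Z).
Local Notation incl := (ce_incl ext).
Local Notation coef := (ce_coef ext).
Local Notation "s *! t" := (sc_mul (incl s) t) (at level 40).
Local Notation gi := (grpring_incl alpha).
Local Notation I r := (mk_ix (mr_mod D r)).
Local Notation A r j := (@mk_set _ _ (mr_mod D r) j).
Local Notation J r := ('I_(fc_rank L r)).
Local Notation dl r i k := (gi (fc_d L r i k)).
Local Notation V r := (vec S (mr_mod D r)).
Local Notation CS := (cp_scalars Z alpha).

Lemma mr_dd k (z : V k.+2) : (k.+2 <= n.+1)%N -> in_mod z ->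
  mr_d D k (mr_d D k.+1 z) = 0.
Proof.
move=> kn hz; have [hd _ _] := mr_d_hom D kn.
by apply: (mr_exactS D kn (hd z hz)).2; exists z.
Qed.

Lemma mr_eta_d (z : V 1) : in_mod z -> mr_eta D (mr_d D 0 z) = 0.
Proof.
move=> hz; have [hd _ _] := mr_d_hom D (ltn0Sn n).
by apply: (mr_exact0 D (ltn0Sn n) (hd z hz)).2; exists z.
Qed.

(** The values on the basis of L of a chain map from L to D that is compatible with the
    augmentations. *)
Definition lift_spec (f : forall r, J r -> V r) :=
  [/\ forall r i, (r <= n.+1)%N -> in_mod (f r i),
      forall r i, (r < n.+1)%N ->
        mr_d D r (f r.+1 i) = \sum_k smul (incl (dl r i k)) (f r k) &
      forall i, mr_eta D (f 0%N i) = linf_const mu (fc_aug L i)].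

Lemma lift_exists : exists f, lift_spec f.
Proof.
pose cycle r (F : J r -> V r) (i : J r.+1) := \sum_k smul (incl (dl r i k)) (F k).
(* Besides membership, the invariant says that the prescribed boundaries in the next degree have
   preimages; this comes from exactness of D together with the relation [fc_dd] of L. *)
pose P r (F : J r -> V r) := (r <= n.+1)%N -> (forall i, in_mod (F i)) /\
  ((r < n.+1)%N -> forall i : J r.+1, exists2 y : V r.+1, in_mod y & mr_d D r y = cycle r F i).
pose Q r (F : J r -> V r) (F' : J r.+1 -> V r.+1) :=
  (r < n.+1)%N -> forall i, mr_d D r (F' i) = cycle r F i.
pose P' r : (J r -> V r) -> Prop := match r return (J r -> V r) -> Prop with
  | 0 => fun F => @P 0%N F /\ forall i, mr_eta D (F i) = linf_const mu (fc_aug L i)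
  | k.+1 => fun F => @P k.+1 F end.
have [f [fP fQ]] : exists f : forall r, J r -> V r,
    (forall r, P' r (f r)) /\ forall r, Q r (f r) (f r.+1).
  apply: dependent_family.
    pose ex i := mr_eta_surj D (linf_const mu (fc_aug L i)).
    pose F i := s2val (cid2 (ex i)).
    have hF i : in_mod (F i) by rewrite /F; case: cid2.
    have eF i : mr_eta D (F i) = linf_const mu (fc_aug L i) by rewrite /F; case: cid2.
    exists F; split => //; split => // n0 i.
    apply: (mr_exact0 D n0 _).1; first exact: in_mod_comb.
    rewrite (aug_hom_comb ext (mr_eta_hom D))//.
    under eq_bigr => k _ do rewrite eF cp_act_const.
    rewrite -linf_const_sum.
    rewrite [X in linf_const _ X](_ : _ = row_aug (fc_aug L) (row i (fc_d L 0))).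
      by rewrite fc_aug_d linf_const0.
    by apply: eq_bigr => k _; rewrite mxE.
  move=> r F PF; have [rn|nr] := leqP r.+1 n.+1; last first.
    have nr' : (r < n.+1)%N -> False by rewrite leqNgt nr.
    by exists (fun=> 0) => // rn; case: (nr' rn).
  have {PF} hFE : @P r F by case: r F PF {rn} => [|r] F // [].
  have {hFE} [hF exF] := hFE (ltnW rn).
  pose F' i := s2val (cid2 (exF rn i)).
  have hF' i : in_mod (F' i) by rewrite /F'; case: cid2.
  have dF' i : mr_d D r (F' i) = cycle r F i by rewrite /F'; case: cid2.
  exists F' => // _; split => // rn1 i.
  apply: (mr_exactS D rn1 _).1; first exact: in_mod_comb.
  rewrite (hom_comb ext (mr_d_hom D rn))//.
  under eq_bigr => k _ do rewrite dF' smul_sumr.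
  rewrite exchange_big big1//= => l _.
  under eq_bigr => k _ do rewrite -smulA -grpring_inclM.
  rewrite -smul_suml -grpring_incl_sum.
  have := congr1 (fun M => fun_of_matrix M i l) (fc_dd L r); rewrite !mxE => ->.
  by rewrite grpring_incl0 smul0l.
exists f; split.
- by move=> r i rn; case: r i rn (fP r) => [|r] i rn; [case=> /(_ rn)[h _] _|move=> /(_ rn)[h _]].
- by move=> r i rn; exact: (fQ r rn).
- by move=> i; have [_] := fP 0%N.
Qed.

Variable f : forall r, J r -> V r.
Hypothesis fP : lift_spec f.

Let W r (j : I r.+1) : V r := mr_d D r (gen ext j).

(* avoidD p r j and avoidL p r are the sets U_j and B_r of the introduction. *)
Fixpoint avoidD (p r : nat) : I r -> set X :=
  match r return I r -> set X with
  | 0 => fun=> set0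
  | k.+1 => fun j => \bigcup_i bad alpha c (coef (@W k j i)) p (@avoidD p k i)
  end.

Fixpoint avoidL (p r : nat) : set X :=
  \bigcup_(i : J r) \bigcup_j bad alpha c (coef (f i j)) p (@avoidD p r j) `|`
  if r is k.+1 then
    \bigcup_(i : J k.+1) \bigcup_(l : J k) bad alpha c (xcoef (dl k i l)) p (avoidL p k)
  else set0.

Lemma vanishing_avoidD r j : vanishing mu (fun p => @avoidD p r j).
Proof.
elim: r j => [|r IH] j /=; first exact: vanishing0.
apply: vanishing_bigcup => i.
exact: (@vanishing_bad _ _ _ _ _ _ _ _ c_inj _ (fun p => @avoidD p r i)
  (ce_row_finite ext _) (IH i)).
Qed.

Let vanishing_badL r (i : J r) j :
  vanishing mu (fun p => bad alpha c (coef (f i j)) p (@avoidD p r j)).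
Proof.
exact: (@vanishing_bad _ _ _ _ _ _ _ _ c_inj _ (fun p => @avoidD p r j)
  (ce_row_finite ext _) (vanishing_avoidD j)).
Qed.

Lemma vanishing_avoidL r : vanishing mu (fun p => avoidL p r).
Proof.
elim: r => [|r IH] /=; apply: vanishingU; try exact: vanishing0.
- by apply: vanishing_bigcup => i; apply: vanishing_bigcup => j; exact: vanishing_badL.
- by apply: vanishing_bigcup => i; apply: vanishing_bigcup => j;
    exact: (@vanishing_badL r.+1).
- apply: vanishing_bigcup => i; apply: vanishing_bigcup => j.
  have h := @vanishing_bad _ _ _ _ _ _ alpha _ c_inj _ (fun p => avoidL p r)
    (row_finite_xring c_inj (dl r i j)) IH.
  exact: h.
Qed.

Arguments avoidD : simpl never.
Arguments avoidL : simpl never.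

Section Approximation.
Variable p : nat.
Local Notation U r j := (@avoidD p r j).
Local Notation B r := (avoidL p r).

Let mU r j : measurable (U r j).
Proof. by have [h _] := vanishing_avoidD j. Qed.
Let mB r : measurable (B r).
Proof. by have [h _] := vanishing_avoidL r. Qed.

Definition Yset r (j : I r) : set X := A r j `\` U r j.

Lemma measurable_Yset r j : measurable (@Yset r j).
Proof. by apply: measurableD => //; exact: mk_measurable. Qed.
Let mY := measurable_Yset.

Definition wcut r (j : I r.+1) (i : I r) : CP := zcut ext (Yset j) (@W r j i).
Definition vcut r (k : J r) (j : I r) : CP := zcut ext (~` B r) (f k j).

Let W_in r (j : I r.+1) : (r < n.+1)%N -> in_mod (W j).
Proof.
by move=> rn; have [h _ _] := mr_d_hom D rn; apply: h; exact: in_mod_gen.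
Qed.

Let avoid_w r (j : I r.+1) i : Yset j `&` bad alpha c (coef (W j i)) p (U r i) = set0.
Proof.
apply/seteqP; split => // x [[_ nU] bx]; apply: nU.
by exists i.
Qed.

Let avoid_v r (k : J r) j : ~` B r `&` bad alpha c (coef (f k j)) p (U r j) = set0.
Proof.
apply/seteqP; split => // x [nB bx]; apply: nB.
by case: r k j bx => [|r] k j bx; left; exists k => //; exists j.
Qed.

Let avoid_d r (i : J r.+1) (k : J r) :
  ~` B r.+1 `&` bad alpha c (xcoef (dl r i k)) p (B r) = set0.
Proof.
apply/seteqP; split => // x [nB bx]; apply: nB.
by right; exists i => //; exists k.
Qed.

Lemma wcutE r (j : I r.+1) i : incl (wcut j i) = chi (Yset j) *! W j i.
Proof. exact: (zincl_zcut c_inj (mY j) (avoid_w j i)). Qed.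
Lemma vcutE r (k : J r) j : incl (vcut k j) = chi (~` B r) *! f k j.
Proof. exact: (zincl_zcut c_inj (measurableC (mB r)) (avoid_v k j)). Qed.

Lemma wcut_in r (j : I r.+1) i : (r < n.+1)%N -> wcut j i * chi (Yset i) = wcut j i.
Proof.
move=> rn; apply: cp_indic_setD => //; first exact: mk_measurable.
  apply: (zcut_mem c_inj (mY j) (avoid_w j i)); first exact: mk_measurable.
  by have /(in_modP ext) := W_in j rn.
exact: (zcut_avoid c_inj (mY j) (mU i) (avoid_w j i)).
Qed.

Lemma vcut_in r (k : J r) j : (r <= n.+1)%N -> vcut k j * chi (Yset j) = vcut k j.
Proof.
move=> rn; have mCB := measurableC (mB r).
apply: cp_indic_setD => //; first exact: mk_measurable.
  apply: (zcut_mem c_inj mCB (avoid_v k j)); first exact: mk_measurable.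
  by have [/(_ _ k rn) /(in_modP ext) h _ _] := fP.
exact: (zcut_avoid c_inj mCB (mU j) (avoid_v k j)).
Qed.

Lemma mem_Yset r (j : I r) (s : CP) : s * chi (Yset j) = s -> s * chi (A r j) = s.
Proof.
by apply: cp_indic_sub => //; [exact: mk_measurable|move=> x []].
Qed.

(** Cutting row j changes the differential only outside [Yset j], and x j absorbs the indicator of
    that set. So on the reduced modules the cut differential is that of D, and identities can be
    checked in D because [incl] is injective. *)
Lemma incl_wcut r (x : I r.+1 -> CP) i : (r < n.+1)%N ->
  (forall j, x j * chi (Yset j) = x j) ->
  incl (\sum_j x j * wcut j i) = mr_d D r (vincl ext x : V r.+1) i.
Proof.
move=> rn hx; rewrite (vincl_gen ext (w := x)); last by move=> j; exact: mem_Yset.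
rewrite (hom_comb ext (mr_d_hom D rn)); last exact: in_mod_gen.
rewrite fct_sumE zincl_sum; apply: eq_bigr => j _.
by rewrite zinclM wcutE -zmulA hx.
Qed.

Lemma wcut_wcut r (j : I r.+2) i : (r.+1 < n.+1)%N ->
  \sum_k wcut j k * wcut k i = 0.
Proof.
move=> rn; apply: (zincl_inj (ext := ext)); rewrite incl_wcut; first last.
- by move=> k; exact: wcut_in.
- exact: ltnW.
have -> : vincl ext (wcut j) = smul (incl (chi (Yset j))) (W j) :> V r.+1.
  by apply: funext => k; exact: wcutE.
have [_ _ dZ] := mr_d_hom D (ltnW rn).
rewrite dZ; last exact: W_in.
by rewrite mr_dd ?smul0 ?zincl0//; exact: in_mod_gen.
Qed.

(** The chain map identity of f survives the cuts after multiplication by the indicator of the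
    complement of [B r.+1]; [fhat] and [hmat] repair what is lost over [B r.+1]. *)
Lemma vcut_wcut r (i : J r.+1) l : (r < n.+1)%N ->
  \sum_j vcut i j * wcut j l = chi (~` B r.+1) * \sum_k dl r i k * vcut k l.
Proof.
move=> rn; have [f_in fd _] := fP; apply: (zincl_inj (ext := ext)).
rewrite incl_wcut//; last first.
  by move=> j; exact: vcut_in.
have -> : vincl ext (vcut i) = smul (incl (chi (~` B r.+1))) (f i) :> V r.+1.
  by apply: funext => k; exact: vcutE.
have [_ _ dZ] := mr_d_hom D rn.
rewrite dZ ?fd//; last exact: f_in.
rewrite smul_sumr fct_sumE mulr_sumr zincl_sum; apply: eq_bigr => k _.
rewrite mulrA zinclM vcutE -zmulA -smulA /smul; congr (_ *! _).
(* Off [B r.+1] the coefficients of [dl r i k] end off [B r], so the indicator produced by cutting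
   [f r k] is absorbed. *)
apply: xringP => g; rewrite xcoef_Mindic !xcoef_indicM.
by rewrite -(bad_avoid g (mB r) (measurableC (mB r.+1)) (avoid_d i k)).
Qed.

(** Off [B r.+1] the differential of L does not reach the new summands of degree r. Hence the cut
    lift, which has no component there, is correct. *)
Lemma indic_d_indic r (i : J r.+1) (k : J r) :
  chi (~` B r.+1) * dl r i k * chi (B r) = 0.
Proof.
have e : chi (~` B r.+1) * dl r i k * chi (~` B r) = chi (~` B r.+1) * dl r i k.
  apply: xringP => g; rewrite xcoef_Mindic !xcoef_indicM.
  by rewrite -(bad_avoid g (mB r) (measurableC (mB r.+1)) (avoid_d i k)).
rewrite -e -mulrA -cp_indicI//; last exact: measurableC.
by rewrite setICl cp_indic0 mulr0.
Qed.

Definition hset r (a : I r + J r) : set X :=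
  match a with inl j => Yset j | inr _ => B r end.

Lemma measurable_hset r a : measurable (@hset r a).
Proof. by case: a => [j|k]; [exact: mY|exact: mB]. Qed.

Definition hmod r : marked X := Marked (@measurable_hset r).

(* The image of the generator i of L: its lift is cut off B r, and the new summand
   <B r> with index i takes care of the points of B r. *)
Definition fhat r (i : J r) (a : I r + J r) : CP :=
  match a with inl j => vcut i j | inr k => if k == i then chi (B r) else 0 end.

(** The row of a new generator is forced by the chain map condition: it is the boundary of i in L,
    carried over by [fhat] in degree r and restricted to [B r.+1]. *)
Definition hmat r (b : I r.+1 + J r.+1) (a : I r + J r) : CP :=
  match b with
  | inl j => if a is inl i then wcut j i else 0
  | inr i => chi (B r.+1) * \sum_k dl r i k * fhat k a
  end.

Lemma fhat_in r (i : J r) a : (r <= n.+1)%N -> fhat i a * chi (hset a) = fhat i a.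
Proof.
move=> rn; case: a => [j|k] /=; first exact: vcut_in.
by case: eqP => _; rewrite ?mul0r// cp_indicM.
Qed.

Lemma hmat_in r b a : (r < n.+1)%N -> @hmat r b a * chi (hset a) = hmat b a.
Proof.
move=> rn; case: b => [j|i] /=.
  by case: a => [l|l] /=; [exact: wcut_in|rewrite mul0r].
rewrite -mulrA mulr_suml; congr (_ * _); apply: eq_bigr => k _.
by rewrite -mulrA fhat_in// ltnW.
Qed.

(** Split 1 as the sum of the indicators of [B r.+1] and of its complement. The new generator
    accounts for the first part, and the cut lift for the second by [vcut_wcut] and
    [indic_d_indic]. *)
Lemma fhat_hmat r (i : J r.+1) a : (r < n.+1)%N ->
  \sum_b fhat i b * hmat b a = \sum_k dl r i k * fhat k a.
Proof.
move=> rn; rewrite big_sumType /=.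
have -> : \sum_k (if k == i then chi (B r.+1) else 0) *
    (chi (B r.+1) * \sum_l dl r k l * fhat l a) =
    chi (B r.+1) * \sum_k dl r i k * fhat k a.
  rewrite (bigD1 i)//= eqxx [X in _ + X]big1 ?addr0; last first.
    by move=> k /negbTE ->; rewrite mul0r.
  by rewrite mulrA cp_indicM//.
have -> : \sum_j vcut i j * (if a is inl l then wcut j l else 0) =
    chi (~` B r.+1) * \sum_k dl r i k * fhat k a.
  case: a => [l|l]; first by rewrite vcut_wcut.
  rewrite big1 => [|j _]; last by rewrite mulr0.
  rewrite (bigD1 l)//= eqxx big1 => [|k kl]; last first.
    by rewrite eq_sym (negbTE kl) mulr0.
  by rewrite addr0 mulrA indic_d_indic.
by rewrite -mulrDl addrC cp_indicC// mul1r.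
Qed.

Lemma hmat_hmat r b a : (r.+1 < n.+1)%N ->
  \sum_e @hmat r.+1 b e * hmat e a = 0.
Proof.
move=> rn; case: b => [j|i] /=.
  rewrite big_sumType /= [X in _ + X]big1 ?addr0; last first.
    by move=> k _; rewrite mul0r.
  case: a => [l|l]; first by rewrite wcut_wcut.
  by rewrite big1// => k _; rewrite mulr0.
under eq_bigr => e _ do rewrite -mulrA mulr_suml.
rewrite -mulr_sumr exchange_big /=.
under eq_bigr => k _.
  under eq_bigr => e _ do rewrite -mulrA.
  rewrite -mulr_sumr fhat_hmat; last exact: ltnW.
  rewrite mulr_sumr; under eq_bigr => l _ do rewrite mulrA -grpring_inclM.
  over.
rewrite exchange_big /= big1 ?mulr0// => l _.
rewrite -mulr_suml -grpring_incl_sum.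
have := congr1 (fun M => fun_of_matrix M i l) (fc_dd L r); rewrite !mxE => ->.
by rewrite grpring_incl0 mul0r.
Qed.

(** The values are not restricted to [Yset j] or [B 0]: elements of the modules absorb these
    indicators themselves. *)
Definition heta_row (a : I 0 + J 0) : Linf mu Z :=
  match a with inl j => mr_eta D (gen ext j : V 0) | inr i => linf_const mu (fc_aug L i) end.

(** A marked complex has differentials in all degrees while D controls only those with r at most n;
    the later ones are set to 0. *)
Definition hd r (z : vec CS (hmod r.+1)) : vec CS (hmod r) :=
  fun a => if (r < n.+1)%N then \sum_b (z b : CP) * hmat b a else 0.

Definition heta (z : vec CS (hmod 0)) : Linf mu Z := \sum_a cp_act (z a) (heta_row a).

Lemma eta_vincl (x : I 0 -> CP) : (forall j, x j * chi (Yset j) = x j) ->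
  \sum_j cp_act (x j) (mr_eta D (gen ext j : V 0)) = mr_eta D (vincl ext x : V 0).
Proof.
move=> hx; rewrite (vincl_gen ext (w := x)); last by move=> j; exact: mem_Yset.
by rewrite (aug_hom_comb ext (mr_eta_hom D))//; exact: in_mod_gen.
Qed.

Lemma heta_fhat i : heta (@fhat 0 i) = linf_const mu (fc_aug L i).
Proof.
have [f_in _ feta] := fP; have [_ eZ] := mr_eta_hom D.
rewrite /heta big_sumType /= eta_vincl; last by move=> j; exact: vcut_in.
have -> : vincl ext (vcut i) = smul (incl (chi (~` B 0))) (f i) :> V 0.
  by apply: funext => k; exact: vcutE.
rewrite eZ ?feta ?ce_act; last exact: f_in.
rewrite (bigD1 i)//= eqxx big1 => [|k /negbTE ->]; last by rewrite cp_act0l.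
by rewrite addr0 -cp_actDl addrC cp_indicC// cp_act1.
Qed.

Lemma heta_hmat b : \sum_a cp_act (@hmat 0 b a) (heta_row a) = 0.
Proof.
case: b => [j|i].
  rewrite big_sumType /= [X in _ + X]big1 ?addr0; last first.
    by move=> k _; rewrite cp_act0l.
  rewrite eta_vincl; last by move=> k; exact: wcut_in.
  have -> : vincl ext (wcut j) = smul (incl (chi (Yset j))) (W j) :> V 0.
    by apply: funext => k; exact: wcutE.
  have [_ eZ] := mr_eta_hom D.
  rewrite eZ; last exact: W_in.
  by rewrite mr_eta_d ?ce_act ?cp_act0r//; exact: in_mod_gen.
under eq_bigr => a _ do rewrite /= cp_actA cp_act_suml.
rewrite -cp_act_sumr exchange_big /=.
under eq_bigr => k _.
  under eq_bigr => a _ do rewrite cp_actA.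
  rewrite -cp_act_sumr -/(heta (fhat k)) heta_fhat cp_act_const.
  over.
rewrite -linf_const_sum.
rewrite [X in linf_const _ X](_ : _ = row_aug (fc_aug L) (row i (fc_d L 0))).
  by rewrite fc_aug_d linf_const0 cp_act0r.
by apply: eq_bigr => k _; rewrite mxE.
Qed.

Lemma hin_modP r (z : vec CS (hmod r)) :
  in_mod z <-> forall a, (z a : CP) * chi (hset a) = z a.
Proof.
by split=> h a; have := cp_mem_indic (z a : CP) (measurable_hset a) => -[h1 h2]; auto.
Qed.

Lemma hd_hom r : is_hom (@hd r).
Proof.
split.
- move=> z _; apply/hin_modP => a; rewrite /hd; case: ifP => rn; last by rewrite mul0r.
  by rewrite mulr_suml; apply: eq_bigr => b _; rewrite -mulrA hmat_in.
- move=> z z' _ _; apply: funext => a; rewrite -[RHS]/((hd z a : CP) + (hd z' a : CP)) /hd.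
  case: ifP => _; last by rewrite addr0.
  by rewrite -big_split; apply: eq_bigr => b _; exact: mulrDl.
- move=> s z _; apply: funext => a; rewrite /smul /= /hd.
  case: ifP => _; last by rewrite mulr0.
  by rewrite mulr_sumr; apply: eq_bigr => b _; rewrite mulrA.
Qed.

Lemma hd_hd r (z : vec CS (hmod r.+2)) : in_mod z -> hd (hd z) = 0.
Proof.
move=> _; apply: funext => a; rewrite {1}/hd; case: ifP => // rn.
rewrite /hd; have [rn1|_] := ltnP r.+1 n.+1; last first.
  by rewrite big1// => b _; rewrite mul0r.
under eq_bigr => b _ do rewrite mulr_suml.
rewrite exchange_big big1// => b _ /=.
under eq_bigr => e _ do rewrite -mulrA.
by rewrite -mulr_sumr hmat_hmat// mulr0.
Qed.

Lemma heta_hom : is_aug_hom heta.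
Proof.
split=> [z z' _ _|s z _]; rewrite /heta.
  by rewrite -big_split; apply: eq_bigr => a _; exact: (cp_actDl (heta_row a)).
by rewrite /= cp_act_sumr; apply: eq_bigr => a _; rewrite -cp_actA.
Qed.

Lemma heta_hd (z : vec CS (hmod 1)) : in_mod z -> heta (hd z) = 0.
Proof.
move=> _; rewrite /heta /hd /=.
under eq_bigr => a _ do rewrite cp_act_suml.
rewrite exchange_big big1// => b _ /=.
under eq_bigr => a _ do rewrite cp_actA.
by rewrite -cp_act_sumr heta_hmat cp_act0r.
Qed.

Definition hmap r (u : 'rV[ZG]_(fc_rank L r)) : vec CS (hmod r) :=
  fun a => \sum_i gi (u 0 i) * fhat i a.

Lemma hmap_in r u : (r <= n.+1)%N -> in_mod (@hmap r u).
Proof.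
move=> rn; apply/hin_modP => a; rewrite /hmap mulr_suml; apply: eq_bigr => i _.
by rewrite -mulrA fhat_in.
Qed.

Lemma hmapP r s (u v : 'rV[ZG]_(fc_rank L r)) :
  hmap (s *: u + v) = smul (gi s : CS) (hmap u) + hmap v.
Proof.
apply: funext => a; rewrite -[RHS]/((gi s : CP) * hmap u a + (hmap v a : CP)).
rewrite /hmap mulr_sumr -big_split.
apply: eq_bigr => i _ /=.
by rewrite !mxE grpring_inclD grpring_inclM mulrDl mulrA.
Qed.

Lemma hmap_d r (u : 'rV[ZG]_(fc_rank L r.+1)) : (r < n.+1)%N ->
  hmap (u *m fc_d L r) = hd (hmap u).
Proof.
move=> rn; apply: funext => a; rewrite /hd rn /hmap.
under [RHS]eq_bigr => b _ do rewrite mulr_suml.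
rewrite [RHS]exchange_big /=.
under [RHS]eq_bigr => i _.
  under eq_bigr => b _ do rewrite -mulrA.
  rewrite -mulr_sumr fhat_hmat// mulr_sumr.
  under eq_bigr => k _ do rewrite mulrA -grpring_inclM.
  over.
rewrite [RHS]exchange_big /=; apply: eq_bigr => k _.
by rewrite mxE grpring_incl_sum mulr_suml.
Qed.

Lemma heta_hmap u : heta (@hmap 0 u) = linf_const mu (row_aug (fc_aug L) u).
Proof.
rewrite /heta /hmap; under eq_bigr => a _ do rewrite cp_act_suml.
rewrite exchange_big linf_const_sum; apply: eq_bigr => i _ /=.
under eq_bigr => a _ do rewrite cp_actA.
by rewrite -cp_act_sumr -/(heta (fhat i)) heta_fhat cp_act_const.
Qed.

Hypothesis augL : exists u : 'rV[ZG]_(fc_rank L 0), row_aug (fc_aug L) u = 1.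

(** Surjectivity of [mr_eta D] may be lost by cutting. But the enlarged complex receives L, whose
    augmentation reaches 1, and the element (g, 1) of the crossed product sends the constant 1 to
    g. *)
Lemma heta_surj (g : Linf mu Z) : exists2 z : vec CS (hmod 0), in_mod z & heta z = g.
Proof.
have [u u1] := augL; pose s : CP := xelt (linf_action alpha Z) g 1%g.
have hu : in_mod (@hmap 0 u) by exact: hmap_in.
exists (smul (s : CS) (hmap u)).
  by have [h _ _] := hd_hom 0; move: hu => /hin_modP hu; apply/hin_modP => a;
     rewrite /smul /= -mulrA hu.
have [_ ->] := heta_hom => //; rewrite heta_hmap u1 linf_const1 /= cp_act_elt.
by rewrite linf_trans1 mulr1.
Qed.

Definition hcomplex : marked_complex CS :=
  MarkedComplex hd_hom hd_hd heta_hom heta_surj heta_hd.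

Lemma hcomplex_embedding (C : resolution Z G)
    (psi : forall k, res_mod C k -> 'rV_(fc_rank L k)) :
  (forall k a x y, (k <= n.+1)%N -> psi k (a *: x + y) = a *: psi k x + psi k y) ->
  (forall k x, (k < n.+1)%N -> psi k (res_d C k x) = psi k.+1 x *m fc_d L k) ->
  (forall x, row_aug (fc_aug L) (psi 0%N x) = res_aug C x) ->
  alpha_embedding C n hcomplex.
Proof.
move=> psiL psid psia; exists (fun k x => hmap (psi k x)).
have psi0 k : (k <= n.+1)%N -> psi k 0 = 0.
  move=> kn; have := psiL k 1 0 0 kn; rewrite !scale1r !addr0 => h.
  by apply: (@addrI _ (psi k 0)); rewrite -h addr0.
have hmap0 k : hmap (0 : 'rV_(fc_rank L k)) = 0.
  by apply: funext => a; rewrite /hmap big1// => i _; rewrite mxE grpring_incl0 mul0r.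
split.
- by move=> k x kn; exact: hmap_in.
- move=> k x y kn; have := psiL k 1 x y kn; rewrite !scale1r => ->.
  rewrite -{1}[psi k x]scale1r hmapP; congr (_ + _); apply: funext => a.
  rewrite /smul /=; set t := gi 1; have -> : t = 1; last by rewrite mul1r.
  apply: xringP => g; rewrite xcoef1 -[LHS]/(linf_const mu ((1 : ZG) g)) xcoef1.
  by case: eqP => _; rewrite ?linf_const1 ?linf_const0.
- move=> k s x kn; have := psiL k s x 0 kn; rewrite psi0// !addr0 => ->.
  by rewrite -[s *: _]addr0 hmapP hmap0 addr0.
- by move=> k x kn; rewrite psid// hmap_d.
- by move=> x; rewrite -psia; exact: heta_hmap.
Qed.

(** * Bounds on dimension and lognorm *)

Section Bounds.
Variable E : measured_equivalence mu.
Hypothesis diagX : measurable [set q : X * X | q.1 = q.2].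
Hypothesis hE : meq_rel E = orbit_rel alpha.
Local Open Scope ereal_scope.

Let nrmE0 : nrm (0 : CP) = 0.
Proof. exact: (nrm0 Z c_inj diagX hE). Qed.

Lemma mdim_hmod r :
  mdim mu (hmod r) <= mdim mu (mr_mod D r) + \sum_(i : J r) mu (B r).
Proof.
rewrite /mdim big_sumType /=; apply: leeD2r; apply: lee_sum => j _.
apply: le_measure; rewrite ?inE//; first exact: mk_measurable.
by move=> x [].
Qed.

Let norm1_hmod r (z : vec CS (hmod r)) :
  norm1 z = \sum_j nrm (z (inl j) : CP) + \sum_i nrm (z (inr i) : CP).
Proof. by rewrite /norm1 big_sumType. Qed.

Lemma mdim_ge0 (M : marked X) : 0 <= mdim mu M.
Proof. by apply: sume_ge0 => i _; exact: measure_ge0. Qed.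

Lemma logp_ge0 (x : \bar R) : 0 <= logp x.
Proof. by rewrite /logp le_max lexx orbT. Qed.

Lemma le_logp (x y : \bar R) : 0 <= x -> x <= y -> logp x <= logp y.
Proof.
move=> x0 xy; rewrite /logp ge_max !le_max lexx orbT andbT lee_lne ?xy//.
  by rewrite in_itv /= x0 leey.
by rewrite in_itv /= (le_trans x0 xy) leey.
Qed.

Lemma opnorm_ge0 (T : scalars mu Z) (M N : marked X) (h : vec T M -> vec T N) :
  0 <= opnorm h.
Proof. by apply: le_ereal_inf_tmp => _ [k [k0 _] <-]; rewrite lee_fin. Qed.

Lemma rk_ge0 (T : scalars mu Z) (M N : marked X) (h : vec T M -> vec T N) : 0 <= rk h.
Proof. by apply: le_ereal_inf_tmp => _ [C [mC [_ _ ->]]]; exact: mdim_ge0. Qed.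

Section CutPiece.
Variables (C : I n.+1 -> set X) (mC : forall j, measurable (C j)).
Hypothesis subC : forall j, C j `<=` A n.+1 j.
Variables (H : I n.+1 + J n.+1 -> set X) (mH : forall a, measurable (H a)).
Hypothesis Hl : forall j, H (inl j) = C j `\` U n.+1 j.
Hypothesis Hr : forall i, H (inr i) = set0.
Local Notation MC := (@Marked _ X _ C mC).
Local Notation MH := (@Marked _ X _ H mH).

(** The cut piece embeds isometrically into the piece [MC] of D, and its components at new
    generators vanish. With [hd_inl] and [hd_inr] the last differential restricts to that of D, so
    bounds over D carry over. *)
Let hpart (z : vec CS MH) : in_mod z ->
  [/\ forall j, ((z (inl j) : CP) * chi (Yset j) = z (inl j))%R,
      @in_mod _ _ _ _ _ S MC (vincl ext (fun j => z (inl j)) : vec S MC),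
      forall j, z (inr j) = 0%R :> CP &
      norm1 z = norm1 (vincl ext (fun j => z (inl j)) : vec S MC)].
Proof.
move=> hz.
have zH a : ((z a : CP) * chi (H a) = z a)%R.
  by have := cp_mem_indic (z a : CP) (mH a) => -[h1 _]; exact: h1.
have mHl j : measurable (C j `\` U n.+1 j) by exact: measurableD.
have zr j : z (inr j) = 0%R :> CP by rewrite -(zH (inr j)) Hr cp_indic0 mulr0.
have zC j : ((z (inl j) : CP) * chi (C j) = z (inl j))%R.
  by have := zH (inl j); rewrite Hl; apply: cp_indic_sub => //; move=> x [].
split => //.
- move=> j; have := zH (inl j); rewrite Hl; apply: cp_indic_sub => //.
  by move=> x [Cx Ux]; split => //; exact: subC.
- apply/(in_modP ext) => i.
  by rewrite /vincl zincl_Mindic ?zC//; exact: (@mk_measurable _ _ MC).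
- rewrite /norm1 big_sumType /= [X in _ + X]big1 ?adde0.
    by apply: eq_bigr => j _; rewrite /vincl ce_norm.
  by move=> i _; rewrite zr; exact: nrmE0.
Qed.

Let hd_inl (z : vec CS MH) i : in_mod z ->
  incl (hd (z : vec CS (hmod n.+1)) (inl i)) =
  mr_d D n (vincl ext (fun j => z (inl j)) : V n.+1) i.
Proof.
move=> hz; have [zY _ zr _] := hpart hz.
rewrite -(@incl_wcut n (fun j => z (inl j)))//; congr incl.
rewrite /hd ltnSn big_sumType /= [X in (_ + X)%R]big1 ?addr0// => k _.
by rewrite zr mul0r.
Qed.

Let hd_inr (z : vec CS MH) i : in_mod z ->
  hd (z : vec CS (hmod n.+1)) (inr i) = 0%R :> CP.
Proof.
move=> hz; have [zY _ zr _] := hpart hz.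
rewrite /hd ltnSn big_sumType /= !big1 ?addr0// => k _; last by rewrite mulr0.
by rewrite zr mul0r.
Qed.

Lemma opnorm_cut : @opnorm _ _ _ _ _ CS MH (hmod n) (@hd n) <=
  @opnorm _ _ _ _ _ S MC (mr_mod D n) (mr_d D n).
Proof.
apply: le_ereal_inf => _ [k [k0 hk] <-]; exists k => //; split => // z hz.
have [_ hx _ ->] := hpart hz.
rewrite norm1_hmod [X in _ + X]big1 ?adde0; last first.
  by move=> i _; rewrite hd_inr.
apply: le_trans (hk _ hx); apply: lee_sum => i _.
by rewrite -hd_inl// ce_norm.
Qed.

(** A summand T containing the image over D may be shrunk to T without the sets U, since the image
    of [hd] already avoids U, and it needs no part in the new summands. *)
Lemma rk_cut : @rk _ _ _ _ _ CS MH (hmod n) (@hd n) <=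
  @rk _ _ _ _ _ S MC (mr_mod D n) (mr_d D n).
Proof.
apply: le_ereal_inf_tmp => _ [T [mT [subT hT ->]]].
pose T' (a : I n + J n) := if a is inl i then T i `\` U n i else set0.
have mT' a : measurable (T' a) by rewrite /T'; case: a => [i|//]; exact: measurableD.
apply: (@le_trans _ _ (mdim mu (Marked mT'))); last first.
  rewrite /mdim big_sumType /= [X in _ + X]big1 ?adde0; last by move=> i _; rewrite measure0.
  apply: lee_sum => i _; apply: le_measure; rewrite ?inE//.
  exact: measurableD.
apply: ereal_inf_lbound; exists T', mT'; split => //.
  by case=> [i|i] //= x [Tx Ux]; split => //; exact: subT.
move=> z hz a; apply/(cp_mem_indic _ (mT' a)).
case: a => [i|i]; last by rewrite hd_inr// mul0r.
have [_ hx _ _] := hpart hz.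
apply: cp_indic_setD => //.
  apply: (zincl_inj (ext := ext)); rewrite -zincl_Mindic// hd_inl//.
  by have /(in_modP ext)/(_ i) := hT _ hx.
have [hin _ _] := hd_hom n.
have : ((hd (z : vec CS (hmod n.+1)) (inl i) : CP) * chi (Yset i))%R =
    hd (z : vec CS (hmod n.+1)) (inl i) :> CP.
  rewrite /hd ltnSn mulr_suml; apply: eq_bigr => b _.
  by rewrite -mulrA (hmat_in b (inl i)).
apply: cp_indic_sub => //; first exact: measurableC.
by move=> x [].
Qed.

Lemma lognorm_cut : @lognorm' _ _ _ _ _ CS MH (hmod n) (@hd n) <=
  @lognorm' _ _ _ _ _ S MC (mr_mod D n) (mr_d D n).
Proof.
have lg : logp (@opnorm _ _ _ _ _ CS MH (hmod n) (@hd n)) <=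
    logp (@opnorm _ _ _ _ _ S MC (mr_mod D n) (mr_d D n)).
  by apply: le_logp; [exact: opnorm_ge0|exact: opnorm_cut].
rewrite /lognorm' le_min !ge_min; apply/andP; split; apply/orP; [left|right].
  apply: lee_pmul => //; [exact: mdim_ge0|exact: logp_ge0|].
  rewrite /mdim big_sumType /= [X in _ + X]big1 ?adde0; last first.
    by move=> i _; rewrite Hr measure0.
  apply: lee_sum => j _; rewrite Hl; apply: le_measure; rewrite ?inE//.
  exact: measurableD.
by apply: lee_pmul => //; [exact: rk_ge0|exact: logp_ge0|exact: rk_cut].
Qed.

End CutPiece.

Section ExtraPiece.
Variables (kf : forall r, J r -> I r -> R) (kd : forall r, J r.+1 -> J r -> R).
Hypothesis kfP : forall r i j, rbound (coef (f i j)) (@kf r i j).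
Hypothesis kdP : forall r i k, rbound (xcoef (dl r i k)) (@kd r i k).

Definition kfhat r (i : J r) (a : I r + J r) : R :=
  if a is inl j then kf i j else 1%R.
(** A row bound for the new rows of [hmat] that does not mention p: the indicators have bound 1, and
    the cut lifts keep the bounds of f. *)
Definition kmat r (i : J r.+1) (a : I r + J r) : R :=
  (\sum_k kfhat k a * kd i k)%R.

Let rbound_fhat r (i : J r) a : rbound (xcoef (fhat i a)) (kfhat i a).
Proof.
case: a => [j|k] /=; first by apply: rbound_zcut => //; exact: measurableC.
case: eqP => _; first exact: rbound_indic.
have [_ h] := rbound0 mu Z G; split=> // q uq.
by apply: filterS (h q uq) => x hx; exact: le_trans hx ler01.
Qed.

Let rbound_hmat r (i : J r.+1) a : rbound (xcoef (hmat (inr i) a)) (kmat i a).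
Proof.
rewrite -[hmat _ _]/(chi (B r.+1) * \sum_k dl r i k * fhat k a)%R.
rewrite -xscale_xcoef -[kmat i a]mulr1; apply: (rboundM c_inj).
  exact: rbound_indic.
rewrite /kmat; elim: (index_enum _) => [|k s IH].
  by rewrite !big_nil; exact: rbound0.
have h : rbound (xcoef (dl r i k * fhat k a)%R) (kfhat k a * kd i k).
  by rewrite -xscale_xcoef; apply: (rboundM c_inj).
by rewrite !big_cons; exact: (rboundD c_inj h IH).
Qed.

Variables (H : I n.+1 + J n.+1 -> set X) (mH : forall a, measurable (H a)).
Hypothesis Hl : forall j, H (inl j) = set0.
Hypothesis Hr : forall i, H (inr i) = B n.+1.
Local Notation MH := (@Marked _ X _ H mH).

(** The sum over i is a crude replacement for the maximum of the row sums; only its independence of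
    p matters. *)
Let kappa : R := (\sum_(i : J n.+1) \sum_a kmat i a)%R.

Let kmat_ge0 i a : (0 <= @kmat n i a)%R.
Proof. by case: (rbound_hmat i a). Qed.

Lemma opnorm_extra : @opnorm _ _ _ _ _ CS MH (hmod n) (@hd n) <= kappa%:E.
Proof.
apply: ereal_inf_lbound; exists kappa => //; split.
  by apply: sumr_ge0 => i _; apply: sumr_ge0 => a _.
move=> z hz.
have zl j : z (inl j) = 0%R :> CP.
  have := cp_mem_indic (z (inl j) : CP) (mH (inl j)) => -[h1 _].
  by rewrite -(h1 (hz (inl j))) Hl cp_indic0 mulr0.
have hdE a : hd (z : vec CS (hmod n.+1)) a =
    (\sum_(i : J n.+1) (z (inr i) : CP) * hmat (inr i) a)%R :> CP.
  rewrite /hd ltnSn big_sumType /= [X in (X + _)%R]big1 ?add0r// => j _.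
  by rewrite zl mul0r.
have nz : norm1 z = \sum_(i : J n.+1) nrm (z (inr i) : CP).
  rewrite /norm1 big_sumType /= [X in X + _]big1 ?add0e// => j _.
  by rewrite zl; exact: nrmE0.
rewrite nz /norm1.
apply: (@le_trans _ _ (\sum_a \sum_(i : J n.+1) (kmat i a)%:E * nrm (z (inr i) : CP))).
  apply: lee_sum => a _; rewrite hdE.
  apply: (le_trans (nrm_sum c_inj diagX hE _ _)); apply: lee_sum => i _.
  exact: (nrmM c_inj diagX hE).
rewrite exchange_big ge0_sume_distrr//=; last by move=> i _; exact: (nrm_ge0 c_inj diagX hE).
apply: lee_sum => i _.
rewrite -ge0_sume_distrl; last by move=> a _; rewrite lee_fin.
apply: lee_wpmul2r; first exact: (nrm_ge0 c_inj diagX hE).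
rewrite sumEFin lee_fin /kappa (bigD1 i)//= lerDl.
by apply: sumr_ge0 => l _; apply: sumr_ge0 => a _.
Qed.

Lemma lognorm_extra : @lognorm' _ _ _ _ _ CS MH (hmod n) (@hd n) <=
  (\sum_(i : J n.+1) mu (B n.+1)) * logp kappa%:E.
Proof.
(* The dimension term of the minimum is the one taken, because the dimension of this piece tends to
   0. *)
rewrite /lognorm' ge_min; apply/orP; left; apply: lee_pmul => //.
- exact: mdim_ge0.
- exact: logp_ge0.
- rewrite /mdim big_sumType /= [X in X + _]big1 ?add0e; last first.
    by move=> i _; rewrite Hl measure0.
  by apply: lee_sum => i _; rewrite Hr.
- by apply: le_logp; [exact: opnorm_ge0|exact: opnorm_extra].
Qed.

End ExtraPiece.

(** A decomposition for D gives one for the enlarged complex: each piece is cut by the sets U, and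
    one further piece collects all new summands. *)
Lemma lognorm_hd (kf : forall r, J r -> I r -> R) (kd : forall r, J r.+1 -> J r -> R)
    (K : nat) (C : 'I_K -> I n.+1 -> set X) (mC : forall k j, measurable (C k j)) :
  (forall r i j, rbound (coef (f i j)) (@kf r i j)) ->
  (forall r i k, rbound (xcoef (dl r i k)) (@kd r i k)) ->
  (forall j, A n.+1 j = \bigcup_k C k j) ->
  (forall j, trivIset setT (fun k => C k j)) ->
  lognorm (@hd n) <=
  \sum_(k < K) @lognorm' _ _ _ _ _ S (Marked (mC k)) (mr_mod D n) (mr_d D n) +
  (\sum_(i : J n.+1) mu (B n.+1)) *
    logp (\sum_(i : J n.+1) \sum_a kmat kf kd i a)%R%:E.
Proof.
move=> kfP kdP AC tC.
(* Indices below K stand for the cut pieces, the last index for the new summands. *)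
pose H (k : 'I_(K + 1)) (a : I n.+1 + J n.+1) : set X :=
  match fintype.split k, a with
  | inl k', inl j => C k' j `\` U n.+1 j
  | inr _, inr _ => B n.+1
  | _, _ => set0 end.
have mH k a : measurable (H k a).
  by rewrite /H; case: (fintype.split k) => k'; case: a => j //; exact: measurableD.
have splitl (k : 'I_K) : fintype.split (lshift 1 k) = inl k.
  exact: (unsplitK (inl k)).
have splitr (k : 'I_1) : fintype.split (rshift K k) = inr k.
  exact: (unsplitK (inr k)).
apply: (@le_trans _ _ (\sum_(k < K + 1)
  @lognorm' _ _ _ _ _ CS (Marked (mH k)) (hmod n) (@hd n))).
  apply: ereal_inf_lbound; exists (K + 1)%N, H, mH; split => //.
    case=> [j|i] /=; apply/seteqP; split => x.
    - move=> [Ax Ux]; have := Ax; rewrite AC => -[k _ Cx].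
      by exists (lshift 1 k) => //; rewrite /H splitl.
    - move=> [k _]; rewrite /H; case: (fintype.split k) => // k' [Cx Ux]; split => //.
      by rewrite AC; exists k'.
    - by move=> Bx; exists (rshift K ord0) => //; rewrite /H splitr.
    - by move=> [k _]; rewrite /H; case: (fintype.split k).
  case=> [j|i]; apply/trivIsetP => k l _ _ kl; apply/seteqP; split => // x [].
    rewrite /H; case ek : (fintype.split k) => [k'|//]; case el : (fintype.split l) => [l'|//].
    move=> [Ck _] [Cl _]; have kl' : k' != l'.
      by apply/eqP => e; move/eqP: kl; apply; rewrite -(fintype.splitK k) ek e -el fintype.splitK.
    have /trivIsetP/(_ k' l' Logic.I Logic.I) := tC j.
    by move=> /(_ kl') <-.
  rewrite /H; case ek : (fintype.split k) => [//|k']; case el : (fintype.split l) => [//|l'] _ _.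
  by move/eqP: kl; apply; rewrite -(fintype.splitK k) -(fintype.splitK l) ek el !ord1.
rewrite big_split_ord /=; apply: leeD.
  apply: lee_sum => k _; apply: lognorm_cut.
  - by move=> j; rewrite AC => x Cx; exists k.
  - by move=> j; rewrite /H splitl.
  - by move=> i; rewrite /H splitl.
rewrite big_ord1; apply: lognorm_extra => //.
- by move=> j; rewrite /H splitr.
- by move=> i; rewrite /H splitr.
Qed.

End Bounds.

End Approximation.

End Assembly.

(** * Letting the exceptional sets shrink *)

Lemma vanishing_sum d (X : measurableType d) (R : realType) (mu : probability X R)
    (V : nat -> set X) (m : nat) (e : R) : vanishing mu V -> 0 < e ->
  exists p, (\sum_(i < m) mu (V p) <= e%:E)%E.
Proof.
move=> [_ vV] e0; have m1 : 0 < m.+1%:R :> R by rewrite ltr0n.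
have [p _ hp] := vV _ (divr_gt0 e0 m1); exists p.
apply: (@le_trans _ _ (\sum_(i < m) (e / m.+1%:R)%:E)%E).
  by apply: lee_sum => i _; exact: hp p (leqnn p).
rewrite sumEFin lee_fin sumr_const card_ord -[leLHS]mulr_natr mulrAC.
by rewrite ler_pdivrMr// ler_pM2l// ler_nat.
Qed.

Lemma logp_fin (R : realType) (k : R) : exists2 l : R, 0 <= l & logp k%:E = l%:E.
Proof.
rewrite /logp /lne; case: ifP => _; first by exists 0; rewrite // max_r// leNye.
by exists (Num.max (ln k) 0); rewrite ?le_max ?lexx ?orbT// EFin_max.
Qed.

Theorem proposition1p11 (R : realType) (d : measure_display)
    (X : measurableType d) (mu : probability X R) (Z : coefficient)
    (E : measured_equivalence mu) (n : nat)
    (D : marked_resolution (ZR_scalars Z E) n.+1)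
    (G : groupType) (alpha : standard_action mu G) (C : resolution Z G) :
  standard_borel X R ->
  countable [set: G] ->
  type_FP n.+1 G ->
  meq_rel E = orbit_rel alpha ->
  free_resolution C ->
  (medim alpha C n <= mdim mu (mr_mod D n))%E /\
  (Z = CoefInt -> (mevol alpha C n <= lognorm (mr_d D n))%E).
Proof.
move=> /standard_borel_diag diagX /countable_injP[c cI] fpG hE freeC.
have c_inj : injective c by move=> g h; apply: cI; rewrite in_setT.
pose ext := zr_extension Z c_inj diagX hE.
have [L [psi [psiL psid psia]]] := type_FP_model fpG freeC.
have augL : exists u : 'rV[grpring Z G]_(fc_rank L 0), row_aug (fc_aug L) u = 1.
  by have [x x1] := @res_aug_surj _ _ C 1; exists (psi 0%N x); rewrite psia.
have [f fP] := lift_exists ext D L.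
pose Dh p := hcomplex c_inj fP p augL.
have Dh_emb p : alpha_embedding C n (Dh p).
  exact: (hcomplex_embedding c_inj fP p augL psiL psid psia).
split.
  apply/lee_addgt0Pr => e e0.
  have [p hp] := vanishing_sum (fc_rank L n) (vanishing_avoidL c_inj ext f n) e0.
  apply: (@le_trans _ _ (mdim mu (mc_mod (Dh p) n))).
    by apply: ereal_inf_lbound; exists (Dh p).
  exact: le_trans (mdim_hmod c_inj ext f p n) (leeD2l _ hp).
(* The decomposition of the source of the last differential of D is fixed first, then the row bounds
   and l; only afterwards is p chosen in terms of e. *)
move=> _; apply: le_ereal_inf_tmp => _ [K [B [mB [AB tB ->]]]].
apply/lee_addgt0Pr => e e0.
pose kf r i j := projT1 (cid (ce_rbound ext (f r i j))).
pose kd r i k := projT1 (cid (rbound_xring c_inj diagX hE (grpring_incl alpha (fc_d L r i k)))).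
have kfP r i j : rbound (ce_coef ext (f r i j)) (kf r i j) by rewrite /kf; case: cid.
have kdP r i k : rbound (xcoef (grpring_incl alpha (fc_d L r i k))) (kd r i k).
  by rewrite /kd; case: cid.
have bound p := lognorm_hd c_inj fP p diagX hE mB kfP kdP AB tB.
have [l l0 lE] := logp_fin (\sum_(i : 'I_(fc_rank L n.+1))
  \sum_(a : mk_ix (mr_mod D n) + 'I_(fc_rank L n)) kmat kf kd i a).
(* The divisor l + 1 covers the case l = 0. *)
have l1 : 0 < l + 1 by rewrite ltr_wpDl.
have [p hp] := vanishing_sum (fc_rank L n.+1)
  (vanishing_avoidL c_inj ext f n.+1) (divr_gt0 e0 l1).
apply: (@le_trans _ _ (lognorm (mc_d (Dh p) n))).
  by apply: ereal_inf_lbound; exists (Dh p).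
apply: (le_trans (bound p)); apply: leeD2l; rewrite lE.
apply: (@le_trans _ _ ((e / (l + 1))%:E * l%:E)%E).
  by apply: lee_wpmul2r; rewrite // lee_fin.
rewrite -EFinM lee_fin mulrAC ler_pdivrMr// ler_pM2l//.
by rewrite lerDl.
Qed.
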